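(* Fix real numbers $0<x_{\min}<x_{\max}$, $a\ge x_{\max}-x_{\min}$, $b\ge 1$ and $\varepsilon\in(0,1/2)$. Then there is a constant $c>0$ depending only on $\varepsilon,x_{\max},x_{\min}$ with the following property. Let $m=m_n\ge1$, $L=L_n\ge1$, $k=k_n\ge1$ be sequences of integers and $\sigma_z=\sigma_{z,n}\ge0$ a sequence of reals, indexed by $n\in\mathbb N$, such that $\log m=\Theta(\log n)$, $\log L=O(\log n)$, $k\le n^{1-2\varepsilon}$ and $$\max(\sigma_z^4,m^2,n^2)\,k\log n\le m^2n^{1-\varepsilon}L .$$ Suppose that $A_1=\dots=A_L=A\in\mathbb R^{m\times n}$, where $A$ has i.i.d. $N(0,1)$ entries. Then for all sufficiently large $n$, $$\sup_{\mathcal C\in\mathcal F_{a,b,k,n}}R_2^{\dagger}(\mathcal C,m,n,\sigma_z)\ \ge\ c\,\frac{\max(\sigma_z^4,m^2,n^2)\,k\log n}{m^2nL}.$$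
   Context: Model (fixed forward operator): $\boldsymbol x_o\in\mathbb R^n$ is an unknown vector and $X_o=\mathrm{diag}(\boldsymbol x_o)$. One observes $\boldsymbol y_l=AX_o\boldsymbol w_l+\boldsymbol z_l\in\mathbb R^m$ for $l=1,\dots,L$, with the same matrix $A$ in all looks, where $\boldsymbol w_1,\dots,\boldsymbol w_L$ are i.i.d. $N(0,I_n)$, $\boldsymbol z_1,\dots,\boldsymbol z_L$ are i.i.d. $N(0,\sigma_z^2I_m)$, and $A$, $(\boldsymbol w_l)$, $(\boldsymbol z_l)$ are mutually independent. The matrix $A$ is known to the estimator. Minimax risk: $R_2^{\dagger}(\mathcal C,m,n,\sigma_z)=\inf_{\hat{\boldsymbol x}}\sup_{\boldsymbol x_o\in\mathcal C}\mathbb E\left[\|\hat{\boldsymbol x}-\boldsymbol x_o\|_2^2/n\right]$, where the infimum is over all measurable estimators $\hat{\boldsymbol x}$ that are functions of $\boldsymbol y_1,\dots,\boldsymbol y_L$ and $A$, and the expectation is over all the randomness (including $A$). The dependence on $L$ is suppressed in the notation. Signal classes: for $\mathcal C\subset\mathbb R^n$, $N_\eta(\mathcal C)$ denotes the $\eta$-covering number, i.e. the least number of $\ell_2$-balls of radius $\eta$ covering $\mathcal C$. $\mathcal F_{a,b,k,n}$ denotes the collection of all nonempty subsets $\mathcal C\subset[x_{\min},x_{\max}]^n$ such that $N_\eta(\mathcal C)\le (an^b/\eta)^k$ for every $0<\eta\le an^b$. Asymptotic notation: $a_n=O(b_n)$ means there exist $C,M>0$ with $|a_n|\le C|b_n|$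 for all $n>M$; $a_n=\Theta(b_n)$ means $a_n=O(b_n)$ and $b_n=O(a_n)$. *)

(* Defs.v *)
From HB Require Import structures.
From mathcomp Require Import all_boot all_order all_algebra.
From mathcomp Require Import all_classical all_reals all_analysis.

Set Implicit Arguments.
Unset Strict Implicit.
Unset Printing Implicit Defensive.

Import Order.TTheory GRing.Theory Num.Theory.
Import numFieldNormedType.Exports.

Local Open Scope classical_set_scope.
Local Open Scope ring_scope.

(* Matrices carry the sigma-algebra generated by their entries, that is, the
   product of the sigma-algebras of the coefficients. *)
Section measurable_matrix.
Context {d : measure_display} {T : measurableType d} (m n : nat).

Definition entry_preimages : set (set 'M[T]_(m, n)) :=
  [set B | exists i j, exists2 U : set T,
     measurable U & B = [set M : 'M[T]_(m, n) | U (M i j)]].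

Definition matrix_measurable : set (set 'M[T]_(m, n)) := <<s entry_preimages >>.

Let matrix_measurable0 : matrix_measurable set0.
Proof. exact: sigma_algebra0. Qed.

Let matrix_measurableC (B : set 'M[T]_(m, n)) :
  matrix_measurable B -> matrix_measurable (~` B).
Proof. by move=> mB; rewrite -setTD; exact: sigma_algebraCD. Qed.

Let matrix_measurable_bigcup (F : (set 'M[T]_(m, n))^nat) :
  (forall i, matrix_measurable (F i)) -> matrix_measurable (\bigcup_i F i).
Proof. exact: sigma_algebra_bigcup. Qed.

HB.instance Definition _ := @isMeasurable.Build
  (sigma_display entry_preimages) 'M[T]_(m, n) matrix_measurable
  matrix_measurable0 matrix_measurableC matrix_measurable_bigcup.

End measurable_matrix.

Section euclidean.
Context {R : realType} {n : nat}.

(* The library norm on matrices is the sup norm. *)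
Definition l2norm (x : 'rV[R]_n) : R := Num.sqrt (\sum_i x 0 i ^+ 2).

Definition l2ball (c : 'rV[R]_n) (eta : R) : set 'rV[R]_n :=
  [set x | l2norm (x - c) <= eta].

(* Equal to +oo when no finite family of balls covers C; the centers are
   arbitrary points of the space. *)
Definition covering_number (eta : R) (C : set 'rV[R]_n) : \bar R :=
  ereal_inf [set N%:R%:E | N in
    [set N : nat | exists c : 'I_N -> 'rV[R]_n,
       C `<=` \bigcup_i l2ball (c i) eta]].

End euclidean.

Definition signal_class {R : realType} (xmin xmax a b : R) (k n : nat) :
    set (set 'rV[R]_n) :=
  [set C : set 'rV[R]_n | [/\ C !=set0,
    forall x, C x -> forall i, xmin <= x 0 i <= xmax &
    forall eta : R, 0 < eta <= a * n%:R `^ b ->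
      (covering_number eta C <= ((a * n%:R `^ b / eta) ^+ k)%:E)%E]].
Arguments signal_class {R} xmin xmax a b k n.

(* N(0, sigma^2); the library's [normal_prob 0 0] is the uniform law on
   [0, 1], not the point mass at 0. *)
Definition centered_normal {R : realType} (sigma : R) (U : set R) : \bar R :=
  if sigma == 0 then \d_(0 : R) U else normal_prob 0 sigma U.

Section random_variables.
Context {d : measure_display} {T : measurableType d} {R : realType}.
Variable P : probability T R.

Definition has_law (X : {RV P >-> R}) (mu : set R -> \bar R) : Prop :=
  forall U, measurable U -> distribution P X U = mu U.

(* For a finite family the product rule for all subfamilies follows from the
   one below by taking B i = setT outside the subfamily. *)
Definition mutually_independent (I : finType) (X : I -> {RV P >-> R}) : Prop :=
  forall B : I -> set R, (forall i, measurable (B i)) ->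
    P (\bigcap_i (X i @^-1` B i)) = (\prod_i P (X i @^-1` B i))%E.

Section looks.
Variables m n L : nat.
Variables (A : 'I_m -> 'I_n -> {RV P >-> R}) (W : 'I_L -> 'I_n -> {RV P >-> R})
  (Z : 'I_L -> 'I_m -> {RV P >-> R}).

Definition all_entries (i : ('I_m * 'I_n) + (('I_L * 'I_n) + ('I_L * 'I_m))) :
    {RV P >-> R} :=
  match i with
  | inl ij => A ij.1 ij.2
  | inr (inl lj) => W lj.1 lj.2
  | inr (inr li) => Z li.1 li.2
  end.

(* The rows W l and Z l are the coordinates of w_l and z_l. Since N(0, s^2 I)
   is the law of independent N(0, s^2) coordinates, the model amounts to the
   mutual independence of all the scalar entries of A, (w_l) and (z_l). *)
Definition looks_model (sigma : R) : Prop :=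
  [/\ forall i j, has_law (A i j) (centered_normal 1),
      forall l j, has_law (W l j) (centered_normal 1),
      forall l i, has_law (Z l i) (centered_normal sigma) &
      mutually_independent all_entries].

Definition forward_matrix (t : T) : 'M[R]_(m, n) := \matrix_(i, j) A i j t.
Definition speckle (l : 'I_L) (t : T) : 'cV[R]_n := \col_j W l j t.
Definition noise (l : 'I_L) (t : T) : 'cV[R]_m := \col_i Z l i t.

Definition look (x : 'rV[R]_n) (l : 'I_L) (t : T) : 'cV[R]_m :=
  forward_matrix t *m diag_mx x *m speckle l t + noise l t.

(* The looks y_1, ..., y_L are the columns of this matrix. *)
Definition looks (x : 'rV[R]_n) (t : T) : 'M[R]_(m, L) :=
  \matrix_(i, l) look x l t i 0.

Definition estimator : Type :=
  {mfun ('M[R]_(m, L) * 'M[R]_(m, n))%type >-> 'rV[R]_n}.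

Definition mean_squared_error (xhat : estimator) (x : 'rV[R]_n) : \bar R :=
  'E_P[fun t => l2norm (xhat (looks x t, forward_matrix t) - x) ^+ 2 / n%:R].

Definition minimax_risk (C : set 'rV[R]_n) : \bar R :=
  ereal_inf [set ereal_sup [set mean_squared_error xhat x | x in C]
            | xhat in [set: estimator]].

End looks.
End random_variables.

(* Main.v *)
Require Import Defs.
From HB Require Import structures.
From mathcomp Require Import all_boot all_order all_algebra.
From mathcomp Require Import all_classical all_reals all_analysis.
From mathcomp Require Import measurable_realfun normal_distribution.
From mathcomp Require Import ring lra zify.

Set Implicit Arguments.
Unset Strict Implicit.
Unset Printing Implicit Defensive.

Import Order.TTheory GRing.Theory Num.Theory.
Import numFieldNormedType.Exports.

Local Open Scope classical_set_scope.
Local Open Scope ring_scope.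

(** The lower bound is an Assouad argument over blocks of coordinates, with a
many-hypotheses test inside each block.

Signals. About half of the coordinates are cut into k blocks of length 2^q; all
other coordinates are frozen at a middle level x0. On a block the squares of
the coordinates are x0^2 + tau * w, where w is one of M Walsh functions, with M
about n^eps. Walsh functions are mutually orthogonal, so two codewords
differ on a positive fraction of the block; they also sum to zero, and this is
what makes the signals hard to tell apart. There are M^k signals, which is few
enough for the covering condition because M <= sqrt n. With
tau^2 = c1 * max(sigma^4, m^2, n^2) k log n / (m^2 n L) the squared distance
between signals that differ everywhere is of order n tau^2, and it remains to
show that an estimator gets the codeword wrong on half of the blocks on average
([assouad_lower_bound]).

Tests. On one block, each codeword is compared with the reference signal in
which the block is erased, that is, set to x0. If f is the density of the first
law with respect to the second, then
t f 1_B <= (f - 1) ln f + (e^t - 1) 1_B pointwise, and the mean of (f - 1) ln f is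
the symmetrised Kullback divergence ([two_point_test]). For two centered Gaussian laws
it is half of L tr((K' - K)(S - S')) for the covariances S, S' and the precisions K, K',
hence it needs no determinant. Summing over M codewords with t = ln M, and
using that the M test sets are disjoint, bounds the total probability of a
correct guess once the divergence is a small multiple of ln M.

Divergence. Three regimes are needed ([pair_test]). If m is at least a small
multiple of n and sigma^2 < max(m, n), the matrix x_i w_i,l of speckled signals is
revealed; the coordinates are then independent and the divergence is a sum over
coordinates ([scaling_test]). Otherwise the noise together with the
contributions of the frozen coordinates is a Gaussian background whose
precision K0 depends on the frozen columns of A only, and adding further rows
can only decrease the precision, so the divergence is at most
(L/2) tr(K0 D K0 D) with D = sum_i d_i a_i a_i^T
([shared_rows_test]). Averaging over the free columns a_i gives
O(L |d|^2 (tr K0)^2): since sum_i d_i = 0, the off-diagonal terms have a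
nonpositive total mean ([mean_cross_form]). If
sigma^2 >= max(m, n) then tr K0 <= m / sigma^2 trivially. If m is much smaller than n,
tr K0 = O(m / n) with probability 7/8, by a leave-one-out argument that only uses
two moments of a quadratic form ([mean_trace_inverse], [small_inverse_prob]). In each
regime the divergence is O(L |d|^2 m^2 / max(sigma^4, m^2, n^2)).

Probability. All scalar entries, divided by their standard deviations, form a
random element of a space of finite functions whose law is determined
by its values on boxes. Independence is used through one principle: redrawing any set of
coordinates from an independent copy does not change the law ([resample]). *)

(** * Laws of independent real coordinates *)

Section ffun_measurable.
Context {R : realType} (I : finType).

Definition coordinate_preimages : set (set {ffun I -> R}) :=
  [set B | exists i, exists2 U : set R,
     measurable U & B = [set v : {ffun I -> R} | U (v i)]].

Let ffun_measurable : set (set {ffun I -> R}) := <<s coordinate_preimages >>.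

Let ffun_measurable0 : ffun_measurable set0.
Proof. exact: sigma_algebra0. Qed.

Let ffun_measurableC (B : set {ffun I -> R}) :
  ffun_measurable B -> ffun_measurable (~` B).
Proof. by move=> mB; rewrite -setTD; exact: sigma_algebraCD. Qed.

Let ffun_measurable_bigcup (F : (set {ffun I -> R})^nat) :
  (forall i, ffun_measurable (F i)) -> ffun_measurable (\bigcup_i F i).
Proof. exact: sigma_algebra_bigcup. Qed.

HB.instance Definition _ := isPointed.Build {ffun I -> R} [ffun=> point].

HB.instance Definition _ := @isMeasurable.Build
  (sigma_display coordinate_preimages) {ffun I -> R} ffun_measurable
  ffun_measurable0 ffun_measurableC ffun_measurable_bigcup.

Lemma measurable_ffunE : measurable = <<s coordinate_preimages >>.
Proof. by []. Qed.

Lemma measurable_coord (i : I) :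
  measurable_fun [set: {ffun I -> R}] (fun v : {ffun I -> R} => v i).
Proof.
move=> _ U mU; rewrite setTI; apply: sub_sigma_algebra.
by exists i; exists U.
Qed.

Lemma measurable_fun_ffun d' (T' : measurableType d') (F : T' -> {ffun I -> R}) :
  (forall i, measurable_fun setT (fun t => F t i)) -> measurable_fun setT F.
Proof.
move=> mF; apply: (measurability _ measurable_ffunE).
move=> _ [_ [i [U mU ->]] <-].
by have := mF i measurableT U mU; rewrite !setTI.
Qed.

Lemma measurable_finfun d' (T' : measurableType d') (F : T' -> I -> R) :
  (forall i, measurable_fun setT (F ^~ i)) ->
  measurable_fun setT (fun t => [ffun i => F t i]).
Proof.
move=> mF; apply: measurable_fun_ffun => i.
by rewrite (_ : (fun t => _) = F ^~ i)//; apply/funext => t; rewrite ffunE.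
Qed.

End ffun_measurable.

Section matrix_measurable_fun.
Context {d : measure_display} {T : measurableType d} (m n : nat).

Lemma measurable_entry (i : 'I_m) (j : 'I_n) :
  measurable_fun [set: 'M[T]_(m, n)] (fun M : 'M[T]_(m, n) => M i j).
Proof.
move=> _ U mU; rewrite setTI; apply: sub_sigma_algebra.
by exists i, j; exists U.
Qed.

Lemma measurable_fun_matrix d' (T' : measurableType d')
    (F : T' -> 'M[T]_(m, n)) :
  (forall i j, measurable_fun setT (fun t => F t i j)) -> measurable_fun setT F.
Proof.
move=> mF; apply: (@measurability _ _ _ _ _ _ (@entry_preimages _ T m n)) => //.
move=> _ [_ [i [j [U mU ->]]] <-].
by have := mF i j measurableT U mU; rewrite !setTI.
Qed.

End matrix_measurable_fun.

Section product_law.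
Context {R : realType} {I : finType}.
Local Notation omega := {ffun I -> R}.

Definition box (B : I -> set R) : set omega := [set v | forall i, B i (v i)].

Lemma measurable_box (B : I -> set R) :
  (forall i, measurable (B i)) -> measurable (box B).
Proof.
move=> mB.
have -> : box B = \big[setI/setT]_(i : I) [set v : omega | B i (v i)].
  apply/seteqP; split => v /=.
    by move=> Bv; elim/big_ind : _ => [//|X Y HX HY|i _]; [split|exact: Bv].
  move=> H i; have : ([set v : omega | B i (v i)] `&`
    \big[setI/setT]_(j | j != i) [set v : omega | B j (v j)]) v.
    by move: H; rewrite (bigD1 i).
  by case.
elim/big_ind : _ => //.
- by move=> X Y; exact: measurableI.
- move=> i _; have := measurable_coord i measurableT (mB i).
  by rewrite setTI.
Qed.

Definition product_law (nu : I -> set R -> \bar R) (mu : set omega -> \bar R) :=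
  forall B, (forall i, measurable (B i)) -> mu (box B) = (\prod_i nu i (B i))%E.

(** Boxes form a pi-system that generates the sigma-algebra. *)
Lemma box_unique (mu mu' : {measure set omega -> \bar R}) :
  (mu setT < +oo)%E ->
  (forall B, (forall i, measurable (B i)) -> mu (box B) = mu' (box B)) ->
  forall X, measurable X -> mu X = mu' X.
Proof.
move=> muoo mumu' X mX.
pose G : set (set omega) :=
  [set X | exists2 B : I -> set R, (forall i, measurable (B i)) & X = box B].
apply: (measure_unique G (fun=> setT)) => //.
- rewrite measurable_ffunE; apply/seteqP; split.
    apply: smallest_sub; first exact: smallest_sigma_algebra.
    move=> _ [i [U mU ->]]; apply: sub_sigma_algebra.
    exists (fun j => if j == i then U else setT).
      by move=> j; case: ifP.
    apply/seteqP; split => v /=; first by move=> Uv j; case: eqP => // ->.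
    by move/(_ i); rewrite eqxx.
  apply: smallest_sub; first exact: (sigma_algebra_measurable omega).
  by move=> _ [B mB ->]; exact: measurable_box.
- move=> _ _ [B mB ->] [B' mB' ->].
  exists (fun i => B i `&` B' i); first by move=> i; exact: measurableI.
  apply/seteqP; split => v /=; first by move=> [H H'] i; split.
  by move=> H; split=> i; have [] := H i.
- move=> _; exists (fun=> setT) => //.
  by apply/seteqP; split.
- by apply/seteqP; split=> // v _; exists 0%N.
- by move=> _ [B mB ->]; exact: mumu'.
Qed.

End product_law.

Section resampling.
Context {R : realType} {I : finType}.
Local Notation omega := {ffun I -> R}.

(** The coordinates in E are taken from the first vector; with an independent first
argument this redraws the coordinates in E. *)
Definition merge (E : pred I) (v' v : omega) : omega :=
  [ffun i => if E i then v' i else v i].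

Definition update (v : omega) (i : I) (t : R) : omega :=
  [ffun j => if j == i then t else v j].

Lemma measurable_merge E :
  measurable_fun setT (fun z : omega * omega => merge E z.1 z.2).
Proof.
apply: measurable_finfun => i; case: (E i).
  exact: (measurableT_comp (measurable_coord i) measurable_fst).
exact: (measurableT_comp (measurable_coord i) measurable_snd).
Qed.

Lemma measurable_update (v : omega) i : measurable_fun setT (update v i).
Proof.
apply: measurable_finfun => j.
by case: eqP => _; [exact: measurable_id|exact: measurable_cst].
Qed.

Lemma measurable_update2 i :
  measurable_fun setT (fun z : omega * R => update z.1 i z.2).
Proof.
apply: measurable_finfun => j.
case: eqP => _; first exact: measurable_snd.
exact: (measurableT_comp (measurable_coord j) measurable_fst).
Qed.

Variables (nu : I -> probability R R) (mu : probability omega R).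
Hypothesis nu_mu : product_law (fun i => nu i) mu.
Local Open Scope ereal_scope.

(** The law of the merged vector has the same values on boxes, because each
coordinate comes from exactly one of two independent copies. *)
Lemma merge_law E X : measurable X ->
  pushforward (mu \x mu) (fun z => merge E z.1 z.2) X = mu X.
Proof.
pose M := fun z : omega * omega => merge E z.1 z.2.
have mM : measurable_fun setT M by exact: measurable_merge.
pose mM_mixin := isMeasurableFun.Build _ _ _ _ _ mM.
pose mM_pack : {mfun _ >-> _} := HB.pack M mM_mixin.
apply: (@box_unique _ _ (pushforward (mu \x mu) mM_pack) mu).
  rewrite /= /pushforward preimage_setT -setXTT.
  by rewrite product_measure1E//= probability_setT mule1 ltry.
move=> B mB.
rewrite /= /pushforward.
have -> : M @^-1` box B =
    box (fun i => if E i then B i else setT) `*`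
    box (fun i => if E i then setT else B i).
  apply/seteqP; split => [[v' v]|[v' v] [/= H H']] /=.
    move=> H; split=> i /=; have := H i; rewrite ffunE/=; by case: (E i).
  by move=> i; rewrite ffunE/=; have := H i; have := H' i; case: (E i).
have mBE i : measurable (if E i then B i else setT) by case: (E i).
have mBE' i : measurable (if E i then setT else B i) by case: (E i).
rewrite product_measure1E; try exact: measurable_box.
transitivity ((\prod_i nu i (if E i then B i else setT)) *
    (\prod_i nu i (if E i then setT else B i))).
  by congr *%E; exact: nu_mu.
transitivity (\prod_i nu i (B i)); last by apply/esym/nu_mu.
rewrite -big_split/=; apply: eq_bigr => i _.
by case: (E i); rewrite probability_setT ?mule1 ?mul1e.
Qed.

(** The substitute for conditioning on the coordinates outside E: the inner
integral is over the coordinates in E only. *)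
Lemma resample (E : pred I) (f : omega -> \bar R) : measurable_fun [set: omega] f ->
  (forall v, 0 <= f v) ->
  \int[mu]_v f v = \int[mu]_v \int[mu]_v' f (merge E v' v).
Proof.
move=> mf f0.
transitivity (\int[pushforward (mu \x mu) (fun z => merge E z.1 z.2)]_v f v).
  apply: eq_measure_integral => [|mM A mA _]; first exact: measurable_merge.
  exact/esym/merge_law.
rewrite ge0_integral_pushforward//; last exact: measurable_merge.
pose g (z : omega * omega) := f (merge E z.1 z.2).
rewrite preimage_setT; apply: (fubini_tonelli2 g) => // [|z]; last exact: f0.
by apply: measurableT_comp => //; exact: measurable_merge.
Qed.

Lemma marginal i (f : R -> \bar R) : measurable_fun setT f ->
  (forall t, 0 <= f t) -> \int[mu]_v f (v i) = \int[nu i]_t f t.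
Proof.
move=> mf f0.
transitivity (\int[pushforward mu (fun v : omega => v i)]_t f t).
  by rewrite ge0_integral_pushforward//; exact: measurable_coord.
apply: eq_measure_integral => [|mM A mA _]; first exact: measurable_coord.
have mB (j : I) : measurable (if j == i then A else setT) by case: ifP.
transitivity (mu (box (fun j => if j == i then A else setT))).
  congr (mu _); apply/seteqP; split => v /= Av; last first.
    by have := Av i; rewrite eqxx.
  by move=> j; case: eqP => // ->.
rewrite nu_mu// (bigD1 i)//= eqxx big1 ?mule1// => j /negbTE ->.
exact: probability_setT.
Qed.

Lemma resample1 i (f : omega -> \bar R) : measurable_fun [set: omega] f ->
  (forall v, 0 <= f v) ->
  \int[mu]_v f v = \int[mu]_v \int[nu i]_t f (update v i t).
Proof.
move=> mf f0; rewrite (resample (pred1 i) mf f0).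
apply: eq_integral => v _.
rewrite -(@marginal i (fun t => f (update v i t)))//; last first.
  by apply: measurableT_comp => //; exact: measurable_update.
apply: eq_integral => v' _; congr f; apply/ffunP => j.
by rewrite !ffunE/=; case: eqP => // ->.
Qed.

(** Redrawing the first coordinate of the list factors one integral out. *)
Lemma integral_prod_coord (J : eqType) (w : J -> I) (s : seq J)
    (phi : J -> R -> R) (c : J -> R) :
  uniq (map w s) -> (forall i, measurable_fun setT (phi i)) ->
  (forall i t, (0 <= phi i t)%R) ->
  (forall i, i \in s -> \int[nu (w i)]_t (phi i t)%:E = (c i)%:E) ->
  \int[mu]_v (\prod_(i <- s) phi i (v (w i)))%:E = (\prod_(i <- s) c i)%:E.
Proof.
move=> + mphi phi0; elim: s => [_ _|i s IH /=/andP[iNs us] cE].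
  under eq_integral do rewrite big_nil.
  by rewrite integral_cst//= probability_setT big_nil mule1.
have mprod (r : seq J) : measurable_fun setT (fun v : omega => (\prod_(i <- r) phi i (v (w i)))%R).
  apply: measurable_prod => j _; apply: measurableT_comp => //.
  exact: measurable_coord.
rewrite (resample1 (w i))//; last 2 first.
- exact/measurable_EFinP.
- by move=> v; rewrite lee_fin; apply: prodr_ge0.
under eq_integral => v _.
  under eq_integral => t _.
    rewrite big_cons EFinM ffunE eqxx.
    rewrite (eq_big_seq (fun j => phi j (v (w j)))); last first.
      by move=> j js; rewrite ffunE; case: eqP => // ji; rewrite -ji map_f in iNs.
    over.
  rewrite ge0_integralZr//; last 3 first.
  - exact/measurable_EFinP.
  - by move=> t _; rewrite lee_fin.
  - by rewrite lee_fin prodr_ge0.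
  rewrite cE ?mem_head//.
  over.
rewrite ge0_integralZl//; last 3 first.
- exact/measurable_EFinP.
- by move=> v _; rewrite lee_fin prodr_ge0.
- by rewrite -cE ?mem_head//; apply: integral_ge0 => t _; rewrite lee_fin.
rewrite IH//; first by rewrite -EFinM big_cons.
by move=> j js; apply: cE; rewrite inE js orbT.
Qed.

End resampling.

(** * Gaussian integrals on the line *)

Section density.
Local Open Scope ereal_scope.
Context d (T : measurableType d) (R : realType).
Variables (mu nu : {measure set T -> \bar R}) (p : T -> R).
Hypotheses (mp : measurable_fun setT p) (p0 : forall x, (0 <= p x)%R).
Hypothesis nuE : forall A, measurable A -> nu A = \int[mu]_(x in A) (p x)%:E.

Let integral_density_indic E : measurable E ->
  \int[nu]_x (\1_E x)%:E = \int[mu]_x ((\1_E x)%:E * (p x)%:E).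
Proof.
move=> mE; rewrite integral_indic// setIT nuE// integral_mkcond.
apply: eq_integral => x _; rewrite patchE indicE.
by case: ifP => _; rewrite ?mul1e ?mul0e.
Qed.

Import HBNNSimple.

Let integral_density_nnsfun (f : {nnsfun T >-> R}) :
  \int[nu]_x (f x)%:E = \int[mu]_x ((f x)%:E * (p x)%:E).
Proof.
under [LHS]eq_integral do rewrite fimfunE -fsumEFin//.
rewrite [LHS]ge0_integral_fsum//; last 2 first.
  - by move=> r; exact/measurable_EFinP/measurableT_comp.
  - by move=> n x _; rewrite EFinM nnfun_muleindic_ge0.
under [RHS]eq_integral.
  move=> x xD; rewrite fimfunE -fsumEFin// muleC ge0_mule_fsumr; last first.
    by move=> r; rewrite EFinM nnfun_muleindic_ge0.
  over.
rewrite [RHS]ge0_integral_fsum//; last 2 first.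
  - move=> r; apply: emeasurable_funM; first exact/measurable_EFinP.
    by apply/measurable_EFinP; do 2 apply/measurableT_comp => //.
  - by move=> n x _; rewrite EFinM; apply: mule_ge0; rewrite ?nnfun_muleindic_ge0 ?lee_fin.
apply: eq_fsbigr => r _.
under [RHS]eq_integral do rewrite EFinM muleCA.
have mpi : measurable_fun setT (fun x => (p x)%:E * (\1_(f @^-1` [set r]) x)%:E).
  apply: emeasurable_funM; first exact/measurable_EFinP.
  by apply/measurable_EFinP; exact: measurable_indic.
have [r0|r0] := leP 0%R r; last first.
  rewrite preimage_nnfun0// indic0.
  by rewrite !integral0_eq// => x _; rewrite /= ?mulr0 ?mule0// mule0.
rewrite ge0_integralZl//; last first.
  by move=> x _; rewrite mule_ge0// lee_fin.
rewrite integralZl_indic_nnsfun//= integral_density_indic//.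
by congr (_ * _); apply: eq_integral => x _; rewrite muleC.
Qed.

(** True by hypothesis for indicators, hence for simple functions, hence in the
monotone limit. *)
Lemma ge0_integral_density (f : T -> \bar R) :
  measurable_fun setT f -> (forall x, 0 <= f x) ->
  \int[nu]_x f x = \int[mu]_x (f x * (p x)%:E).
Proof.
move=> mf f0.
pose f_ := nnsfun_approx measurableT mf.
have cvgf x : (f_ n x)%:E @[n --> \oo] --> f x by exact: cvg_nnsfun_approx.
transitivity (lim (\int[nu]_x (f_ n x)%:E @[n --> \oo])).
  rewrite -monotone_convergence//=.
  - by apply: eq_integral => x _; apply/esym/cvg_lim.
  - by move=> n; exact/measurable_EFinP/measurable_funTS.
  - by move=> n ? _; rewrite lee_fin.
  - by move=> ? _ ? ? mn; rewrite lee_fin; exact/lefP/nd_nnsfun_approx.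
rewrite [RHS](_ : _ = lim (\int[mu]_x ((f_ n x)%:E * (p x)%:E) @[n --> \oo])).
  by apply: congr_lim; apply/funext => n; exact: integral_density_nnsfun.
rewrite -monotone_convergence//=.
- apply: eq_integral => x _; apply/esym/cvg_lim => //.
  by apply: cvgeZr => //; exact: cvgf.
- move=> n; apply: emeasurable_funM; last exact/measurable_EFinP.
  exact/measurable_EFinP/measurable_funTS.
- by move=> n x _; rewrite mule_ge0// lee_fin.
- move=> x _ n m nm; rewrite lee_wpmul2r ?lee_fin//.
  exact/lefP/nd_nnsfun_approx.
Qed.

End density.

Section lebesgue_affine.
Context {R : realType}.
Local Open Scope ereal_scope.
Local Notation mu := (@lebesgue_measure R).

Lemma measurable_affine (a b : R) : measurable_fun setT (fun x : R => (a * x + b)%R).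
Proof. by apply: measurable_funD => //; exact: mulrl_measurable. Qed.

(** Lebesgue measure is determined by its values on intervals, where the formula
is a computation of lengths. *)
Lemma ge0_integral_affine (a b : R) (f : R -> \bar R) : (0 < a)%R ->
  measurable_fun setT f -> (forall x, 0 <= f x) ->
  \int[mu]_x f x = a%:E * \int[mu]_x f (a * x + b)%R.
Proof.
move=> a0 mf f0.
pose phi (x : R) : R := (a * x + b)%R.
have mphi : measurable_fun [set: measurableTypeR R] (phi : _ -> measurableTypeR R).
  exact: measurable_affine.
pose mphi_mixin := isMeasurableFun.Build _ _ (measurableTypeR R) (measurableTypeR R) phi mphi.
pose mphi_pack : {mfun measurableTypeR R >-> measurableTypeR R} := HB.pack phi mphi_mixin.
pose a1 : {nonneg R} := NngNum (ltW a0).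
pose m := mscale a1 (pushforward mu mphi_pack).
transitivity (\int[m mphi]_x f x).
  apply: eq_measure_integral => A mA _.
  apply: lebesgue_measure_unique => //= _ [[u v]] _ <-.
  rewrite /m /mscale/= /pushforward.
  have -> : phi @^-1` `]u, v]%classic = `]((u - b) / a)%R, ((v - b) / a)%R]%classic.
    apply/seteqP; split => x /=; rewrite !in_itv/= /phi ltr_pdivrMr// ler_pdivlMr//.
      by rewrite ltrBlDr lerBrDr mulrC.
    by rewrite ltrBlDr lerBrDr mulrC.
  rewrite !lebesgue_measure_itv/= !lte_fin ltr_pM2r ?invr_gt0// ltrD2r.
  case: ifP => _; last by rewrite mule0.
  rewrite -!EFinD -EFinM; congr EFin; field; lra.
rewrite ge0_integral_mscale//= ge0_integral_pushforward//.
Qed.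

End lebesgue_affine.

Section centered_normal_probability.
Context {R : realType} (sigma : R).
Local Open Scope ereal_scope.

Let centered_normal0 : centered_normal sigma set0 = 0.
Proof. by rewrite /centered_normal; case: ifP => _; exact: measure0. Qed.

Let centered_normal_ge0 (A : set R) : 0 <= centered_normal sigma A.
Proof. by rewrite /centered_normal; case: ifP => _; exact: measure_ge0. Qed.

Let centered_normal_sigma_additive :
  semi_sigma_additive (centered_normal sigma : set R -> \bar R).
Proof.
rewrite /centered_normal; case: (sigma == 0)%R.
  exact: (@measure_semi_sigma_additive _ _ _ \d_(0%R : R)).
exact: (@measure_semi_sigma_additive _ _ _ (normal_prob 0 sigma)).
Qed.

HB.instance Definition _ := isMeasure.Build _ _ _ (centered_normal sigma : set R -> \bar R)
  centered_normal0 centered_normal_ge0 centered_normal_sigma_additive.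

Let centered_normalT : centered_normal sigma [set: R] = 1.
Proof.
by rewrite /centered_normal; case: ifP => _; rewrite probability_setT.
Qed.

HB.instance Definition _ := Measure_isProbability.Build _ _ _
  (centered_normal sigma : set R -> \bar R) centered_normalT.

End centered_normal_probability.

Section gaussian_integrals.
Context {R : realType}.
Local Open Scope ereal_scope.
Local Notation gauss := (centered_normal (1%R : R)).
Local Notation leb := (@lebesgue_measure R).

Lemma integral_centered_normal (s : R) (f : R -> \bar R) : s != 0%R ->
  measurable_fun setT f -> (forall t, 0 <= f t) ->
  \int[centered_normal s]_t f t = \int[leb]_t (f t * (normal_pdf 0 s t)%:E).
Proof.
move=> s0 mf f0.
rewrite -(@ge0_integral_density _ (measurableTypeR R) _ leb (normal_prob 0 s) (normal_pdf 0 s))//.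
- have mid : measurable_fun [set: measurableTypeR R] (idfun : measurableTypeR R -> R).
    by move=> _ A mA; rewrite setTI.
  rewrite -[RHS](@ge0_integral_pushforward _ _ (measurableTypeR R) R R
    idfun mid (normal_prob 0 s) setT f)//.
  apply: eq_measure_integral => // A mA _ /=.
  by rewrite /pushforward /centered_normal (negbTE s0).
- exact: measurable_normal_pdf.
- by move=> t; exact: normal_pdf_ge0.
Qed.

Lemma normal_pdf0E (s t : R) : s != 0%R ->
  normal_pdf 0 s t = (normal_peak s * expR (- (t / s) ^+ 2 / 2))%R.
Proof.
move=> s0; rewrite normal_pdfE// /= /normal_fun subr0.
congr (_ * expR _)%R; rewrite -mulr_natr; field.
by rewrite s0.
Qed.

Lemma normal_peak_scale (s : R) : (0 < s)%R -> normal_peak s = (s^-1 * normal_peak 1)%R.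
Proof.
move=> s0; rewrite /normal_peak expr1n mul1r -mulrnAr sqrtrM ?sqr_ge0//.
by rewrite sqrtr_sqr gtr0_norm// invfM.
Qed.

Lemma integral_scaled_normal (s : R) (f : R -> \bar R) : (0 < s)%R ->
  measurable_fun setT f -> (forall t, 0 <= f t) ->
  \int[centered_normal s]_t f t = \int[gauss]_t f (s * t)%R.
Proof.
move=> s0 mf f0.
have mfs : measurable_fun setT (fun t => f (s * t)%R).
  by apply: measurableT_comp => //; exact: mulrl_measurable.
rewrite (integral_centered_normal (lt0r_neq0 s0) mf f0).
rewrite (integral_centered_normal (@oner_neq0 R) mfs (fun t => f0 _)).
rewrite (@ge0_integral_affine _ s 0)//; last 2 first.
- apply: emeasurable_funM => //; apply/measurable_EFinP.
  exact: measurable_normal_pdf.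
- by move=> t; rewrite mule_ge0// lee_fin normal_pdf_ge0.
rewrite -ge0_integralZl//; last 3 first.
- apply: emeasurable_funM; apply: measurableT_comp => //; last first.
    apply: measurableT_comp; first exact: measurable_normal_pdf.
    exact: measurable_affine.
  exact: measurable_affine.
- by move=> t _; rewrite mule_ge0// lee_fin normal_pdf_ge0.
- by rewrite lee_fin ltW.
apply: eq_integral => t _; rewrite addr0 muleCA -EFinM; congr (_ * _%:E).
rewrite !normal_pdf0E ?gt_eqF ?ltr01// divr1 normal_peak_scale//.
rewrite [(s * t)%R]mulrC mulfK ?gt_eqF// !mulrA mulfV ?gt_eqF// mul1r.
by [].
Qed.

(** The change of variable t |-> s t + p in the Gaussian density, written with
respect to the Gaussian law itself. Both the shift formula and the rescaling
formula for Gaussian vectors are iterations of this one. *)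
Lemma gauss_affine (s p : R) (f : R -> \bar R) : (0 < s)%R ->
  measurable_fun setT f -> (forall t, 0 <= f t) ->
  \int[gauss]_t f (s * t + p)%R =
  \int[gauss]_t (f t * (s^-1 * expR (t ^+ 2 / 2 - ((t - p) / s) ^+ 2 / 2))%:E).
Proof.
move=> s0 mf f0.
have mfs : measurable_fun setT (fun t => f (s * t + p)%R).
  by apply: measurableT_comp => //; exact: measurable_affine.
pose e t := (s^-1 * expR (t ^+ 2 / 2 - ((t - p) / s) ^+ 2 / 2))%R.
have me : measurable_fun setT e.
  apply: measurable_funM => //; apply: measurableT_comp => //.
  by apply: measurable_funB; apply: measurable_funM => //; apply: measurable_funX => //;
    apply: measurable_funM => //; exact: measurable_funB.
have e0 t : (0 <= e t)%R by rewrite mulr_ge0 ?expR_ge0// invr_ge0 ltW.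
have mpdf : measurable_fun setT (fun t : R => (normal_pdf 0 1 t)%:E).
  by apply/measurable_EFinP; exact: measurable_normal_pdf.
have mfe : measurable_fun setT (fun t => f t * (e t)%:E).
  by apply: emeasurable_funM => //; exact/measurable_EFinP.
have fe0 t : 0 <= f t * (e t)%:E by apply: mule_ge0; rewrite ?lee_fin.
rewrite (integral_centered_normal (@oner_neq0 R) mfs (fun t => f0 _)).
rewrite (integral_centered_normal (@oner_neq0 R) mfe fe0).
rewrite [RHS](@ge0_integral_affine _ s p)//; last 2 first.
- exact: emeasurable_funM.
- by move=> t; apply: mule_ge0; [exact: fe0|rewrite lee_fin; exact: normal_pdf_ge0].
rewrite -ge0_integralZl//; last 3 first.
- apply: (measurableT_comp (emeasurable_funM mfe mpdf)).
  exact: measurable_affine.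
- by move=> t _; apply: mule_ge0; [exact: fe0|rewrite lee_fin; exact: normal_pdf_ge0].
- by rewrite lee_fin ltW.
apply: eq_integral => t _; rewrite muleA muleCA -!EFinM -muleA -EFinM.
congr (_ * _%:E); rewrite /e addrK.
rewrite !normal_pdf0E ?oner_eq0// !divr1 [(s * t)%R]mulrC mulfK ?gt_eqF//.
rewrite mulVKf ?gt_eqF// mulrCA -expRD; congr (_ * expR _)%R.
ring.
Qed.

Let affine1 (s p : R) : (0 < s)%R ->
  \int[gauss]_t (s^-1 * expR (t ^+ 2 / 2 - ((t - p) / s) ^+ 2 / 2))%:E = 1.
Proof.
move=> s0; transitivity (\int[gauss]_t (cst 1 t : \bar R)); last first.
  by rewrite integral_cst// mul1e; exact: probability_setT.
have := @gauss_affine s p (cst 1) s0 (@measurable_cst _ _ _ _ _ _) (fun=> lee01).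
by move=> /= ->; apply: eq_integral => t _; rewrite mul1e.
Qed.

(** The integrand is a constant multiple of the density of an affine image of the
Gaussian law ([gauss_affine]), which integrates to 1. *)
Lemma gauss_exp_quad (beta s : R) : (-1 < s)%R ->
  \int[gauss]_t (expR (beta * t - s * t ^+ 2 / 2))%:E =
  ((Num.sqrt (1 + s))^-1 * expR (beta ^+ 2 / (1 + s) / 2))%:E.
Proof.
move=> s1.
have s0 : (0 < 1 + s)%R by rewrite -ltrBlDl sub0r.
pose x := (Num.sqrt (1 + s))^-1%R.
have x0 : (0 < x)%R by rewrite invr_gt0 sqrtr_gt0.
have x2 : (x ^+ 2 = (1 + s)^-1)%R by rewrite exprVn sqr_sqrtr// ltW.
pose c := (x * expR (beta ^+ 2 / (1 + s) / 2))%R.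
have c0 : (0 < c)%R by rewrite mulr_gt0 ?expR_gt0.
transitivity (\int[gauss]_t (c%:E * (x^-1 *
    expR (t ^+ 2 / 2 - ((t - beta / (1 + s)) / x) ^+ 2 / 2))%:E)).
  apply: eq_integral => t _; rewrite -EFinM; congr EFin.
  rewrite /c mulrACA divff ?gt_eqF// mul1r -expRD; congr expR.
  rewrite expr_div_n x2; field; by rewrite gt_eqF.
rewrite ge0_integralZl ?lee_fin ?(ltW c0)//.
- by rewrite affine1// mule1.
- apply/measurable_EFinP.
  apply: measurable_funM => //; apply: measurableT_comp => //.
  by apply: measurable_funB; apply: measurable_funM => //; apply: measurable_funX => //;
    apply: measurable_funM => //; exact: measurable_funB.
- by move=> t _; rewrite lee_fin mulr_ge0 ?expR_ge0// invr_ge0 ltW.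
Qed.

Lemma gauss_opp (f : R -> \bar R) :
  measurable_fun setT f -> (forall t, 0 <= f t) ->
  \int[gauss]_t f (- t)%R = \int[gauss]_t f t.
Proof.
move=> mf f0.
have mfN : measurable_fun setT (fun t : R => f (- t)%R) by apply: measurableT_comp.
rewrite (integral_centered_normal (@oner_neq0 R) mfN (fun t => f0 _)).
rewrite (integral_centered_normal (@oner_neq0 R) mf f0).
pose h t := f t * (normal_pdf 0 1 t)%:E.
have mh : measurable_fun setT h.
  apply: emeasurable_funM => //; apply/measurable_EFinP.
  exact: measurable_normal_pdf.
have h0 t : 0 <= h t by rewrite mule_ge0// lee_fin normal_pdf_ge0.
transitivity (\int[leb]_t h (- t)%R).
  apply: eq_integral => t _; congr (_ * _%:E).
  by rewrite !normal_pdf0E ?oner_eq0// !divr1 sqrrN.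
transitivity (\int[pushforward leb (-%R : _ -> measurableTypeR R)]_t h t).
  by rewrite ge0_integral_pushforward.
apply: eq_measure_integral => // A mA _ /=.
exact: lebesgue_measureN.
Qed.

Let gauss_exp_sq (c : R) : (c < 1)%R ->
  \int[gauss]_t (expR (c * t ^+ 2 / 2))%:E = (Num.sqrt (1 - c))^-1%:E.
Proof.
move=> c1; have := @gauss_exp_quad 0 (- c)%R; rewrite ltrN2 => /(_ c1).
rewrite expr0n/= !mul0r expR0 mulr1 => <-.
by apply: eq_integral => t _; rewrite mul0r add0r !mulNr opprK.
Qed.

Let measurable_power (c : R) n : measurable_fun setT (fun t : R => (c * t ^+ n)%R).
Proof. by apply: measurable_funM => //; exact: exprn_measurable. Qed.

Let measurable_exp_sq (c : R) :
  measurable_fun setT (fun t : R => (expR (c * t ^+ 2 / 2))%:E).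
Proof.
apply/measurable_EFinP; apply: measurableT_comp => //.
by apply: measurable_funM => //; exact: measurable_power.
Qed.

(** From u^2 <= 64 e^(u / 4) with u = t^2 and the exponential moment of t^2 / 4. The
true value is 3; only the order of the constant matters for the lower bound. *)
Lemma gauss_fourth_moment_le : \int[gauss]_t (t ^+ 4)%:E <= 96%:E.
Proof.
apply: (@le_trans _ _ (\int[gauss]_t (64%:E * (expR (2^-1 * t ^+ 2 / 2))%:E))).
  apply: ge0_le_integral => //.
  - by move=> t _; rewrite lee_fin exprn_even_ge0.
  - by apply/measurable_EFinP; exact: exprn_measurable.
  - by apply: measurable_funeM; exact: measurable_exp_sq.
  - move=> t _; rewrite -EFinM lee_fin.
    have : (0 <= t ^+ 2)%R by exact: sqr_ge0.
    rewrite -[(t ^+ 4)%R]/(t ^+ (2 * 2))%R exprM; move: (t ^+ 2)%R => u u0.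
    have e1 := @expR_ge1Dx R (u / 8).
    have -> : (2^-1 * u / 2 = u / 8 + u / 8)%R by field.
    rewrite expRD; move: (expR _) e1 => x e1.
    nra.
rewrite ge0_integralZl//.
rewrite gauss_exp_sq; last by rewrite invf_lt1// ltr1n.
rewrite -EFinM lee_fin.
set y := Num.sqrt _.
have y0 : (0 < y)%R by rewrite sqrtr_gt0; lra.
have y2 : (y ^+ 2 = 1 / 2)%R by rewrite sqr_sqrtr; lra.
rewrite ler_pdivrMr//; nra.
Qed.

(** The exponential moments of c t^2 / 2 are (1 - c)^(-1/2). Since e^u >= 1 + u, they
bound the second moment on both sides when c tends to 0 from above and from below. *)
Lemma gauss_second_moment : \int[gauss]_t (t ^+ 2)%:E = 1.
Proof.
have m2 : measurable_fun setT (fun t : R => (t ^+ 2)%:E).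
  by apply/measurable_EFinP; exact: exprn_measurable.
have t20 (t : R) : 0 <= (t ^+ 2)%:E by rewrite lee_fin sqr_ge0.
have int1 : \int[gauss]_t (1%R%:E) = 1.
  rewrite integral_cst// mul1e; exact: probability_setT.
pose M : \bar R := \int[gauss]_t (t ^+ 2)%:E; rewrite -/M.
have M0 : 0 <= M by exact: integral_ge0.
have upper (c : R) : (0 < c < 1)%R -> 1 + (c / 2)%:E * M <= (Num.sqrt (1 - c))^-1%:E.
  move=> /andP[c0 c1]; rewrite -gauss_exp_sq// -int1 -ge0_integralZl//; last first.
    by rewrite lee_fin divr_ge0// ltW.
  rewrite -ge0_integralD//=; last 2 first.
  - by move=> t _; rewrite -EFinM lee_fin mulr_ge0 ?sqr_ge0// divr_ge0// ltW.
  - exact: measurable_funeM.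
  apply: ge0_le_integral => //=.
  - by move=> t _; rewrite -EFinD lee_fin addr_ge0// mulr_ge0 ?sqr_ge0// divr_ge0// ltW.
  - by apply: emeasurable_funD => //; exact: measurable_funeM.
  - by move=> t _; rewrite -EFinM -EFinD lee_fin mulrAC expR_ge1Dx.
have lower (c : R) : (0 < c)%R -> 1 <= (Num.sqrt (1 + c))^-1%:E + (c / 2)%:E * M.
  move=> c0; have -> : (1 + c = 1 - (- c))%R by rewrite opprK.
  rewrite -gauss_exp_sq; last lra.
  rewrite -ge0_integralZl//; last by rewrite lee_fin divr_ge0// ltW.
  rewrite -ge0_integralD//=; last 2 first.
  - by move=> t _; rewrite -EFinM lee_fin mulr_ge0 ?sqr_ge0// divr_ge0// ltW.
  - exact: measurable_funeM.
  rewrite -int1; apply: ge0_le_integral => //=.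
  - apply: emeasurable_funD; first exact: measurable_exp_sq.
    exact: measurable_funeM.
  - move=> t _; rewrite -EFinM -EFinD lee_fin.
    have := @expR_ge1Dx R (- c * t ^+ 2 / 2).
    by rewrite mulrAC; move: (expR _) => x; lra.
have Mfin : M \is a fin_num.
  have h2 : (0 < (2^-1 : R) < 1)%R by apply/andP; split; lra.
  rewrite ge0_fin_numE// ltey; apply/eqP => Mo; have := upper _ h2.
  by rewrite Mo gt0_muley ?lte_fin; [|lra].
move: M0 upper lower; rewrite -(fineK Mfin); move: (fine M) => x x0 upper lower.
congr EFin; apply/eqP; rewrite eq_le; apply/andP; split; apply/ler_addgt0Pr => e e0.
- pose h := Num.min (e / 3)%R (1 / 2)%R.
  have h0 : (0 < h)%R by rewrite lt_min !divr_gt0.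
  have h1 : (h <= 1 / 2)%R by rewrite ge_min lexx orbT.
  have h2 : (h <= e / 3)%R by rewrite ge_min lexx.
  have u0 : (0 < 1 + h)%R by lra.
  have := upper (1 - (1 + h) ^- 2)%R.
  rewrite subKr sqrtrV ?sqr_ge0// sqrtr_sqr gtr0_norm// invrK.
  have ch : ((1 + h) ^- 2 < 1)%R by rewrite invf_lt1 ?exprn_gt0//; nra.
  have ch' : (0 < (1 + h) ^- 2)%R by rewrite invr_gt0 exprn_gt0.
  move=> /(_ ltac:(apply/andP; split; lra)).
  rewrite -EFinM -EFinD lee_fin.
  have -> : (1 - (1 + h) ^- 2 = h * (2 + h) / (1 + h) ^+ 2)%R by field; rewrite gt_eqF.
  move=> H.
  have : (h * (2 + h) / (1 + h) ^+ 2 / 2 * x * (2 * (1 + h) ^+ 2) <= h * (2 * (1 + h) ^+ 2))%R.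
    by rewrite ler_pM2r ?mulr_gt0 ?exprn_gt0//; lra.
  have -> : (h * (2 + h) / (1 + h) ^+ 2 / 2 * x * (2 * (1 + h) ^+ 2) = h * ((2 + h) * x))%R.
    by field; rewrite gt_eqF.
  rewrite ler_pM2l// => H2.
  nra.
- pose h := Num.min (e / 3)%R (1 / 2)%R.
  have h0 : (0 < h)%R by rewrite lt_min !divr_gt0.
  have h1 : (h <= 1 / 2)%R by rewrite ge_min lexx orbT.
  have h2 : (h <= e / 3)%R by rewrite ge_min lexx.
  have u0 : (0 < 1 - h)%R by lra.
  have := lower ((1 - h) ^- 2 - 1)%R.
  rewrite subrKC sqrtrV ?sqr_ge0// sqrtr_sqr gtr0_norm// invrK.
  have ch : (1 < (1 - h) ^- 2)%R by rewrite invf_gt1 ?exprn_gt0//; nra.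
  move=> /(_ ltac:(lra)).
  rewrite -EFinM -EFinD lee_fin.
  have -> : ((1 - h) ^- 2 - 1 = h * (2 - h) / (1 - h) ^+ 2)%R by field; rewrite gt_eqF.
  move=> H.
  have : (h * (2 * (1 - h) ^+ 2) <= h * (2 - h) / (1 - h) ^+ 2 / 2 * x * (2 * (1 - h) ^+ 2))%R.
    by rewrite ler_pM2r ?mulr_gt0 ?exprn_gt0//; lra.
  have -> : (h * (2 - h) / (1 - h) ^+ 2 / 2 * x * (2 * (1 - h) ^+ 2) = h * ((2 - h) * x))%R.
    by field; rewrite gt_eqF.
  rewrite ler_pM2l// => H2.
  nra.
Qed.

End gaussian_integrals.

(** * Gaussian vectors: shifts and moments of linear forms *)

Ltac nneg := repeat first
  [ done | exact: sqr_ge0 | exact: expR_ge0 | (apply: ltW; assumption)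
  | by rewrite exprn_even_ge0 | rewrite invr_ge0
  | apply: addr_ge0 | apply: mulr_ge0 ].

Lemma integral_cst_probability d (T : measurableType d) (R : realType)
  (P : probability T R) (r : R) : (\int[P]_x r%:E = r%:E)%E.
Proof. by rewrite integral_cst// [X in (_ * X)%E](@probability_setT _ _ _ P) mule1. Qed.

Section gaussian_vector.
Context {R : realType} {I : finType}.
Local Notation omega := {ffun I -> R}.
Variables (nu : I -> probability R R) (mu : probability omega R).
Hypothesis nu_mu : product_law (fun i => nu i) mu.
Local Open Scope ereal_scope.

Definition standard (i : I) := nu i = centered_normal 1 :> probability R R.

Definition lin (c : I -> R) (v : omega) : R := (\sum_i c i * v i)%R.

Lemma measurable_shift (p : omega) : measurable_fun [set: omega] (fun v : omega => (v + p)%R).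
Proof.
apply: measurable_fun_ffun => i.
rewrite (_ : (fun v : omega => _) = (fun v : omega => v i + p i)%R); last first.
  by apply/funext => v; rewrite ffunE.
by apply: measurable_funD => //; exact: measurable_coord.
Qed.

Lemma measurable_lin c : measurable_fun [set: omega] (lin c).
Proof.
apply: measurable_sum => i; apply: measurable_funM => //.
exact: measurable_coord.
Qed.

Let single_shift i (p : R) (f : omega -> \bar R) :
  (p != 0 -> standard i)%R -> measurable_fun [set: omega] f -> (forall v, 0 <= f v) ->
  \int[mu]_v f (v + [ffun j => if j == i then p else 0])%R =
  \int[mu]_v (f v * (expR (p * v i - p ^+ 2 / 2))%:E).
Proof.
move=> pS mf f0; have [p0|p0] := eqVneq p 0%R.
  apply: eq_integral => v _.
  rewrite p0 mul0r expr0n/= mul0r subr0 expR0 mule1; congr f.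
  by apply/ffunP => j; rewrite !ffunE; case: ifP; rewrite addr0.
have me : measurable_fun [set: omega] (fun v : omega => (expR (p * v i - p ^+ 2 / 2))%:E).
  apply/measurable_EFinP; apply: measurableT_comp => //.
  apply: measurable_funB => //; apply: measurable_funM => //.
  exact: measurable_coord.
rewrite (resample1 nu_mu i); last 2 first.
- by apply: measurableT_comp => //; exact: measurable_shift.
- by [].
rewrite [RHS](resample1 nu_mu i); last 2 first.
- exact: emeasurable_funM.
- by move=> v; rewrite mule_ge0// lee_fin expR_ge0.
apply: eq_integral => v _; rewrite (pS p0).
have mfu : measurable_fun setT (fun t => f (update v i t)).
  by apply: measurableT_comp => //; exact: measurable_update.
transitivity (\int[centered_normal 1%R]_t f (update v i (1 * t + p)%R)).
  apply: eq_integral => t _; congr f; apply/ffunP => j; rewrite !ffunE.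
  by case: ifP => _; rewrite ?mul1r ?addr0.
rewrite (@gauss_affine _ 1 p (fun t => f (update v i t)))//.
apply: eq_integral => t _; congr (_ * _%:E); rewrite ffunE eqxx invr1 mul1r.
by congr expR; field.
Qed.

(** Shifting one standard coordinate multiplies the law by
exp (p_i v_i - p_i^2 / 2); the coordinates are shifted one at a time. Coordinates
that are not standard are left in place, which is what allows noise of
variance zero. *)
Lemma cameron_martin (p : omega) (f : omega -> \bar R) :
  (forall i, p i != 0%R -> standard i) ->
  measurable_fun [set: omega] f -> (forall v, 0 <= f v) ->
  \int[mu]_v f (v + p)%R =
  \int[mu]_v (f v * (expR (\sum_i (p i * v i - p i ^+ 2 / 2)))%:E).
Proof.
move=> pS mf f0.
suff H (s : seq I) : uniq s -> forall g : omega -> \bar R,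
    measurable_fun [set: omega] g -> (forall v, 0 <= g v) ->
    \int[mu]_v g (v + [ffun i => if i \in s then p i else 0])%R =
    \int[mu]_v (g v * (expR (\sum_(i <- s) (p i * v i - p i ^+ 2 / 2)))%:E).
  have := H (index_enum I) (index_enum_uniq I) f mf f0.
  by rewrite (_ : [ffun i => _] = p)//; apply/ffunP => i; rewrite ffunE mem_index_enum.
elim: s => [_ g mg g0|i s IH /= /andP[iNs us] g mg g0].
  apply: eq_integral => v _; rewrite big_nil expR0 mule1; congr g.
  by apply/ffunP => i; rewrite !ffunE in_nil addr0.
pose E (v : omega) := (expR (\sum_(i <- s) (p i * v i - p i ^+ 2 / 2)))%:E.
have mE : measurable_fun [set: omega] E.
  apply/measurable_EFinP; apply: measurableT_comp => //.
  apply: measurable_sum => j; apply: measurable_funB => //.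
  by apply: measurable_funM => //; exact: measurable_coord.
have E0 v : 0 <= E v by rewrite lee_fin expR_ge0.
pose D : omega := [ffun j => if j == i then p i else 0%R].
transitivity (\int[mu]_v g (v + [ffun i => if i \in s then p i else 0] + D)%R).
  apply: eq_integral => v _; congr g; apply/ffunP => j; rewrite !ffunE in_cons.
  have [->|ji] /= := eqVneq j i; first by rewrite (negbTE iNs) addr0.
  by rewrite addr0.
have mgD : measurable_fun [set: omega] (fun v => g (v + D)%R).
  by apply: measurableT_comp => //; exact: measurable_shift.
rewrite (IH us (fun v => g (v + D)%R) mgD (fun v => g0 _)).
have ED v : E (v + D)%R = E v.
  congr (expR _)%:E; apply: eq_big_seq => j js; rewrite !ffunE.
  by case: eqP => [ji|_]; rewrite ?addr0//; rewrite -ji js in iNs.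
transitivity (\int[mu]_v (g (v + D)%R * E (v + D)%R)).
  by apply: eq_integral => v _; rewrite ED.
rewrite (@single_shift i (p i) (fun v => g v * E v)); last 3 first.
- exact: pS.
- exact: emeasurable_funM.
- by move=> v; rewrite mule_ge0.
apply: eq_integral => v _; rewrite -muleA -EFinM -expRD big_cons.
by rewrite [(_ + \sum_(_ <- _) _)%R]addrC.
Qed.

(** The cross term vanishes because the Gaussian law is symmetric, so the average
of the integrand at t and - t may be integrated instead. *)
Lemma gauss_affine_sq (c z : R) :
  \int[centered_normal 1%R]_t ((c * t + z) ^+ 2)%:E = (c ^+ 2 + z ^+ 2)%:E.
Proof.
have m2 (a b : R) : measurable_fun setT (fun t : R => ((a * t + b) ^+ 2)%:E).
  apply/measurable_EFinP; apply: measurable_funX; exact: measurable_affine.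
have mm : measurable_fun setT (fun t : R => (t ^+ 2)%:E).
  by apply/measurable_EFinP; exact: exprn_measurable.
set A := (X in X = _).
have AN : \int[centered_normal 1%R]_t ((- c * t + z) ^+ 2)%:E = A.
  rewrite /A -(@gauss_opp _ (fun t => ((c * t + z) ^+ 2)%:E))//.
    by apply: eq_integral => t _; rewrite mulrN mulNr.
  by move=> t; rewrite lee_fin; nneg.
have A0 : 0 <= A by apply: integral_ge0 => t _; rewrite lee_fin; nneg.
have AA : A + A = (2 * (c ^+ 2 + z ^+ 2))%:E.
  rewrite -{1}AN /A -ge0_integralD//; try by move=> t _; rewrite lee_fin; nneg.
  transitivity (\int[centered_normal 1%R]_t ((2 * c ^+ 2)%:E * (t ^+ 2)%:E + (2 * z ^+ 2)%:E)).
    by apply: eq_integral => t _; rewrite -EFinM -!EFinD; congr EFin; ring.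
  rewrite ge0_integralD//; last 3 first.
  - by move=> t _; rewrite -EFinM lee_fin; nneg.
  - exact: measurable_funeM.
  - by move=> t _; rewrite lee_fin; nneg.
  rewrite ge0_integralZl//; last 2 first.
  - by move=> t _; rewrite lee_fin; nneg.
  - by rewrite lee_fin; nneg.
  rewrite gauss_second_moment integral_cst_probability mule1.
  by rewrite -EFinD mulrDr.
have : A \is a fin_num.
  rewrite ge0_fin_numE// ltey; apply/eqP => Ao.
  by move: AA; rewrite Ao.
move: AA; case: A {AN A0} => // r; rewrite -EFinD => -[] rr _; congr EFin.
lra.
Qed.

Lemma gauss_affine_fourth (c z : R) :
  \int[centered_normal 1%R]_t ((c * t + z) ^+ 4)%:E <=
  (96 * c ^+ 4 + 6 * c ^+ 2 * z ^+ 2 + z ^+ 4)%:E.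
Proof.
have m4 (a b : R) : measurable_fun setT (fun t : R => ((a * t + b) ^+ 4)%:E).
  apply/measurable_EFinP; apply: measurable_funX; exact: measurable_affine.
have mt n : measurable_fun setT (fun t : R => (t ^+ n)%:E).
  by apply/measurable_EFinP; exact: exprn_measurable.
have e4 (x : R) : (0 <= x ^+ 4)%R by rewrite exprn_even_ge0.
have e2 (x : R) : (0 <= x ^+ 2)%R by rewrite exprn_even_ge0.
set A := (X in X <= _).
have AN : \int[centered_normal 1%R]_t ((- c * t + z) ^+ 4)%:E = A.
  rewrite /A -(@gauss_opp _ (fun t => ((c * t + z) ^+ 4)%:E))//; last first.
    by move=> t; rewrite lee_fin.
  by apply: eq_integral => t _; rewrite mulrN mulNr.
have A0 : 0 <= A by apply: integral_ge0 => t _; rewrite lee_fin.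
have AA : A + A <= (2 * (96 * c ^+ 4 + 6 * c ^+ 2 * z ^+ 2 + z ^+ 4))%:E.
  rewrite -{1}AN /A -ge0_integralD//; try by move=> t _; rewrite lee_fin.
  rewrite (eq_integral (fun t : R => (2 * c ^+ 4)%:E * (t ^+ 4)%:E +
    ((12 * (c ^+ 2 * z ^+ 2))%:E * (t ^+ 2)%:E + (2 * z ^+ 4)%:E))); last first.
    by move=> t _; rewrite -!EFinM -!EFinD; congr EFin; ring.
  rewrite ge0_integralD//; last 4 first.
  - by move=> t _; rewrite -EFinM lee_fin; nneg.
  - exact: measurable_funeM.
  - by move=> t _; rewrite -EFinM -EFinD lee_fin; nneg.
  - by apply: emeasurable_funD => //; exact: measurable_funeM.
  rewrite ge0_integralD//; last 3 first.
  - by move=> t _; rewrite -EFinM lee_fin; nneg.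
  - exact: measurable_funeM.
  - by move=> t _; rewrite lee_fin; nneg.
  rewrite !ge0_integralZl//; try (by move=> t _; rewrite lee_fin; nneg);
    try (by rewrite lee_fin; nneg).
  rewrite gauss_second_moment integral_cst_probability mule1.
  apply: (@le_trans _ _ ((2 * c ^+ 4)%:E * 96%:E + ((12 * (c ^+ 2 * z ^+ 2))%:E + (2 * z ^+ 4)%:E))).
    rewrite leeD2r// lee_wpmul2l//; last exact: gauss_fourth_moment_le.
    by rewrite lee_fin; nneg.
  by rewrite -EFinM -!EFinD lee_fin; lra.
have : A \is a fin_num.
  rewrite ge0_fin_numE// ltey; apply/eqP => Ao.
  by move: AA; rewrite Ao.
move: AA; case: A {AN A0} => // r; rewrite -EFinD !lee_fin => rr _.
lra.
Qed.

Definition supported_standard (c : I -> R) := forall i, c i != 0%R -> standard i.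

Let partial_lin (s : seq I) (c : I -> R) (v : omega) : R := (\sum_(i <- s) c i * v i)%R.

Let measurable_partial_lin s c : measurable_fun [set: omega] (partial_lin s c).
Proof.
apply: measurable_sum => i; apply: measurable_funM => //.
exact: measurable_coord.
Qed.

Let partial_lin_update s c v i t : i \notin s ->
  partial_lin (i :: s) c (update v i t) = (c i * t + partial_lin s c v)%R.
Proof.
move=> iNs; rewrite /partial_lin big_cons ffunE eqxx; congr (_ + _)%R.
apply: eq_big_seq => j js; rewrite ffunE.
by case: eqP => // ji; rewrite -ji js in iNs.
Qed.

Let partial_lin_sq s c : supported_standard c -> uniq s ->
  \int[mu]_v (partial_lin s c v ^+ 2)%:E = (\sum_(i <- s) c i ^+ 2)%:E.
Proof.
move=> cS; elim: s => [_|i s IH /= /andP[iNs us]].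
  rewrite integral0_eq ?big_nil// => v _; by rewrite /partial_lin big_nil expr0n.
have mp s' : measurable_fun [set: omega] (fun v => (partial_lin s' c v ^+ 2)%:E).
  by apply/measurable_EFinP; apply: measurable_funX.
rewrite (resample1 nu_mu i)//; last by move=> v; rewrite lee_fin; nneg.
transitivity (\int[mu]_v ((c i ^+ 2)%:E + (partial_lin s c v ^+ 2)%:E)).
  apply: eq_integral => v _.
  under eq_integral do rewrite partial_lin_update//.
  have [c0|c0] := eqVneq (c i) 0%R; last by rewrite (cS i c0) gauss_affine_sq.
  under eq_integral do rewrite c0 mul0r add0r.
  by rewrite integral_cst_probability c0 expr0n/= add0e.
rewrite ge0_integralD//; last 2 first.
- by move=> v _; rewrite lee_fin; nneg.
- by move=> v _; rewrite lee_fin; nneg.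
by rewrite IH// integral_cst_probability big_cons.
Qed.

Lemma lin_sq c : supported_standard c ->
  \int[mu]_v (lin c v ^+ 2)%:E = (\sum_i c i ^+ 2)%:E.
Proof. by move=> cS; apply: (partial_lin_sq cS); exact: index_enum_uniq. Qed.

(** Induction on the coordinates: adding one of them adds
at most 96 c^4 + 6 c^2 z^2 to the fourth power of the remaining sum z, on average, by symmetry. *)
Lemma lin_fourth c : supported_standard c ->
  \int[mu]_v (lin c v ^+ 4)%:E <= (96 * (\sum_i c i ^+ 2) ^+ 2)%:E.
Proof.
move=> cS.
suff H s : uniq s ->
    \int[mu]_v (partial_lin s c v ^+ 4)%:E <= (96 * (\sum_(i <- s) c i ^+ 2) ^+ 2)%:E.
  exact: H (index_enum_uniq I).
elim: s => [_|i s IH /= /andP[iNs us]].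
  rewrite integral0_eq ?lee_fin; last first.
    by move=> v _; rewrite /partial_lin big_nil expr0n.
  by nneg.
have mp s' n : measurable_fun [set: omega] (fun v => (partial_lin s' c v ^+ n)%:E).
  by apply/measurable_EFinP; apply: measurable_funX.
rewrite (resample1 nu_mu i)//; last by move=> v; rewrite lee_fin; nneg.
apply: (@le_trans _ _ (\int[mu]_v ((96 * c i ^+ 4)%:E +
  ((6 * c i ^+ 2)%:E * (partial_lin s c v ^+ 2)%:E + (partial_lin s c v ^+ 4)%:E)))).
  apply: ge0_le_integral => //.
  - by move=> v _; apply: integral_ge0 => t _; rewrite lee_fin; nneg.
  - have mu2 : measurable_fun [set: omega * R]
        (fun z => (partial_lin (i :: s) c (update z.1 i z.2) ^+ 4)%:E).
      apply: (measurableT_comp (mp (i :: s) 4%N)); exact: measurable_update2.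
    by apply: (measurable_fun_fubini_tonelli_F _ mu2) => z; rewrite lee_fin; nneg.
  - by apply: emeasurable_funD => //; apply: emeasurable_funD => //; exact: measurable_funeM.
  - move=> v _; under eq_integral do rewrite partial_lin_update//.
    rewrite -!EFinM -!EFinD.
    have [c0|c0] := eqVneq (c i) 0%R; last first.
      by rewrite (cS i c0) addrA; exact: gauss_affine_fourth.
    under eq_integral do rewrite c0 mul0r add0r.
    by rewrite integral_cst_probability c0 !expr0n/= !mulr0 mul0r !add0r.
rewrite ge0_integralD//; last 3 first.
- by move=> v _; rewrite lee_fin; nneg.
- by move=> v _; rewrite -EFinM -EFinD lee_fin; nneg.
- by apply: emeasurable_funD => //; exact: measurable_funeM.
rewrite ge0_integralD//; last 3 first.
- by move=> v _; rewrite -EFinM lee_fin; nneg.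
- exact: measurable_funeM.
- by move=> v _; rewrite lee_fin; nneg.
rewrite ge0_integralZl//; last 2 first.
- by move=> v _; rewrite lee_fin; nneg.
- by rewrite lee_fin; nneg.
rewrite partial_lin_sq// integral_cst_probability big_cons.
have := IH us; set S := (\sum_(_ <- _) _)%R => IHs.
apply: (@le_trans _ _ ((96 * c i ^+ 4)%:E + ((6 * c i ^+ 2)%:E * S%:E + (96 * S ^+ 2)%:E))).
  by rewrite leeD2l// leeD2l.
rewrite -EFinM -!EFinD lee_fin.
have S0 : (0 <= S)%R by apply: sumr_ge0 => j _; nneg.
have c20 : (0 <= c i ^+ 2)%R by nneg.
rewrite -[(c i ^+ 4)%R]/(c i ^+ (2 * 2))%R exprM; move: (c i ^+ 2)%R c20 => x x0.
nra.
Qed.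

(** Polarisation of [lin_sq]. *)
Lemma lin_mul c c' : supported_standard c -> supported_standard c' ->
  mu.-integrable setT (fun v => (lin c v * lin c' v)%:E) /\
  \int[mu]_v (lin c v * lin c' v)%:E = (\sum_i c i * c' i)%:E.
Proof.
move=> cS cS'.
have cSD (e : R) : supported_standard (fun i => c i + e * c' i)%R.
  move=> i; have [c0|/cS//] := eqVneq (c i) 0%R.
  have [c0'|/cS'//] := eqVneq (c' i) 0%R.
  by rewrite c0 c0' mulr0 addr0 eqxx.
have linD e v : lin (fun i => c i + e * c' i)%R v = (lin c v + e * lin c' v)%R.
  by rewrite /lin mulr_sumr -big_split/=; apply: eq_bigr => i _; ring.
have isq c1 : supported_standard c1 -> mu.-integrable setT (fun v => (lin c1 v ^+ 2)%:E).
  move=> c1S; apply/integrableP; split.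
    by apply/measurable_EFinP; apply: measurable_funX; exact: measurable_lin.
  under eq_integral => v _ do rewrite gee0_abs ?lee_fin ?sqr_ge0//.
  by rewrite lin_sq// ltry.
have E v : (lin c v * lin c' v)%:E =
    (4^-1)%:E * (lin (fun i => c i + 1 * c' i)%R v ^+ 2)%:E
    - (4^-1)%:E * (lin (fun i => c i + (- 1) * c' i)%R v ^+ 2)%:E.
  by rewrite -!EFinM -EFinB; congr EFin; rewrite !linD; field.
have i1 := integrableZl measurableT (4^-1)%R (isq _ (cSD 1%R)).
have i2 := integrableZl measurableT (4^-1)%R (isq _ (cSD (-1)%R)).
split.
  rewrite (_ : (fun v => _) = (fun v => (4^-1)%:E * (lin (fun i => c i + 1 * c' i)%R v ^+ 2)%:E
    - (4^-1)%:E * (lin (fun i => c i + (- 1) * c' i)%R v ^+ 2)%:E)); last exact/funext.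
  exact: integrableB.
under eq_integral do rewrite E.
rewrite integralB// !integralZl//; try exact: isq.
rewrite (lin_sq (cSD 1%R)) (lin_sq (cSD (-1)%R)) -!EFinM -EFinB; congr EFin.
by rewrite -mulrBr -sumrB mulr_sumr; apply: eq_bigr => i _; field.
Qed.

(** A product of one-dimensional integrals [gauss_exp_quad]. *)
Lemma integral_row_exp_quad (L : nat) (w : 'I_L -> I) (beta : 'I_L -> R) (s : R) :
  injective w -> (forall l, standard (w l)) -> (0 <= s)%R ->
  \int[mu]_v (expR (\sum_l (beta l * v (w l) - s * v (w l) ^+ 2 / 2)))%:E =
  (expR (- (L%:R * ln (Num.sqrt (1 + s))) + (1 + s)^-1 / 2 * \sum_l beta l ^+ 2))%:E.
Proof.
move=> wi wS s0.
have s1 : (0 < Num.sqrt (1 + s))%R by rewrite sqrtr_gt0; lra.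
transitivity (\int[mu]_v (\prod_(l <- index_enum 'I_L)
    expR (beta l * v (w l) - s * v (w l) ^+ 2 / 2))%:E).
  by apply: eq_integral => v _; rewrite expR_sum.
rewrite (@integral_prod_coord _ _ _ _ nu_mu _ w (index_enum 'I_L)
  (fun l t => expR (beta l * t - s * t ^+ 2 / 2)%R)
  (fun l => (Num.sqrt (1 + s))^-1 * expR (beta l ^+ 2 / (1 + s) / 2))%R).
- congr EFin; rewrite big_split/= -expR_sum prodr_const card_ord expRD; congr (_ * expR _)%R.
    by rewrite expRN expRM_natl lnK ?posrE// exprVn.
  by rewrite mulr_sumr; apply: eq_bigr => l _; ring.
- by rewrite map_inj_uniq// index_enum_uniq.
- move=> l; apply: measurableT_comp => //; apply: measurable_funB.
    exact: mulrl_measurable.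
  by apply: measurable_funM => //; apply: measurable_funM => //; exact: exprn_measurable.
- by move=> l t; exact: expR_ge0.
- by move=> l _; rewrite wS gauss_exp_quad//; lra.
Qed.

End gaussian_vector.

(** * Trace forms and matrices with a Gaussian-like shift density *)

Section matrix_functions.
Context {d} {T : measurableType d} {R : realType}.

Lemma measurable_mulmx m n p (F : T -> 'M[R]_(m, n)) (G : T -> 'M[R]_(n, p)) :
  measurable_fun setT F -> measurable_fun setT G ->
  measurable_fun setT (fun t => F t *m G t).
Proof.
move=> mF mG; apply: measurable_fun_matrix => i j.
under eq_fun do rewrite mxE.
apply: measurable_sum => k; apply: measurable_funM.
  exact: (measurableT_comp (measurable_entry i k) mF).
exact: (measurableT_comp (measurable_entry k j) mG).
Qed.

Lemma measurable_addmx m n (F G : T -> 'M[R]_(m, n)) :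
  measurable_fun setT F -> measurable_fun setT G ->
  measurable_fun setT (fun t => F t + G t).
Proof.
move=> mF mG; apply: measurable_fun_matrix => i j.
under eq_fun do rewrite mxE.
apply: measurable_funD.
  exact: (measurableT_comp (measurable_entry i j) mF).
exact: (measurableT_comp (measurable_entry i j) mG).
Qed.

Lemma measurable_sum_mx m n (J : Type) (s : seq J) (F : J -> T -> 'M[R]_(m, n)) :
  (forall j, measurable_fun setT (F j)) ->
  measurable_fun setT (fun t => \sum_(j <- s) F j t).
Proof.
move=> mF; apply: measurable_fun_matrix => i j.
under eq_fun do rewrite summxE.
apply: measurable_sum => k; exact: (measurableT_comp (measurable_entry i j) (mF k)).
Qed.

Lemma measurable_trmx m n (F : T -> 'M[R]_(m, n)) :
  measurable_fun setT F -> measurable_fun setT (fun t => (F t)^T).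
Proof.
move=> mF; apply: measurable_fun_matrix => i j.
under eq_fun do rewrite mxE.
exact: (measurableT_comp (measurable_entry j i) mF).
Qed.

Lemma measurable_mxtrace m (F : T -> 'M[R]_m) :
  measurable_fun setT F -> measurable_fun setT (fun t => \tr (F t)).
Proof.
move=> mF; apply: measurable_sum => i.
exact: (measurableT_comp (measurable_entry i i) mF).
Qed.

End matrix_functions.

Section trace_form.
Context {R : realType} {m L : nat}.
Implicit Types (K M : 'M[R]_m) (X Y : 'M[R]_(m, L)).

(** The sum over the L columns of the bilinear form of K. *)
Definition trform K X Y : R := \tr (X^T *m K *m Y).

Lemma trformDl K X X' Y : trform K (X + X') Y = trform K X Y + trform K X' Y.
Proof. by rewrite /trform raddfD/= !mulmxDl mxtraceD. Qed.

Lemma trformDr K X Y Y' : trform K X (Y + Y') = trform K X Y + trform K X Y'.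
Proof. by rewrite /trform mulmxDr mxtraceD. Qed.

Lemma trformC K X Y : K^T = K -> trform K X Y = trform K Y X.
Proof.
by move=> KT; rewrite /trform -mxtrace_tr !trmx_mul trmxK KT mulmxA.
Qed.

Lemma trformBK K M X Y : trform (K - M) X Y = trform K X Y - trform M X Y.
Proof. by rewrite /trform mulmxBr mulmxBl raddfB. Qed.

Lemma trformZK (c : R) K X Y : trform (c *: K) X Y = c * trform K X Y.
Proof. by rewrite /trform -scalemxAr -scalemxAl mxtraceZ. Qed.

Lemma trform0l K Y : trform K 0 Y = 0.
Proof. by rewrite /trform trmx0 !mul0mx mxtrace0. Qed.

Lemma trform_col K (a : 'cV[R]_m) (w : 'rV[R]_L) Y :
  trform K (a *m w) Y = \sum_l w 0 l * (a^T *m K *m Y) 0 l.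
Proof.
rewrite /trform trmx_mul -!mulmxA; apply: eq_bigr => l _.
by rewrite mxE big_ord1 mxE !mulmxA.
Qed.

Lemma trform_rank1 (b : 'cV[R]_m) X Y :
  trform (b *m b^T) X Y = \sum_l (b^T *m X) 0 l * (b^T *m Y) 0 l.
Proof.
have -> : trform (b *m b^T) X Y = \tr ((b^T *m X)^T *m (b^T *m Y)).
  by rewrite /trform trmx_mul trmxK !mulmxA.
by apply: eq_bigr => l _; rewrite mxE big_ord1 mxE.
Qed.

Lemma measurable_trform d (T : measurableType d) K (F G : T -> 'M[R]_(m, L)) :
  measurable_fun setT F -> measurable_fun setT G ->
  measurable_fun setT (fun t => trform K (F t) (G t)).
Proof.
move=> mF mG; apply: measurable_mxtrace; apply: measurable_mulmx => //.
by apply: measurable_mulmx => //; exact: measurable_trmx.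
Qed.

End trace_form.

Section psd.
Context {R : realType} {m : nat}.
Implicit Types (K M S : 'M[R]_m) (x : 'cV[R]_m).

Definition qform K x : R := (x^T *m K *m x) 0 0.

Definition psd K := forall x, 0 <= qform K x.

Lemma psd_rank1 (b : 'cV[R]_m) : psd (b *m b^T).
Proof.
move=> x; have -> : qform (b *m b^T) x = ((b^T *m x)^T *m (b^T *m x)) 0 0.
  by rewrite /qform trmx_mul trmxK !mulmxA.
by rewrite mxE big_ord1 mxE -expr2 sqr_ge0.
Qed.

Lemma psd_sum (J : Type) (s : seq J) (P : pred J) (F : J -> 'M[R]_m) :
  (forall j, P j -> psd (F j)) -> psd (\sum_(j <- s | P j) F j).
Proof.
move=> pF x; rewrite /qform mulmx_sumr mulmx_suml summxE.
by apply: sumr_ge0 => j Pj; exact: pF.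
Qed.

(** x^T K x = (K x)^T S (K x). *)
Lemma psd_inv K S : K^T = K -> K *m S = 1%:M -> psd S -> psd K.
Proof.
move=> KT KS pS x.
suff -> : qform K x = qform S (K *m x) by exact: pS.
rewrite /qform trmx_mul KT; congr (fun_of_matrix _ 0 0).
by rewrite -!mulmxA (mulmxA K S) KS mul1mx.
Qed.

(** The inverse of S + a a^T when K is the inverse of S (Sherman-Morrison). *)
Definition update_precision K (a : 'cV[R]_m) : 'M[R]_m :=
  K - (1 + qform K a)^-1 *: (K *m a *m (a^T *m K)).

Lemma update_precision_sym K a : K^T = K -> (update_precision K a)^T = update_precision K a.
Proof.
by move=> KT; rewrite /update_precision raddfB/= linearZ/= !trmx_mul KT trmxK.
Qed.

Lemma update_precision_inv K S a : 1 + qform K a != 0 -> K *m S = 1%:M ->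
  update_precision K a *m (S + a *m a^T) = 1%:M.
Proof.
move=> q0 KS; rewrite /update_precision mulmxBl mulmxDr KS -scalemxAl mulmxDr.
rewrite -!(mulmxA (K *m a)) -(mulmxA _ K S) KS mulmx1.
rewrite (mulmxA (a^T *m K) a) [a^T *m K *m a]mx11_scalar -/(qform K a) mul_scalar_mx.
rewrite -scalemxAr -[X in X + _ *: _]scale1r -scalerDl scalerA mulVf// scale1r.
by rewrite mulmxA addrK.
Qed.

Lemma update_precision_le K a x : K^T = K -> 0 <= qform K a ->
  qform (update_precision K a) x <= qform K x.
Proof.
move=> KT q0; have -> : qform (update_precision K a) x =
    qform K x - (1 + qform K a)^-1 * qform ((K *m a) *m (K *m a)^T) x.
  rewrite /qform /update_precision mulmxBr mulmxBl trmx_mul KT.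
  rewrite -scalemxAr -scalemxAl mxE; congr (_ + _).
  by rewrite mxE; congr (- _); rewrite mxE.
rewrite gerBl mulr_ge0 ?invr_ge0 ?addr_ge0//; exact: psd_rank1.
Qed.

End psd.

Section gaussian_matrix.
Context {R : realType} {I : finType}.
Local Notation omega := {ffun I -> R}.
Variables (nu : I -> probability R R) (mu : probability omega R).
Hypothesis nu_mu : product_law (fun i => nu i) mu.
Context {m L : nat}.
Local Notation MY := 'M[R]_(m, L).
Local Open Scope ereal_scope.

(** The Cameron-Martin formula for a matrix with L independent Gaussian columns of
precision K. This is the only property of a Gaussian background that is used,
so that no density with respect to Lebesgue measure is ever needed. *)
Definition gausslike (eta : omega -> MY) (K : 'M[R]_m) :=
  forall (H : MY) (g : MY -> \bar R),
    measurable_fun [set: MY] g -> (forall y, 0 <= g y) ->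
    \int[mu]_v g (eta v + H)%R =
    \int[mu]_v (g (eta v) *
       (expR (trform K H (eta v) - trform K H H / 2))%:E).

Definition getrow (w : 'I_L -> I) (v : omega) : 'rV[R]_L := \row_l v (w l).

Lemma measurable_getrow w : measurable_fun [set: omega] (getrow w).
Proof.
apply: measurable_fun_matrix => i j.
rewrite (_ : (fun v : omega => _) = (fun v : omega => v (w j))).
  exact: measurable_coord.
by apply/funext => v; rewrite mxE.
Qed.

Section add_row.
Variables (eta : omega -> MY) (K : 'M[R]_m) (a : 'cV[R]_m) (w : 'I_L -> I).
Hypotheses (meta : measurable_fun [set: omega] eta) (etaK : gausslike eta K).
Hypotheses (KT : K^T = K) (aK : (0 <= qform K a)%R).
Hypotheses (wi : injective w) (wS : forall l, standard nu (w l)).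
Hypothesis eta_row : forall v' v, eta (merge (mem (codom w)) v' v) = eta v.

Let s := qform K a.
Let kappa : R := (- (L%:R * ln (Num.sqrt (1 + s))))%R.
Let eta' v : MY := (eta v + a *m getrow w v)%R.

Let mcst (H : MY) : measurable_fun [set: omega] (fun=> H).
Proof. exact: measurable_cst. Qed.

Let main (H : MY) (g : MY -> \bar R) :
  measurable_fun [set: MY] g -> (forall y, 0 <= g y) ->
  \int[mu]_v g (eta' v + H)%R =
  \int[mu]_v (g (eta v) * (expR (kappa + trform K H (eta v) - trform K H H / 2
     + (1 + s)^-1 / 2 * \sum_l (a^T *m K *m eta v - a^T *m K *m H) 0 l ^+ 2))%:E).
Proof.
move=> mg g0.
pose F (z : omega * omega) := g (eta z.2 + (a *m getrow w z.1 + H))%R.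
have mF : measurable_fun setT F.
  apply: measurableT_comp => //; apply: measurable_addmx.
    exact: (measurableT_comp meta measurable_snd).
  apply: measurable_addmx; last exact: measurable_cst.
  apply: measurable_mulmx; first exact: measurable_cst.
  exact: (measurableT_comp (measurable_getrow w) measurable_fst).
pose e (v' v : omega) := expR (trform K (a *m getrow w v' + H)%R (eta v) -
    trform K (a *m getrow w v' + H)%R (a *m getrow w v' + H)%R / 2).
pose G (z : omega * omega) := g (eta z.2) * (e z.1 z.2)%:E.
have mG : measurable_fun setT G.
  apply: emeasurable_funM.
    apply: measurableT_comp => //; exact: (measurableT_comp meta measurable_snd).
  apply/measurable_EFinP; apply: measurableT_comp => //.
  have mH : measurable_fun [set: omega * omega] (fun z => a *m getrow w z.1 + H)%R.
    apply: measurable_addmx; last exact: measurable_cst.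
    apply: measurable_mulmx; first exact: measurable_cst.
    exact: (measurableT_comp (measurable_getrow w) measurable_fst).
  apply: measurable_funB; last apply: measurable_funM => //.
    by apply: measurable_trform => //; exact: (measurableT_comp meta measurable_snd).
  exact: measurable_trform.
have G0 z : 0 <= G z by rewrite mule_ge0// lee_fin expR_ge0.
transitivity (\int[mu]_v \int[mu]_v' F (v', v)).
  rewrite (resample nu_mu (mem (codom w))); last 2 first.
  - apply: measurableT_comp => //; apply: measurable_addmx => //.
    apply: measurable_addmx => //; apply: measurable_mulmx; first exact: measurable_cst.
    exact: measurable_getrow.
  - by [].
  apply: eq_integral => v _; apply: eq_integral => v' _.
  rewrite /F /eta' /= eta_row addrA; congr (g (_ + _ *m _ + _)%R).
  apply/rowP => l; rewrite !mxE ffunE; case: ifP => // /negP[].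
  exact: codom_f.
transitivity (\int[mu]_v' \int[mu]_v F (v', v)).
  exact/esym/(fubini_tonelli F mF (fun z => g0 _)).
transitivity (\int[mu]_v' \int[mu]_v G (v', v)).
  by apply: eq_integral => v' _; rewrite /F /G/=; exact: etaK.
transitivity (\int[mu]_v \int[mu]_v' G (v', v)).
  exact: (fubini_tonelli G mG G0).
apply: eq_integral => v _; rewrite /G/=.
pose beta l : R := ((a^T *m K *m eta v - a^T *m K *m H) 0 l)%R.
have betaE l : beta l = ((a^T *m K *m eta v) 0 l - (a^T *m K *m H) 0 l)%R.
  by rewrite /beta mxE [X in (_ + X)%R]mxE.
have eE v' : e v' v = (expR (trform K H (eta v) - trform K H H / 2) *
    expR (\sum_l (beta l * v' (w l) - s * v' (w l) ^+ 2 / 2)))%R.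
  rewrite -expRD; congr expR.
  set r := getrow w v'.
  have rE l : r 0%R l = v' (w l) by rewrite mxE.
  have cross : trform K H (a *m r)%R = trform K (a *m r)%R H by exact: trformC.
  rewrite !trformDl !trformDr cross !trform_col.
  have sq : (\sum_l r 0 l * (a^T *m K *m (a *m r)) 0 l = \sum_l s * v' (w l) ^+ 2)%R.
    apply: eq_bigr => l _; rewrite mulmxA [(a^T *m K *m a)%R]mx11_scalar mul_scalar_mx.
    by rewrite -/(qform K a) [((_ *: r) _ _)%R]mxE rE /s; ring.
  rewrite sq sumrB -mulr_suml.
  have -> : (\sum_l beta l * v' (w l) =
     \sum_l r 0 l * (a^T *m K *m eta v) 0 l - \sum_l r 0 l * (a^T *m K *m H) 0 l)%R.
    by rewrite -sumrB; apply: eq_bigr => l _; rewrite betaE rE; ring.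
  by field.
under eq_integral do rewrite eE EFinM muleA.
rewrite ge0_integralZl//; last 2 first.
- apply/measurable_EFinP; apply: measurableT_comp => //.
  apply: measurable_sum => l; apply: measurable_funB.
    by apply: measurable_funM => //; exact: measurable_coord.
  apply: measurable_funM => //; apply: measurable_funM => //.
  by apply: measurable_funX; exact: measurable_coord.
- by rewrite mule_ge0// lee_fin expR_ge0.
rewrite (integral_row_exp_quad nu_mu)// -muleA -EFinM -expRD; congr (_ * (expR _)%:E).
rewrite -/kappa /beta; ring.
Qed.

(** Given the row w, the added term a w is a shift of eta, whose cost is
exponential in a linear and a quadratic function of w. Integrating over w gives
an exponential of a quadratic form in eta, by completing the square. *)
Lemma add_row_density (g : MY -> \bar R) :
  measurable_fun [set: MY] g -> (forall y, 0 <= g y) ->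
  \int[mu]_v g (eta v + a *m getrow w v)%R =
  \int[mu]_v (g (eta v) * (expR (kappa +
     trform (K - update_precision K a) (eta v) (eta v) / 2))%:E).
Proof.
move=> mg g0; have := main 0%R mg g0.
under eq_integral do rewrite addr0.
move=> ->; apply: eq_integral => v _; congr (_ * (expR _)%:E).
rewrite !trform0l mulmx0 subr0 mul0r addr0 subr0 mulrAC.
rewrite /update_precision subKr trformZK.
have -> : (K *m a *m (a^T *m K) = (K *m a) *m (K *m a)^T)%R by rewrite trmx_mul KT.
by rewrite trform_rank1 trmx_mul KT.
Qed.

(** The same computation with an additional constant shift H. *)
Lemma add_row_gausslike :
  gausslike (fun v => eta v + a *m getrow w v)%R (update_precision K a).
Proof.
move=> H g mg g0; rewrite -/eta'.
have := main H mg g0; rewrite {1}/eta' => ->.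
pose e (y : MY) : R := expR (trform (update_precision K a) H y
   - trform (update_precision K a) H H / 2).
rewrite [RHS](@add_row_density (fun y => g y * (e y)%:E)); last 2 first.
- apply: emeasurable_funM => //; apply/measurable_EFinP.
  apply: measurableT_comp => //; apply: measurable_funB => //.
  by apply: measurable_trform; [exact: measurable_cst|exact: measurable_id].
- by move=> y; rewrite mule_ge0// lee_fin expR_ge0.
apply: eq_integral => v _; rewrite -muleA -EFinM -expRD; congr (_ * (expR _)%:E).
set c := (1 + s)^-1%R; set y := eta v.
have updE X Y : trform (update_precision K a) X Y = (trform K X Y -
    c * \sum_l (a^T *m K *m X) 0 l * (a^T *m K *m Y) 0 l)%R.
  rewrite /update_precision trformBK trformZK.
  have -> : (K *m a *m (a^T *m K) = (K *m a) *m (K *m a)^T)%R by rewrite trmx_mul KT.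
  by rewrite trform_rank1 trmx_mul KT.
rewrite trformBK !updE.
have -> : (\sum_l (a^T *m K *m y - a^T *m K *m H) 0 l ^+ 2 =
   \sum_l (a^T *m K *m y) 0 l * (a^T *m K *m y) 0 l
   - 2 * \sum_l (a^T *m K *m H) 0 l * (a^T *m K *m y) 0 l
   + \sum_l (a^T *m K *m H) 0 l * (a^T *m K *m H) 0 l)%R.
  rewrite mulr_sumr -sumrB -big_split/=; apply: eq_bigr => l _.
  by rewrite mxE [X in (_ + X)%R]mxE; ring.
by field.
Qed.

End add_row.

End gaussian_matrix.

(** * Rescaled Gaussian coordinates and weighted sums of Gaussian rows *)

Section gaussian_scaling.
Context {R : realType} {I : finType}.
Local Notation omega := {ffun I -> R}.
Variables (nu : I -> probability R R) (mu : probability omega R).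
Hypothesis nu_mu : product_law (fun i => nu i) mu.
Local Open Scope ereal_scope.

Definition rescale (r : I -> R) (v : omega) : omega := [ffun i => r i * v i]%R.

Lemma measurable_rescale r : measurable_fun [set: omega] (rescale r).
Proof.
apply: measurable_finfun => i; apply: measurable_funM => //.
exact: measurable_coord.
Qed.

(** The logarithm of the density of the law of r t with respect to that of t, for t standard Gaussian. *)
Definition scale_log (r t : R) : R := - ln r + (t ^+ 2 / 2) * (1 - (r ^+ 2)^-1).

Lemma measurable_scale_log r : measurable_fun [set: R] (scale_log r).
Proof.
apply: measurable_funD => //; apply: measurable_funM => //; apply: measurable_funM => //.
Qed.

Let single_rescale i (r : R) (f : omega -> \bar R) : (0 < r)%R ->
  (r != 1 -> standard nu i)%R -> measurable_fun [set: omega] f -> (forall v, 0 <= f v) ->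
  \int[mu]_v f (rescale (fun j => if j == i then r else 1%R) v) =
  \int[mu]_v (f v * (expR (scale_log r (v i)))%:E).
Proof.
move=> r0 rS mf f0; have [->|r1] := eqVneq r 1%R.
  apply: eq_integral => v _.
  rewrite /scale_log ln1 oppr0 add0r expr1n invr1 subrr mulr0 expR0 mule1; congr f.
  by apply/ffunP => j; rewrite !ffunE; case: ifP; rewrite mul1r.
have me : measurable_fun [set: omega] (fun v : omega => (expR (scale_log r (v i)))%:E).
  apply/measurable_EFinP; apply: measurableT_comp => //.
  exact: (measurableT_comp (measurable_scale_log r) (measurable_coord i)).
rewrite (resample1 nu_mu i); last 2 first.
- by apply: measurableT_comp => //; exact: measurable_rescale.
- by [].
rewrite [RHS](resample1 nu_mu i); last 2 first.
- exact: emeasurable_funM.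
- by move=> v; rewrite mule_ge0// lee_fin expR_ge0.
apply: eq_integral => v _; rewrite (rS r1).
have mfu : measurable_fun setT (fun t => f (update v i t)).
  by apply: measurableT_comp => //; exact: measurable_update.
transitivity (\int[centered_normal 1%R]_t f (update v i (r * t + 0)%R)).
  apply: eq_integral => t _; congr f; apply/ffunP => j; rewrite !ffunE.
  by case: ifP => _; rewrite ?mul1r ?addr0.
rewrite (@gauss_affine _ r 0 (fun t => f (update v i t)))//.
apply: eq_integral => t _; congr (_ * _%:E); rewrite ffunE eqxx.
rewrite /scale_log [in RHS]expRD expRN lnK ?posrE//; congr (_ * expR _)%R.
by rewrite subr0; field; rewrite gt_eqF.
Qed.

(** One coordinate at a time, by [gauss_affine] without shift. *)
Lemma gaussian_rescale (r : I -> R) (f : omega -> \bar R) :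
  (forall i, 0 < r i)%R -> (forall i, r i != 1%R -> standard nu i) ->
  measurable_fun [set: omega] f -> (forall v, 0 <= f v) ->
  \int[mu]_v f (rescale r v) =
  \int[mu]_v (f v * (expR (\sum_i scale_log (r i) (v i)))%:E).
Proof.
move=> r0 rS mf f0.
suff H (s : seq I) : uniq s -> forall g : omega -> \bar R,
    measurable_fun [set: omega] g -> (forall v, 0 <= g v) ->
    \int[mu]_v g (rescale (fun i => if i \in s then r i else 1%R) v) =
    \int[mu]_v (g v * (expR (\sum_(i <- s) scale_log (r i) (v i)))%:E).
  have := H (index_enum I) (index_enum_uniq I) f mf f0.
  rewrite (_ : (fun i => _) = r)//; apply/funext => i; by rewrite mem_index_enum.
elim: s => [_ g mg g0|i s IH /= /andP[iNs us] g mg g0].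
  apply: eq_integral => v _; rewrite big_nil expR0 mule1; congr g.
  by apply/ffunP => i; rewrite !ffunE mul1r.
pose E (v : omega) := (expR (\sum_(i <- s) scale_log (r i) (v i)))%:E.
have mE : measurable_fun [set: omega] E.
  apply/measurable_EFinP; apply: measurableT_comp => //.
  apply: measurable_sum => j.
  exact: (measurableT_comp (measurable_scale_log _) (measurable_coord j)).
have E0 v : 0 <= E v by rewrite lee_fin expR_ge0.
pose D : omega -> omega := rescale (fun j => if j == i then r i else 1%R).
have mgD : measurable_fun [set: omega] (fun v => g (D v)).
  by apply: measurableT_comp => //; exact: measurable_rescale.
transitivity (\int[mu]_v g (D (rescale (fun i => if i \in s then r i else 1%R) v))).
  apply: eq_integral => v _; congr g; apply/ffunP => j; rewrite !ffunE in_cons.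
  have [->|ji] /= := eqVneq j i; first by rewrite (negbTE iNs) mul1r.
  by rewrite mul1r.
rewrite (IH us (fun v => g (D v)) mgD (fun v => g0 _)).
have ED v : E (D v) = E v.
  congr (expR _)%:E; apply: eq_big_seq => j js; rewrite !ffunE.
  by case: eqP => [ji|_]; rewrite ?mul1r//; rewrite -ji js in iNs.
transitivity (\int[mu]_v (g (D v) * E (D v))).
  by apply: eq_integral => v _; rewrite ED.
rewrite (@single_rescale i (r i) (fun v => g v * E v)); last 4 first.
- exact: r0.
- exact: rS.
- exact: emeasurable_funM.
- by move=> v; rewrite mule_ge0.
apply: eq_integral => v _; rewrite -muleA -EFinM -expRD big_cons.
by rewrite [(_ + \sum_(_ <- _) _)%R]addrC.
Qed.

End gaussian_scaling.

Section integral_rsum.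
Local Open Scope ereal_scope.
Context d (T : measurableType d) (R : realType) (mu : {measure set T -> \bar R}).

Lemma integral_rsum (K : Type) (s : seq K) (F : K -> T -> R) (c : K -> R) :
  (forall k, mu.-integrable setT (EFin \o F k) /\ \int[mu]_t (F k t)%:E = (c k)%:E) ->
  mu.-integrable setT (EFin \o (fun t => \sum_(k <- s) F k t)%R) /\
  \int[mu]_t (\sum_(k <- s) F k t)%R%:E = (\sum_(k <- s) c k)%R%:E.
Proof.
move=> Fc; elim: s => [|k s [IH1 IH2]].
  rewrite (_ : (EFin \o _) = cst 0); last by apply/funext => t /=; rewrite big_nil.
  split; first exact: integrable0.
  by under eq_integral do rewrite big_nil; rewrite integral0 big_nil.
have [h1 h2] := Fc k.
rewrite (_ : (EFin \o _) = (EFin \o F k) \+ (EFin \o (fun t => \sum_(k <- s) F k t)%R)).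
  split; first exact: integrableD.
  under eq_integral do rewrite big_cons EFinD.
  by rewrite integralD// h2 IH2 big_cons.
by apply/funext => t /=; rewrite big_cons.
Qed.

End integral_rsum.

Section row_family.
Context {R : realType} {I J : finType} {m L : nat}.
Local Notation omega := {ffun I -> R}.
Local Notation MY := 'M[R]_(m, L).
Variables (nu : I -> probability R R) (mu : probability omega R).
Hypothesis nu_mu : product_law (fun i => nu i) mu.
Variable ix : J * 'I_L -> I.
Hypothesis ix_inj : injective ix.
Local Open Scope ereal_scope.

Definition row_of (j : J) : omega -> 'rV[R]_L := getrow (fun l => ix (j, l)).

Definition rowsum (b : J -> 'cV[R]_m) (s : seq J) (v : omega) : MY :=
  (\sum_(j <- s) b j *m row_of j v)%R.

Definition rowcov (b : J -> 'cV[R]_m) (s : seq J) : 'M[R]_m :=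
  (\sum_(j <- s) b j *m (b j)^T)%R.

(** Extends a family of coefficients indexed by rows and columns to all
coordinates, by zero. *)
Definition spread (s : seq J) (F : J -> 'I_L -> R) : omega :=
  [ffun i => \sum_(j <- s) \sum_l if ix (j, l) == i then F j l else 0]%R.

Lemma spread_ix s F j l : uniq s ->
  spread s F (ix (j, l)) = if j \in s then F j l else 0%R.
Proof.
move=> us; rewrite ffunE.
transitivity (\sum_(j' <- s) if j' == j then F j l else 0)%R.
  apply: eq_bigr => j' _; case: eqP => [->|j'j].
    rewrite (bigD1 l)//= eqxx big1 ?addr0// => l' l'l.
    by rewrite (inj_eq ix_inj) xpair_eqE (negbTE l'l) andbF.
  rewrite big1// => l' _; rewrite (inj_eq ix_inj) xpair_eqE.
  by case: eqP j'j.
rewrite -big_mkcond/= big_const_seq count_uniq_mem//.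
by case: (j \in s) => //=; rewrite addr0.
Qed.

Lemma sum_spread s F (v : I -> R) :
  (\sum_i spread s F i * v i = \sum_(j <- s) \sum_l F j l * v (ix (j, l)))%R.
Proof.
transitivity (\sum_i \sum_(j <- s) \sum_l
    (if ix (j, l) == i then F j l else 0) * v i)%R.
  apply: eq_bigr => i _; rewrite ffunE mulr_suml; apply: eq_bigr => j _.
  by rewrite mulr_suml.
rewrite exchange_big/=; apply: eq_bigr => j _.
rewrite exchange_big/=; apply: eq_bigr => l _.
rewrite (bigD1 (ix (j, l)))//= eqxx big1 ?addr0// => i.
by rewrite eq_sym => /negbTE ->; rewrite mul0r.
Qed.

Lemma spread_supported s F :
  (forall j l, F j l != 0%R -> standard nu (ix (j, l))) ->
  supported_standard nu (spread s F).
Proof.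
move=> FS i; rewrite ffunE => H; apply/not_notP => nS; move/eqP: H; apply.
rewrite big1// => j _; rewrite big1// => l _; case: eqP => // ji.
by have [//|/FS] := eqVneq (F j l) 0%R; rewrite ji.
Qed.

Lemma row_ofD j (v p : omega) : row_of j (v + p)%R = (row_of j v + row_of j p)%R.
Proof. by apply/rowP => l; rewrite !mxE ffunE. Qed.

Lemma measurable_row_of j : measurable_fun [set: omega] (row_of j).
Proof. exact: measurable_getrow. Qed.

Lemma measurable_rowsum b s : measurable_fun [set: omega] (rowsum b s).
Proof.
apply: measurable_sum_mx => j; apply: measurable_mulmx => //.
exact: measurable_row_of.
Qed.

Lemma trform_rows (K : 'M[R]_m) (H : MY) b s (r : J -> 'rV[R]_L) : K^T = K ->
  trform K H (\sum_(j <- s) b j *m r j)%R =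
  (\sum_(j <- s) \sum_l ((b j)^T *m K *m H) 0 l * r j 0 l)%R.
Proof.
move=> KT; elim: s => [|j s IH].
  by rewrite !big_nil trformC// trform0l.
rewrite !big_cons trformDr IH; congr (_ + _)%R.
by rewrite trformC// trform_col; apply: eq_bigr => l _; rewrite mulrC.
Qed.

Section base.
Variables (b : J -> 'cV[R]_m).
Hypothesis bS : forall j l, b j != 0%R -> standard nu (ix (j, l)).

(** A shift of the sum by H is produced by shifting the row j by b_j^T K H, because
sum_j b_j b_j^T K = 1; the coordinates are then shifted by [cameron_martin]. *)
Lemma rowsum_gausslike s (K : 'M[R]_m) : uniq s -> K^T = K ->
  (K *m rowcov b s)%R = 1%:M -> gausslike mu (rowsum b s) K.
Proof.
move=> us KT KS H g mg g0.
pose F j l := ((b j)^T *m K *m H)%R 0%R l.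
have FS j l : F j l != 0%R -> standard nu (ix (j, l)).
  move=> Fjl; apply: bS; apply: contra_neq Fjl => bj0.
  by rewrite /F bj0 trmx0 !mul0mx mxE.
have SK : (rowcov b s *m K = 1%:M)%R by exact: mulmx1C.
have rF j : j \in s -> row_of j (spread s F) = ((b j)^T *m K *m H)%R.
  by move=> js; apply/rowP => l; rewrite mxE spread_ix// js.
have HE : H = (\sum_(j <- s) b j *m ((b j)^T *m K *m H))%R.
  rewrite -[LHS]mul1mx -SK -mulmxA mulmx_suml; apply: eq_bigr => j _.
  by rewrite !mulmxA.
transitivity (\int[mu]_v g (rowsum b s (v + spread s F)%R)).
  apply: eq_integral => v _; congr g; rewrite {1}HE /rowsum -big_split/=.
  by apply: eq_big_seq => j js; rewrite row_ofD mulmxDr rF.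
rewrite (@cameron_martin _ _ _ _ nu_mu _ (fun v => g (rowsum b s v))); last 3 first.
- exact: spread_supported.
- by apply: measurableT_comp => //; exact: measurable_rowsum.
- by [].
apply: eq_integral => v _; congr (_ * (expR _)%:E).
have -> : trform K H H = trform K H (\sum_(j <- s) b j *m ((b j)^T *m K *m H))%R.
  by rewrite -HE.
rewrite sumrB sum_spread !trform_rows//; congr (_ - _)%R.
  by apply: eq_bigr => j _; apply: eq_bigr => l _; rewrite [row_of _ _ _ _]mxE.
rewrite -mulr_suml; congr (_ / _)%R.
under eq_bigr do rewrite expr2.
rewrite sum_spread; apply: eq_big_seq => j js; apply: eq_bigr => l _.
by rewrite spread_ix// js.
Qed.

(** Distinct coordinates are uncorrelated, so only the diagonal terms
b_j^T M b_j survive, each one L times. *)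
Lemma rowsum_second_moment s (M : 'M[R]_m) : uniq s ->
  mu.-integrable setT (fun v => (trform M (rowsum b s v) (rowsum b s v))%:E) /\
  \int[mu]_v (trform M (rowsum b s v) (rowsum b s v))%:E =
    (L%:R * \tr (M *m rowcov b s))%:E.
Proof.
move=> us.
pose c i l := spread s (fun j l' => if l' == l then b j i 0%R else 0%R).
have yE i l v : rowsum b s v i l = lin (c i l) v.
  rewrite /lin sum_spread /rowsum summxE; apply: eq_bigr => j _.
  rewrite mxE big_ord1 mxE (bigD1 l)//= eqxx big1 ?addr0// => l' /negbTE ->.
  by rewrite mul0r.
have cS i l : supported_standard nu (c i l).
  apply: spread_supported => j l'; case: ifP => _; rewrite ?eqxx// => bji.
  by apply: bS; apply: contra_neq bji => ->; rewrite mxE.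
have cc i i' l : (\sum_k c i l k * c i' l k = rowcov b s i i')%R.
  rewrite sum_spread /rowcov summxE; apply: eq_big_seq => j js.
  rewrite mxE big_ord1 mxE (bigD1 l)//= eqxx big1 ?addr0; last first.
    by move=> l' /negbTE ->; rewrite mul0r.
  by rewrite spread_ix// js eqxx.
have ilin i i' l := lin_mul nu_mu (cS i l) (cS i' l).
have E v : trform M (rowsum b s v) (rowsum b s v) =
    (\sum_l \sum_i \sum_i' M i i' * (lin (c i l) v * lin (c i' l) v))%R.
  rewrite /trform; apply: eq_bigr => l _; rewrite mxE.
  under eq_bigr do rewrite mxE mulr_suml.
  rewrite exchange_big/=; apply: eq_bigr => i _; apply: eq_bigr => i' _.
  by rewrite mxE !yE; ring.
have ME : (L%:R * \tr (M *m rowcov b s) =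
    \sum_(l < L) \sum_i \sum_i' M i i' * rowcov b s i i')%R.
  rewrite sumr_const card_ord mulr_natl; congr (_ *+ _)%R.
  apply: eq_bigr => i _; rewrite mxE; apply: eq_bigr => i' _; congr (_ * _)%R.
  by rewrite /rowcov !summxE; apply: eq_bigr => j _; rewrite !mxE !big_ord1 !mxE mulrC.
rewrite ME (_ : (fun v => _) = EFin \o (fun v =>
  \sum_l \sum_i \sum_i' M i i' * (lin (c i l) v * lin (c i' l) v))%R); last first.
  by apply/funext => v /=; rewrite E.
apply: integral_rsum => l; apply: integral_rsum => i; apply: integral_rsum => i'.
have [h1 h2] := ilin i i' l; split; first exact: (integrableZl measurableT (M i i') h1).
under eq_integral do rewrite EFinM.
by rewrite integralZl// h2 -EFinM cc.
Qed.

End base.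

End row_family.

(** * Testing two laws with exponential-quadratic densities *)

Section testing.
Local Open Scope ereal_scope.
Context d (T : measurableType d) (R : realType) (mu : probability T R).
Context {m L : nat}.
Local Notation MY := 'M[R]_(m, L).

(** Both laws of a test are compared with the same background eta. *)
Definition quad_density (Y eta : T -> MY) (kappa : R) (D : 'M[R]_m) :=
  forall g : MY -> \bar R, measurable_fun [set: MY] g -> (forall y, 0 <= g y) ->
  \int[mu]_v g (Y v) =
  \int[mu]_v (g (eta v) * (expR (kappa + trform D (eta v) (eta v) / 2))%:E).

(** Integrate t f 1_B <= (f - 1) ln f + (e^t - 1) 1_B, where f is the density of the law
of Y1 with respect to the law of Y0. As ln f is an affine function of the quadratic form D1 - D0, the
mean of (f - 1) ln f is half the difference of the means of this form under
the two laws; the normalising constants cancel. *)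
Lemma two_point_test (Y1 Y0 eta : T -> MY) (k1 k0 : R) (D1 D0 : 'M[R]_m)
    (c1 c0 t : R) (B : set MY) :
  measurable_fun setT Y1 -> measurable_fun setT Y0 -> measurable_fun setT eta ->
  quad_density Y1 eta k1 D1 -> quad_density Y0 eta k0 D0 ->
  (mu.-integrable setT (fun v => (trform (D1 - D0) (Y1 v) (Y1 v))%:E) /\
   \int[mu]_v (trform (D1 - D0) (Y1 v) (Y1 v))%:E = c1%:E) ->
  (mu.-integrable setT (fun v => (trform (D1 - D0) (Y0 v) (Y0 v))%:E) /\
   \int[mu]_v (trform (D1 - D0) (Y0 v) (Y0 v))%:E = c0%:E) ->
  (0 <= t)%R -> measurable B ->
  t%:E * \int[mu]_v (\1_B (Y1 v))%:E <=
  ((c1 - c0) / 2)%:E + (expR t - 1)%:E * \int[mu]_v (\1_B (Y0 v))%:E.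
Proof.
move=> mY1 mY0 meta d1 d0 [i1 e1] [i0 e0] t0 mB.
pose l (y : MY) : R := (k1 - k0 + trform (D1 - D0) y y / 2)%R.
have ml : measurable_fun [set: MY] l.
  apply: measurable_funD => //; apply: measurable_funM => //.
  by apply: measurable_trform; exact: measurable_id.
pose lp y := (Num.max (l y) 0)%R; pose ln y := (Num.max (- l y) 0)%R.
have mlp : measurable_fun [set: MY] (fun y => (lp y)%:E).
  by apply/measurable_EFinP; exact: measurable_maxr.
have mln : measurable_fun [set: MY] (fun y => (ln y)%:E).
  by apply/measurable_EFinP; apply: measurable_maxr => //; exact: measurableT_comp.
have lp0 y : 0 <= (lp y)%:E by rewrite lee_fin le_max lexx orbT.
have ln0 y : 0 <= (ln y)%:E by rewrite lee_fin le_max lexx orbT.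
have m1 : measurable_fun [set: MY] (fun y => (\1_B y : R)%:E).
  by apply/measurable_EFinP; exact: measurable_indic.
have i10 y : 0 <= (\1_B y : R)%:E by rewrite lee_fin.
pose f k D (y : MY) : R := expR (k + trform D y y / 2)%R.
have mf k D : measurable_fun [set: MY] (fun y => (f k D y)%:E).
  apply/measurable_EFinP; apply: measurableT_comp => //.
  apply: measurable_funD => //; apply: measurable_funM => //.
  by apply: measurable_trform; exact: measurable_id.
have f0 k D y : (0 <= f k D y)%R by exact: expR_ge0.
(* Both parts of l have finite means, so the signed comparison of the two laws
   can be carried out on nonnegative integrals. *)
have parts Y c : measurable_fun setT Y ->
    mu.-integrable setT (fun v => (trform (D1 - D0) (Y v) (Y v))%:E) ->
    \int[mu]_v (trform (D1 - D0) (Y v) (Y v))%:E = c%:E ->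
    exists p q : R, [/\ \int[mu]_v (lp (Y v))%:E = p%:E,
      \int[mu]_v (ln (Y v))%:E = q%:E & (p - q = k1 - k0 + c / 2)%R].
  move=> mY iY eY.
  have icst : mu.-integrable setT (fun=> (k1 - k0)%:E).
    exact: finite_measure_integrable_cst.
  have ih := integrableZl measurableT (2^-1)%R iY.
  have lE : (fun v => (l (Y v))%:E) = (fun v => (k1 - k0)%:E +
      (2^-1)%:E * (trform (D1 - D0) (Y v) (Y v))%:E).
    by apply/funext => v; rewrite -EFinM -EFinD mulrC.
  have il : mu.-integrable setT (fun v => (l (Y v))%:E).
    by rewrite lE; exact: (integrableD measurableT icst ih).
  have el : \int[mu]_v (l (Y v))%:E = (k1 - k0 + c / 2)%:E.
    rewrite lE (integralD measurableT icst ih) integral_cst_probability.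
    by rewrite integralZl// eY -EFinM -EFinD mulrC.
  have ppE : (fun v => (lp (Y v))%:E) = (fun v => (l (Y v))%:E)^\+.
    by apply/funext => v; rewrite funeposE EFin_max.
  have nnE : (fun v => (ln (Y v))%:E) = (fun v => (l (Y v))%:E)^\-.
    by apply/funext => v; rewrite funenegE EFin_max EFinN.
  have pfin : \int[mu]_v (lp (Y v))%:E \is a fin_num.
    by rewrite ppE; exact: integrable_pos_fin_num.
  have qfin : \int[mu]_v (ln (Y v))%:E \is a fin_num.
    by rewrite nnE; exact: integrable_neg_fin_num.
  exists (fine (\int[mu]_v (lp (Y v))%:E)), (fine (\int[mu]_v (ln (Y v))%:E)).
  split; [by rewrite fineK|by rewrite fineK|].
  apply: EFin_inj; rewrite EFinB !fineK// -el.
  by rewrite [RHS]integralE ppE nnE.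
have [p1 [q1 [P1 Q1 PQ1]]] := parts Y1 c1 mY1 i1 e1.
have [p0 [q0 [P0 Q0 PQ0]]] := parts Y0 c0 mY0 i0 e0.
have key : t%:E * \int[mu]_v (\1_B (Y1 v))%:E + (q1 + p0)%:E <=
    (p1 + q0)%:E + (expR t - 1)%:E * \int[mu]_v (\1_B (Y0 v))%:E.
  have et0 : (0 <= expR t - 1)%R by rewrite subr_ge0 -expR0 ler_expR.
  have comb (G H : MY -> R) : measurable_fun setT G -> measurable_fun setT H ->
      (forall y, 0 <= G y)%R -> (forall y, 0 <= H y)%R ->
      measurable_fun setT (fun v => (G (eta v) * f k1 D1 (eta v) + H (eta v) * f k0 D0 (eta v))%:E) /\
      \int[mu]_v (G (Y1 v))%:E + \int[mu]_v (H (Y0 v))%:E =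
      \int[mu]_v (G (eta v) * f k1 D1 (eta v) + H (eta v) * f k0 D0 (eta v))%:E.
    move=> mG mH G0 H0.
    have m2 (g : MY -> R) k D : measurable_fun setT g ->
        measurable_fun setT (fun v => (g (eta v) * f k D (eta v))%:E).
      move=> mg; apply: (@measurableT_comp _ _ _ _ _ _ (fun y => (g y * f k D y)%:E)) => //.
      apply/measurable_EFinP; apply: measurable_funM => //.
      apply/measurable_EFinP; exact: mf.
    split; first by under eq_fun do rewrite EFinD; apply: emeasurable_funD; exact: m2.
    rewrite (d1 (fun y => (G y)%:E)); [|exact/measurable_EFinP|by move=> y; rewrite lee_fin].
    rewrite (d0 (fun y => (H y)%:E)); [|exact/measurable_EFinP|by move=> y; rewrite lee_fin].
    rewrite -ge0_integralD//.
    - by move=> v _; rewrite -EFinM lee_fin mulr_ge0// expR_ge0.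
    - exact: m2.
    - by move=> v _; rewrite -EFinM lee_fin mulr_ge0// expR_ge0.
    - exact: m2.
  have mind : measurable_fun setT (fun y : MY => \1_B y : R) by exact: measurable_indic.
  have mlpR : measurable_fun setT lp by exact/measurable_EFinP.
  have mlnR : measurable_fun setT ln by exact/measurable_EFinP.
  pose G1 y := (t * \1_B y + ln y)%R.
  pose H2 y := (ln y + (expR t - 1) * \1_B y)%R.
  have mG1 : measurable_fun setT G1 by apply: measurable_funD => //; apply: measurable_funM.
  have mH2 : measurable_fun setT H2 by apply: measurable_funD => //; apply: measurable_funM.
  have G10 y : (0 <= G1 y)%R by rewrite addr_ge0 ?mulr_ge0// -lee_fin.
  have H20 y : (0 <= H2 y)%R by rewrite addr_ge0 ?mulr_ge0// -lee_fin.
  have lpR0 y : (0 <= lp y)%R by rewrite -lee_fin.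
  have [mL eL] := comb G1 lp mG1 mlpR G10 lpR0.
  have [mR eR] := comb lp H2 mlpR mH2 lpR0 H20.
  have -> : t%:E * \int[mu]_v (\1_B (Y1 v))%:E + (q1 + p0)%:E =
      \int[mu]_v (G1 (Y1 v))%:E + \int[mu]_v (lp (Y0 v))%:E.
    rewrite EFinD -Q1 -P0 addeA; congr (_ + _).
    under [RHS]eq_integral do rewrite EFinD EFinM.
    rewrite ge0_integralD//.
    - by rewrite ge0_integralZl//; exact: (measurableT_comp m1 mY1).
    - by move=> v _; rewrite -EFinM lee_fin mulr_ge0.
    - by apply: measurable_funeM; exact: (measurableT_comp m1 mY1).
    - exact: (measurableT_comp mln mY1).
  have -> : (p1 + q0)%:E + (expR t - 1)%:E * \int[mu]_v (\1_B (Y0 v))%:E =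
      \int[mu]_v (lp (Y1 v))%:E + \int[mu]_v (H2 (Y0 v))%:E.
    rewrite EFinD -P1 -Q0 -addeA; congr (_ + _).
    under [RHS]eq_integral do rewrite EFinD EFinM.
    rewrite ge0_integralD//.
    - by rewrite ge0_integralZl//; exact: (measurableT_comp m1 mY0).
    - exact: (measurableT_comp mln mY0).
    - by move=> v _; rewrite -EFinM lee_fin mulr_ge0.
    - by apply: measurable_funeM; exact: (measurableT_comp m1 mY0).
  rewrite eL eR; apply: ge0_le_integral => //.
    by move=> v _; rewrite lee_fin addr_ge0// mulr_ge0 ?expR_ge0.
  move=> v _; rewrite lee_fin; move: (eta v) => y.
  have -> : f k1 D1 y = (f k0 D0 y * expR (l y))%R.
    by rewrite /f -expRD; congr expR; rewrite /l trformBK; field.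
  have e1l := @expR_ge1Dx R (l y).
  have e1ml := @expR_ge1Dx R (- l y).
  have etl := @expR_ge1Dx R (t - l y).
  have x0 := expR_gt0 (l y).
  have xt : (expR t = expR (l y) * expR (t - l y))%R by rewrite -expRD addrC subrK.
  have xm : (1 = expR (l y) * expR (- l y))%R by rewrite -expRD subrr expR0.
  have lpln : (lp y - ln y = l y)%R.
    by rewrite /lp /ln; case: (leP (l y) 0%R) => h; case: (leP (- l y)%R 0%R) => h'; lra.
  suff : (t * \1_B y * expR (l y) <= (expR (l y) - 1) * l y + (expR t - 1) * \1_B y)%R.
    rewrite /G1 /H2 => H; have := f0 k0 D0 y; move: (f _ _ _) => F F0.
    have := ler_wpM2l F0 H; rewrite -lpln; lra.
  rewrite indicE; case: (y \in B) => /=.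
    move: etl e1l x0; rewrite xt; move: (expR (l y)) (expR (t - l y)) => x z; nra.
  move: e1ml e1l x0 xm; move: (expR (l y)) (expR (- l y)) => x z; nra.
have fin1 : \int[mu]_v (\1_B (Y1 v))%:E \is a fin_num.
  rewrite ge0_fin_numE ?integral_ge0//; apply: (@le_lt_trans _ _ (\int[mu]_v (1%R%:E))).
    apply: ge0_le_integral => //; first exact: (measurableT_comp m1 mY1).
    by move=> v _; rewrite lee_fin indicE; case: (_ \in _).
  by rewrite integral_cst_probability ltry.
have fin0 : \int[mu]_v (\1_B (Y0 v))%:E \is a fin_num.
  rewrite ge0_fin_numE ?integral_ge0//; apply: (@le_lt_trans _ _ (\int[mu]_v (1%R%:E))).
    apply: ge0_le_integral => //; first exact: (measurableT_comp m1 mY0).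
    by move=> v _; rewrite lee_fin indicE; case: (_ \in _).
  by rewrite integral_cst_probability ltry.
move: key; rewrite -(fineK fin1) -(fineK fin0) -!EFinM -!EFinD !lee_fin.
lra.
Qed.

End testing.

(** * The Loewner order and the densities of longer sums of rows *)

Section trace_inequality.
Context {R : realType} {m : nat}.
Implicit Types (A B K D : 'M[R]_m).

(** Positive semidefinite, witnessed by a decomposition into rank-one terms. All
positivity needed about traces of products then follows termwise. *)
Definition gram (M : 'M[R]_m) :=
  exists (J : finType) (c : J -> 'cV[R]_m), M = \sum_j c j *m (c j)^T.

Definition loewner_le A B := forall x, qform A x <= qform B x.

Lemma mxtrace_gram A D (J : finType) (c : J -> 'cV[R]_m) : D^T = D ->
  \tr (A *m D *m (\sum_j c j *m (c j)^T) *m D) = \sum_j qform A (D *m c j).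
Proof.
move=> DT; rewrite mulmx_sumr mulmx_suml raddf_sum/=; apply: eq_bigr => j _.
have -> : qform A (D *m c j) = \tr ((c j)^T *m D *m (A *m D *m c j)).
  by rewrite /qform trmx_mul DT !mulmxA [RHS]big_ord1.
by rewrite [RHS]mxtrace_mulC !mulmxA.
Qed.

Lemma mxtrace_gram_le A B D M : D^T = D -> loewner_le A B -> gram M ->
  \tr (A *m D *m M *m D) <= \tr (B *m D *m M *m D).
Proof.
move=> DT AB [J [c ->]]; rewrite !mxtrace_gram//.
by apply: ler_sum => j _; exact: AB.
Qed.

(** Each of the two outer precisions is replaced in turn by the larger K. *)
Lemma mxtrace_sandwich_le A B K D : D^T = D -> loewner_le A K -> loewner_le B K ->
  gram B -> gram K -> \tr (A *m D *m B *m D) <= \tr (K *m D *m K *m D).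
Proof.
move=> DT AK BK gB gK; apply: (le_trans (mxtrace_gram_le DT AK gB)).
have -> : \tr (K *m D *m B *m D) = \tr (B *m D *m K *m D).
  by rewrite -mulmxA mxtrace_mulC !mulmxA.
exact: mxtrace_gram_le.
Qed.

(** K = K S K^T. *)
Lemma gram_inv K S : K^T = K -> K *m S = 1%:M -> gram S -> gram K.
Proof.
move=> KT KS [J [c SE]]; exists J, (fun j => K *m c j).
rewrite -[LHS]mulmx1 -(mulmx1C KS) SE mulmxA mulmx_sumr mulmx_suml.
by apply: eq_bigr => j _; rewrite trmx_mul KT !mulmxA.
Qed.

Lemma gram_sum (J : finType) (c : J -> 'cV[R]_m) (s : seq J) : uniq s ->
  gram (\sum_(j <- s) c j *m (c j)^T).
Proof.
move=> us; exists J, (fun j => if j \in s then c j else 0).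
rewrite big_uniq// big_mkcond/=; apply: eq_bigr => j _.
by case: (j \in s); rewrite ?mul0mx.
Qed.

(** K0 - K1 = K0 (S1 - S0) K1. *)
Lemma precision_difference K0 K1 S0 S1 : K0 *m S0 = 1%:M -> K1 *m S1 = 1%:M ->
  (K0 - K1) *m (S1 - S0) = K0 *m (S1 - S0) *m K1 *m (S1 - S0).
Proof.
move=> KS0 KS1; congr (_ *m _).
by rewrite mulmxBr KS0 mulmxBl mul1mx -mulmxA (mulmx1C KS1) mulmx1.
Qed.

End trace_inequality.

Section adding_rows.
Context {R : realType} {I J : finType} {m L : nat}.
Local Notation omega := {ffun I -> R}.
Local Notation MY := 'M[R]_(m, L).
Variables (nu : I -> probability R R) (mu : probability omega R).
Hypothesis nu_mu : product_law (fun i => nu i) mu.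
Variable ix : J * 'I_L -> I.
Hypothesis ix_inj : injective ix.
Variables (b : J -> 'cV[R]_m) (s0 : seq J) (K0 : 'M[R]_m).
Hypotheses (KT0 : K0^T = K0) (KS0 : K0 *m rowcov b s0 = 1%:M).
Hypothesis b_std : forall j l, b j != 0 -> standard nu (ix (j, l)).

Lemma rowcov_psd s : psd (rowcov b s).
Proof. by apply: psd_sum => j _; exact: psd_rank1. Qed.

Lemma rowsum_merge s j v' v : j \notin s ->
  rowsum (L := L) ix b s (merge (mem (codom (fun l => ix (j, l)))) v' v) = rowsum ix b s v.
Proof.
move=> jNs; apply: eq_big_seq => j' js; congr (_ *m _); apply/rowP => l.
rewrite !mxE ffunE; case: ifP => // /codomP[l' /ix_inj [jj' _]].
by rewrite -jj' js in jNs.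
Qed.

(** Rows are added one at a time; each step updates the precision by a
nonpositive rank-one term and multiplies the density by an exponential
of a quadratic form. *)
Lemma add_rows s : uniq (s ++ s0) ->
  (forall j l, j \in s -> standard nu (ix (j, l))) ->
  exists (K : 'M[R]_m) (kappa : R), [/\ K^T = K, K *m rowcov b (s ++ s0) = 1%:M,
    loewner_le K K0, gausslike mu (rowsum ix b (s ++ s0)) K &
    quad_density mu (rowsum ix b (s ++ s0)) (rowsum (L := L) ix b s0) kappa (K0 - K)].
Proof.
elim: s => [|j s IH] us sS.
  exists K0, 0; split => //.
    exact: (rowsum_gausslike nu_mu ix_inj).
  move=> g mg g0; apply: eq_integral => v _.
  by rewrite subrr /trform mulmx0 mul0mx mxtrace0 mul0r addr0 expR0 mule1.
have [jNs us'] := andP us.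
have [|K [kappa [KT KS KK0 gK dK]]] := IH us'.
  by move=> j' l js; apply: sS; rewrite inE js orbT.
have bK : 0 <= qform K (b j).
  exact: (psd_inv KT KS (@rowcov_psd _)).
pose w l := ix (j, l).
have wi : injective w by move=> l l' /ix_inj [].
have wS l : standard nu (w l) by apply: sS; rewrite mem_head.
have wm v' v := rowsum_merge v' v jNs.
have meta := measurable_rowsum (L := L) ix b (s ++ s0).
have E v : rowsum ix b ((j :: s) ++ s0) v = rowsum ix b (s ++ s0) v + b j *m getrow w v.
  by rewrite /rowsum cat_cons big_cons addrC.
have dens := add_row_density nu_mu meta gK KT bK wi wS wm.
have glike := add_row_gausslike nu_mu meta gK KT bK wi wS wm.
exists (update_precision K (b j)), (kappa - L%:R * ln (Num.sqrt (1 + qform K (b j)))).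
split.
- exact: update_precision_sym.
- rewrite /rowcov cat_cons big_cons addrC; apply: update_precision_inv => //.
  by rewrite gt_eqF// ltr_wpDr.
- by move=> x; apply: (le_trans _ (KK0 x)); exact: update_precision_le.
- by rewrite (_ : rowsum ix b _ = fun v => rowsum ix b (s ++ s0) v + b j *m getrow w v)//; exact/funext.
- move=> g mg g0; under eq_integral do rewrite E.
  rewrite (dens g mg g0).
  pose e (y : MY) : R := expR (- (L%:R * ln (Num.sqrt (1 + qform K (b j)))) +
     trform (K - update_precision K (b j)) y y / 2).
  rewrite (dK (fun y => g y * (e y)%:E)%E); last 2 first.
  + apply: emeasurable_funM => //; apply/measurable_EFinP.
    apply: measurableT_comp => //; apply: measurable_funD => //.
    by apply: measurable_funM => //; apply: measurable_trform; exact: measurable_id.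
  + by move=> y; rewrite mule_ge0// lee_fin expR_ge0.
  apply: eq_integral => v _; rewrite -muleA -EFinM -expRD; congr (_ * (expR _)%:E)%E.
  by rewrite !trformBK; field.
Qed.

End adding_rows.

(** * Second moments of quadratic forms in Gaussian columns *)

Section column_moments.
Context {R : realType} {I : finType} {m n : nat}.
Local Notation omega := {ffun I -> R}.
Variables (nu : I -> probability R R) (mu : probability omega R).
Hypothesis nu_mu : product_law (fun i => nu i) mu.
Variable ax : 'I_n * 'I_m -> I.
Hypothesis ax_inj : injective ax.
Hypothesis ax_std : forall k, standard nu (ax k).
Local Open Scope ereal_scope.

Definition colv (i : 'I_n) (v : omega) : 'cV[R]_m := (row_of ax i v)^T%R.

Lemma colvE i v r o : colv i v r o = v (ax (i, r)).
Proof. by rewrite !mxE. Qed.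

Lemma measurable_colv i : measurable_fun [set: omega] (colv i).
Proof. by apply: measurable_trmx; exact: measurable_row_of. Qed.

Lemma measurable_qform d (T : measurableType d) (K : T -> 'M[R]_m) (x : T -> 'cV[R]_m) :
  measurable_fun setT K -> measurable_fun setT x ->
  measurable_fun setT (fun t => qform (K t) (x t)).
Proof.
move=> mK mx; apply: (measurableT_comp (measurable_entry 0%R 0%R)).
apply: measurable_mulmx => //; apply: measurable_mulmx => //; exact: measurable_trmx.
Qed.

Definition colcoef (i : 'I_n) (c : 'cV[R]_m) : omega := spread ax [:: i] (fun _ r => c r 0%R).

Lemma colcoef_std i c : supported_standard nu (colcoef i c).
Proof. by apply: spread_supported => j r _; exact: ax_std. Qed.

Lemma lin_colcoef i (c : 'cV[R]_m) v : lin (colcoef i c) v = (c^T *m colv i v)%R 0%R 0%R.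
Proof.
rewrite /lin sum_spread big_seq1 mxE; apply: eq_bigr => r _.
by rewrite mxE colvE.
Qed.

Lemma colcoef_sq i c : (\sum_k colcoef i c k ^+ 2 = \sum_r c r 0 ^+ 2)%R.
Proof.
under eq_bigr do rewrite expr2.
rewrite sum_spread big_seq1; apply: eq_bigr => r _.
by rewrite spread_ix// mem_seq1 eqxx expr2.
Qed.

Let ip (i : 'I_n) (c : 'cV[R]_m) (v : omega) : R := (c^T *m colv i v)%R 0%R 0%R.

Let mip i c : measurable_fun [set: omega] (ip i c).
Proof.
rewrite (_ : ip i c = lin (colcoef i c)); first exact: measurable_lin.
by apply/funext => v; rewrite lin_colcoef.
Qed.

Lemma inner_sq i (c : 'cV[R]_m) :
  \int[mu]_v (((c^T *m colv i v)%R 0%R 0%R) ^+ 2)%:E = (\sum_r c r 0 ^+ 2)%R%:E.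
Proof.
rewrite -(colcoef_sq i) -(lin_sq nu_mu (@colcoef_std i c)).
by apply: eq_integral => v _; rewrite lin_colcoef.
Qed.

Let inner_fourth i (c : 'cV[R]_m) :
  \int[mu]_v (ip i c v ^+ 4)%:E <= (96 * (\sum_r c r 0 ^+ 2) ^+ 2)%R%:E.
Proof.
rewrite -(colcoef_sq i); apply: le_trans (lin_fourth nu_mu (@colcoef_std i c)).
by rewrite (eq_integral (fun v => (lin (colcoef i c) v ^+ 4)%:E))// => v _; rewrite lin_colcoef.
Qed.

Lemma qform_gram (J : finType) (c : J -> 'cV[R]_m) x :
  (qform (\sum_j c j *m (c j)^T) x = \sum_j (((c j)^T *m x) 0 0) ^+ 2)%R.
Proof.
rewrite /qform mulmx_sumr mulmx_suml summxE; apply: eq_bigr => j _.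
have -> : (x^T *m (c j *m (c j)^T) *m x = ((c j)^T *m x)^T *m ((c j)^T *m x))%R.
  by rewrite trmx_mul trmxK !mulmxA.
by rewrite mxE big_ord1 mxE expr2.
Qed.

Lemma mxtrace_gramE (J : finType) (c : J -> 'cV[R]_m) :
  (\tr (\sum_j c j *m (c j)^T) = \sum_j \sum_r c j r 0 ^+ 2)%R.
Proof.
rewrite raddf_sum/=; apply: eq_bigr => j _; apply: eq_bigr => r _.
by rewrite mxE big_ord1 mxE expr2.
Qed.

Lemma mean_qform i K : gram K -> \int[mu]_v (qform K (colv i v))%:E = (\tr K)%:E.
Proof.
move=> [J [c ->]]; rewrite mxtrace_gramE.
under eq_integral do rewrite qform_gram -sumEFin.
rewrite ge0_integral_sum//; last 2 first.
- by move=> j; apply/measurable_EFinP; apply: measurable_funX; exact: mip.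
- by move=> j v _; rewrite lee_fin sqr_ge0.
by rewrite -sumEFin; apply: eq_bigr => j _; rewrite inner_sq.
Qed.

(** For a Gram matrix the square is a double sum of products of squares of linear
forms; each product is bounded by fourth powers with weights that balance the norms of
the two forms. *)
Lemma second_moment_qform i K : gram K ->
  \int[mu]_v (qform K (colv i v) ^+ 2)%:E <= (96 * (\tr K) ^+ 2)%R%:E.
Proof.
move=> [J [c ->]]; rewrite mxtrace_gramE.
pose s j := (\sum_r c j r 0 ^+ 2)%R.
have s0 j : (0 <= s j)%R by apply: sumr_ge0 => r _; exact: sqr_ge0.
pose F (jk : J * J) v : R := (ip i (c jk.1) v ^+ 2 * ip i (c jk.2) v ^+ 2)%R.
have F0 jk v : (0 <= F jk v)%R by rewrite mulr_ge0 ?sqr_ge0.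
have mF jk : measurable_fun [set: omega] (fun v => (F jk v)%:E).
  by apply/measurable_EFinP; apply: measurable_funM; apply: measurable_funX; exact: mip.
have sumE (f : J -> R) : ((\sum_j f j) ^+ 2 = \sum_(jk : J * J) f jk.1 * f jk.2)%R.
  rewrite expr2 mulr_suml -(pair_bigA _ (fun j k => f j * f k)%R)/=.
  by apply: eq_bigr => j _; rewrite mulr_sumr.
under eq_integral do rewrite qform_gram sumE -sumEFin.
rewrite (eq_integral (fun v => \sum_(jk : J * J) (F jk v)%:E)%E)//.
rewrite ge0_integral_sum//; last by move=> jk v _; rewrite lee_fin.
rewrite (sumE s) mulr_sumr -sumEFin; apply: lee_sum => -[j k] _ /=.
have zero j0 : s j0 = 0%R -> forall v, ip i (c j0) v = 0%R.
  move=> sj v; rewrite /ip (_ : c j0 = 0%R); first by rewrite trmx0 mul0mx mxE.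
  apply/colP => r; rewrite mxE; apply/eqP; rewrite -sqrf_eq0.
  move/eqP: sj; rewrite psumr_eq0; last by move=> r' _; exact: sqr_ge0.
  by move/allP => /(_ r (mem_index_enum r)).
have [sj0|sj0] := eqVneq (s j) 0%R.
  rewrite integral0_eq; last by move=> v _; rewrite /F/= (zero j)// expr0n mul0r.
  by rewrite lee_fin sj0 mul0r mulr0.
have [sk0|sk0] := eqVneq (s k) 0%R.
  rewrite integral0_eq; last by move=> v _; rewrite /F/= (zero k)// expr0n/= mulr0.
  by rewrite lee_fin sk0 !mulr0.
have sj : (0 < s j)%R by rewrite lt0r sj0 s0.
have sk : (0 < s k)%R by rewrite lt0r sk0 s0.
pose a := (s k / s j / 2)%R; pose a' := (s j / s k / 2)%R.
have a0 : (0 < a)%R by rewrite !divr_gt0.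
have a'0 : (0 < a')%R by rewrite !divr_gt0.
have m4 c' : measurable_fun [set: omega] (fun v => (ip i c' v ^+ 4)%:E).
  by apply/measurable_EFinP; apply: measurable_funX; exact: mip.
have p4 c' v : 0 <= (ip i c' v ^+ 4)%:E by rewrite lee_fin exprn_even_ge0.
apply: (@le_trans _ _ (\int[mu]_v (a%:E * (ip i (c j) v ^+ 4)%:E + a'%:E * (ip i (c k) v ^+ 4)%:E))).
  apply: ge0_le_integral => //.
  - by move=> v _; rewrite lee_fin.
  - by apply: emeasurable_funD; exact: measurable_funeM.
  move=> v _; rewrite -!EFinM -EFinD lee_fin /F/= /a /a'.
  move: (ip i (c j) v) (ip i (c k) v) => x y.
  rewrite -subr_ge0.
  have -> : (s k / s j / 2 * x ^+ 4 + s j / s k / 2 * y ^+ 4 - x ^+ 2 * y ^+ 2 =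
      (s k * x ^+ 2 - s j * y ^+ 2) ^+ 2 / (2 * s j * s k))%R.
    by field; rewrite sj0 sk0.
  by rewrite divr_ge0 ?sqr_ge0// !mulr_ge0.
rewrite ge0_integralD//; last 4 first.
- by move=> v _; rewrite mule_ge0// lee_fin ltW.
- exact: measurable_funeM.
- by move=> v _; rewrite mule_ge0// lee_fin ltW.
- exact: measurable_funeM.
rewrite !ge0_integralZl//; try by rewrite lee_fin ltW.
apply: (@le_trans _ _ (a%:E * (96 * s j ^+ 2)%:E + a'%:E * (96 * s k ^+ 2)%:E)).
  by apply: leeD; (apply: lee_wpmul2l; [rewrite lee_fin ltW|exact: inner_fourth]).
rewrite -!EFinM -EFinD lee_fin /a /a' le_eqVlt; apply/orP; left; apply/eqP.
by field; rewrite sj0 sk0.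
Qed.

Definition cross (K : 'M[R]_m) (x y : 'cV[R]_m) : R := (x^T *m K *m y)%R 0%R 0%R.

(** Given one of the two independent columns, the other one enters through a linear form. *)
Lemma second_moment_cross i j K : K^T%R = K -> i != j ->
  \int[mu]_v (cross K (colv i v) (colv j v) ^+ 2)%:E = (\sum_r \sum_s K r s ^+ 2)%R%:E.
Proof.
move=> KT ij.
have mcross : measurable_fun [set: omega] (fun v => (cross K (colv i v) (colv j v) ^+ 2)%:E).
  apply/measurable_EFinP; apply: measurable_funX.
  apply: (measurableT_comp (measurable_entry 0%R 0%R)).
  apply: measurable_mulmx; last exact: measurable_colv.
  by apply: measurable_mulmx => //; apply: measurable_trmx; exact: measurable_colv.
pose E : pred I := mem (codom (fun r => ax (j, r))).
have cj v' v : colv j (merge E v' v) = colv j v'.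
  apply/colP => r; rewrite !colvE ffunE; case: ifP => // /negP[].
  exact: (codom_f (fun r => ax (j, r))).
have ci v' v : colv i (merge E v' v) = colv i v.
  apply/colP => r; rewrite !colvE ffunE; case: ifP => // /codomP[s /ax_inj [h]].
  by rewrite h eqxx in ij.
rewrite (resample nu_mu E)//; last by move=> v; rewrite lee_fin sqr_ge0.
transitivity (\int[mu]_v (\sum_r (row r K *m colv i v) 0 0 ^+ 2)%R%:E).
  apply: eq_integral => v _.
  rewrite (eq_integral (fun v' => ((((K *m colv i v)^T *m colv j v')%R 0%R 0%R) ^+ 2)%:E)); last first.
    by move=> v' _; rewrite cj ci /cross trmx_mul KT.
  rewrite inner_sq; congr EFin; apply: eq_bigr => r _.
  by rewrite -row_mul [in RHS]mxE.
under eq_integral do rewrite -sumEFin.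
rewrite ge0_integral_sum//; last 2 first.
- move=> r; apply/measurable_EFinP; apply: measurable_funX.
  apply: (measurableT_comp (measurable_entry 0%R 0%R)).
  by apply: measurable_mulmx => //; exact: measurable_colv.
- by move=> r v _; rewrite lee_fin sqr_ge0.
rewrite -sumEFin; apply: eq_bigr => r _.
rewrite -[row r K]trmxK inner_sq; congr EFin.
by apply: eq_bigr => s _; rewrite !mxE.
Qed.

(** The off-diagonal terms have the common mean tr (K^2), so that together they
contribute tr (K^2) (sum_(i <> j) d_i d_j) = - tr (K^2) |d|^2 <= 0, and only the diagonal
remains. *)
Lemma mean_cross_form K (d : 'I_n -> R) : K^T%R = K -> gram K -> (\sum_i d i = 0)%R ->
  \int[mu]_v (\sum_i \sum_j d i * d j * cross K (colv i v) (colv j v) ^+ 2)%R%:E <=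
  (96 * (\sum_i d i ^+ 2) * (\tr K) ^+ 2)%R%:E.
Proof.
move=> KT gK d0.
pose Q := (\sum_r \sum_s K r s ^+ 2)%R.
have Q0 : (0 <= Q)%R by apply: sumr_ge0 => r _; apply: sumr_ge0 => s _; exact: sqr_ge0.
have mc i j : measurable_fun [set: omega] (fun v => (cross K (colv i v) (colv j v) ^+ 2)%:E).
  apply/measurable_EFinP; apply: measurable_funX.
  apply: (measurableT_comp (measurable_entry 0%R 0%R)).
  apply: measurable_mulmx; last exact: measurable_colv.
  by apply: measurable_mulmx => //; apply: measurable_trmx; exact: measurable_colv.
pose e i := fine (\int[mu]_v (qform K (colv i v) ^+ 2)%:E).
have eE i : \int[mu]_v (qform K (colv i v) ^+ 2)%:E = (e i)%:E.
  rewrite fineK// ge0_fin_numE.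
    by apply: (le_lt_trans (second_moment_qform i gK)); rewrite ltry.
  by apply: integral_ge0 => v _; rewrite lee_fin sqr_ge0.
have e96 i : (e i <= 96 * (\tr K) ^+ 2)%R.
  by rewrite -lee_fin -eE; exact: second_moment_qform.
pose g i j := if i == j then e i else Q.
have gE i j : \int[mu]_v (cross K (colv i v) (colv j v) ^+ 2)%:E = (g i j)%:E.
  rewrite /g; case: eqP => [<-|/eqP ij]; first exact: eE.
  exact: second_moment_cross.
have H i j : mu.-integrable setT (EFin \o (fun v => d i * d j * cross K (colv i v) (colv j v) ^+ 2)%R) /\
    \int[mu]_v (d i * d j * cross K (colv i v) (colv j v) ^+ 2)%R%:E = (d i * d j * g i j)%R%:E.
  have ii : mu.-integrable setT (fun v => (cross K (colv i v) (colv j v) ^+ 2)%:E).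
    apply/integrableP; split; first exact: mc.
    under eq_integral do rewrite gee0_abs ?lee_fin ?sqr_ge0//.
    by rewrite gE ltry.
  split; first exact: (integrableZl measurableT (d i * d j)%R ii).
  under eq_integral do rewrite EFinM.
  by rewrite integralZl// gE -EFinM.
have [_ ->] := integral_rsum (index_enum 'I_n) (fun i => integral_rsum (index_enum 'I_n) (H i)).
rewrite lee_fin.
have -> : (\sum_i \sum_j d i * d j * g i j = \sum_i d i ^+ 2 * (e i - Q) + (\sum_i d i) ^+ 2 * Q)%R.
  set S := (\sum_i d i)%R; rewrite [(S ^+ 2)%R]expr2 -mulrA {1}/S mulr_suml -big_split/=.
  apply: eq_bigr => i _.
  rewrite (bigD1 i)//= /g eqxx (eq_bigr (fun j => d i * Q * d j)%R); last first.
    by move=> j /negbTE; rewrite eq_sym => ->; ring.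
  have -> : S = (d i + \sum_(j < n | j != i) d j)%R by rewrite /S (bigD1 i).
  by rewrite -mulr_sumr; ring.
rewrite d0 expr0n/= mul0r addr0 mulrAC mulr_sumr; apply: ler_sum => i _.
have := e96 i; have := sqr_ge0 (d i); move: (d i ^+ 2)%R => x x0 h.
nra.
Qed.

End column_moments.

(** * Inverses of Gram matrices *)

Section gram_inverse.
Context {R : realType} {m : nat}.
Implicit Types (N K M : 'M[R]_m).

Lemma gram_add N M : gram N -> gram M -> gram (N + M).
Proof.
move=> [J [c ->]] [J' [c' ->]].
exists (J + J')%type, (fun k => match k with inl j => c j | inr j => c' j end).
by rewrite big_sumType.
Qed.

Lemma gram_scalar (rho : R) : 0 <= rho -> gram (rho%:M : 'M[R]_m).
Proof.
move=> r0; exists 'I_m, (fun i => Num.sqrt rho *: delta_mx i 0).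
rewrite -scalemx1 mx1_sum_delta scaler_sumr; apply: eq_bigr => i _.
rewrite linearZ/= trmx_delta -scalemxAl -scalemxAr scalerA -expr2 sqr_sqrtr//.
by rewrite mul_delta_mx.
Qed.

Lemma gram_psd N : gram N -> psd N.
Proof. by move=> [J [c ->]]; apply: psd_sum => j _; exact: psd_rank1. Qed.

Lemma gram_sym N : gram N -> N^T = N.
Proof.
move=> [J [c ->]]; rewrite raddf_sum/=; apply: eq_bigr => j _.
by rewrite trmx_mul trmxK.
Qed.

Lemma gram_trace_ge0 N : gram N -> 0 <= \tr N.
Proof.
move=> [J [c ->]]; rewrite mxtrace_gramE; apply: sumr_ge0 => j _.
by apply: sumr_ge0 => r _; exact: sqr_ge0.
Qed.

Lemma sqr_norm_gt0 (x : 'cV[R]_m) : x != 0 -> 0 < \sum_r x r 0 ^+ 2.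
Proof.
move=> x0; rewrite lt_neqAle sumr_ge0 ?andbT; last by move=> r _; exact: sqr_ge0.
apply: contra x0; rewrite eq_sym psumr_eq0; last by move=> r _; exact: sqr_ge0.
move=> /allP H; apply/eqP/colP => r; rewrite mxE; apply/eqP.
by rewrite -sqrf_eq0; exact: H (mem_index_enum r).
Qed.

Lemma definite_unitmx M : (forall x : 'cV[R]_m, M *m x = 0 -> x = 0) -> M \in unitmx.
Proof.
move=> H; rewrite -unitmx_tr -row_free_unit -kermx_eq0; apply/eqP/row_matrixP => i.
rewrite row0; apply: trmx_inj; rewrite trmx0; apply: H.
apply: trmx_inj; rewrite trmx_mul trmxK trmx0.
by apply/sub_kermxP; exact: row_sub.
Qed.

Lemma qform_scalar (rho : R) x : qform (rho%:M : 'M[R]_m) x = rho * \sum_r x r 0 ^+ 2.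
Proof.
rewrite /qform mul_mx_scalar -scalemxAl mxE; congr (_ * _).
by rewrite mxE; apply: eq_bigr => r _; rewrite mxE expr2.
Qed.

Lemma qformD N M x : qform (N + M) x = qform N x + qform M x.
Proof. by rewrite /qform mulmxDr mulmxDl mxE. Qed.

Lemma gram_shift_unit N rho : gram N -> 0 < rho -> N + rho%:M \in unitmx.
Proof.
move=> gN r0; apply: definite_unitmx => x Nx0; apply/eqP; apply/negPn/negP => x0.
have : qform (N + rho%:M) x = 0.
  by rewrite /qform -mulmxA Nx0 mulmx0 mxE.
rewrite qformD qform_scalar; have := gram_psd gN x.
have := mulr_gt0 r0 (sqr_norm_gt0 x0); lra.
Qed.

Lemma cauchy_schwarz_sum (a x : 'cV[R]_m) :
  ((a^T *m x) 0 0) ^+ 2 <= (\sum_r a r 0 ^+ 2) * (\sum_r x r 0 ^+ 2).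
Proof.
have -> : (a^T *m x) 0 0 = \sum_r a r 0 * x r 0.
  by rewrite mxE; apply: eq_bigr => r _; rewrite mxE.
have : 0 <= \sum_r \sum_s (a r 0 * x s 0 - a s 0 * x r 0) ^+ 2.
  by apply: sumr_ge0 => r _; apply: sumr_ge0 => s _; exact: sqr_ge0.
have -> : \sum_r \sum_s (a r 0 * x s 0 - a s 0 * x r 0) ^+ 2 =
  (\sum_r a r 0 ^+ 2) * (\sum_r x r 0 ^+ 2) + (\sum_r x r 0 ^+ 2) * (\sum_r a r 0 ^+ 2)
  - 2 * ((\sum_r a r 0 * x r 0) * (\sum_r a r 0 * x r 0)).
  rewrite !mulr_suml mulr_sumr -big_split/= -sumrB; apply: eq_bigr => r _.
  rewrite !mulr_sumr -big_split/= -sumrB; apply: eq_bigr => s _; ring.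
rewrite expr2; lra.
Qed.

Lemma qform_le_trace K x : gram K -> qform K x <= \tr K * \sum_r x r 0 ^+ 2.
Proof.
move=> [J [c ->]]; rewrite qform_gram mxtrace_gramE mulr_suml.
by apply: ler_sum => j _; exact: cauchy_schwarz_sum.
Qed.

Lemma gram_invmx M : gram M -> M \in unitmx -> gram (invmx M).
Proof.
move=> gM uM; apply: (gram_inv _ (mulVmx uM)) => //.
by rewrite trmx_inv (gram_sym gM).
Qed.

(** tr (K M) is a sum of values of the quadratic form of K, each at most
tr K times the squared norm of the argument. *)
Lemma mxtrace_mul_le K M : gram K -> gram M -> 0 <= \tr (K *m M) <= \tr K * \tr M.
Proof.
move=> gK [J [c ->]].
have -> : \tr (K *m (\sum_j c j *m (c j)^T)) = \sum_j qform K (c j).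
  rewrite -[LHS]/(\tr _) -{1}[K]mulmx1 -[X in \tr X]mulmx1.
  rewrite mxtrace_gram ?trmx1//; by apply: eq_bigr => j _; rewrite mul1mx.
rewrite mxtrace_gramE mulr_sumr; apply/andP; split.
  by apply: sumr_ge0 => j _; exact: gram_psd.
by apply: ler_sum => j _; exact: qform_le_trace.
Qed.

Lemma resolvent M (d : R) : M \in unitmx -> M + d%:M \in unitmx ->
  invmx M - invmx (M + d%:M) = d *: (invmx M *m invmx (M + d%:M)).
Proof.
move=> uM uMd.
have -> : invmx M - invmx (M + d%:M) = invmx M *m (d%:M) *m invmx (M + d%:M).
  rewrite -[X in _ *m X *m _](addKr M) [- M + _]addrC mulmxBr mulVmx// mulmxBl mul1mx.
  by rewrite -mulmxA mulmxV// mulmx1.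
by rewrite mul_mx_scalar -scalemxAl.
Qed.

(** By the resolvent identity the difference is a multiple of the trace of
a product of two Gram matrices. *)
Lemma trace_resolvent_le N rho rho' : gram N -> 0 < rho -> rho <= rho' ->
  \tr (invmx (N + rho'%:M)) <= \tr (invmx (N + rho%:M)).
Proof.
move=> gN r0 rr'.
have u1 := gram_shift_unit gN r0.
have u2 := gram_shift_unit gN (lt_le_trans r0 rr').
have E : N + rho'%:M = N + rho%:M + (rho' - rho)%:M.
  by rewrite -addrA -raddfD/= subrKC.
rewrite -subr_ge0 -raddfB/= E resolvent//; last by rewrite -E.
rewrite mxtraceZ mulr_ge0 ?subr_ge0// -E.
have gS r : 0 < r -> gram (invmx (N + r%:M)).
  move=> rp; apply: gram_invmx (gram_shift_unit gN rp).
  by apply: gram_add => //; apply: gram_scalar; exact: ltW.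
by have /andP[] := mxtrace_mul_le (gS _ r0) (gS _ (lt_le_trans r0 rr')).
Qed.

(** If N x = 0 for some x <> 0, the quadratic form of the regularised inverse at x is
(j + 1) |x|^2, which exceeds any bound on the trace. Once N is known to be invertible, the traces
converge by the resolvent identity. *)
Lemma ridge_limit N tau : gram N ->
  (forall j : nat, \tr (invmx (N + (j.+1%:R^-1)%:M)) <= tau) ->
  N \in unitmx /\ \tr (invmx N) <= tau.
Proof.
move=> gN H; pose lam j : R := j.+1%:R^-1.
have lam0 j : 0 < lam j by rewrite invr_gt0.
have gM j : gram (N + (lam j)%:M).
  by apply: gram_add => //; apply: gram_scalar; exact: ltW.
have uM j := gram_shift_unit gN (lam0 j).
have gK j := gram_invmx (gM j) (uM j).
have uN : N \in unitmx.
  apply: definite_unitmx => x Nx0; apply/eqP; apply/negPn/negP => x0.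
  have xx := sqr_norm_gt0 x0.
  pose j := `|Num.ceil tau|%N.
  have tj : tau <= j%:R.
    apply: (le_trans (Num.Theory.ceil_ge tau)).
    by rewrite /j natr_absz ler_int ler_norm.
  have Kx : invmx (N + (lam j)%:M) *m x = j.+1%:R *: x.
    have : (N + (lam j)%:M) *m x = lam j *: x by rewrite mulmxDl Nx0 add0r mul_scalar_mx.
    move/(congr1 (mulmx (invmx (N + (lam j)%:M)))); rewrite mulKmx// -scalemxAr => h.
    by rewrite [in RHS]h scalerA divff ?pnatr_eq0// scale1r.
  have := qform_le_trace x (gK j).
  have -> : qform (invmx (N + (lam j)%:M)) x = j.+1%:R * \sum_r x r 0 ^+ 2.
    by rewrite -(qform_scalar (j.+1%:R) x) /qform -!mulmxA Kx mul_scalar_mx.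
  rewrite ler_pM2r// => h; have := le_trans h (le_trans (H j) tj).
  by rewrite ler_nat ltnn.
split => //.
have gKN := gram_invmx gN uN.
have tau0 : 0 <= tau by exact: le_trans (gram_trace_ge0 (gK 0%N)) (H 0%N).
set T := \tr (invmx N); have T0 : 0 <= T by exact: gram_trace_ge0.
have step j : T <= tau + lam j * (T * tau).
  have := congr1 mxtrace (resolvent uN (uM j)).
  rewrite raddfB/= mxtraceZ => h.
  have /andP[_ le2] := mxtrace_mul_le gKN (gK j).
  have : lam j * \tr (invmx N *m invmx (N + (lam j)%:M)) <= lam j * (T * tau).
    rewrite ler_wpM2l ?(ltW (lam0 j))//; apply: (le_trans le2).
    by apply: ler_wpM2l => //; exact: H.
  have := H j; rewrite -/(lam j) -/T in h *; lra.
apply/ler_addgt0Pr => e e0.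
pose j := `|Num.ceil (T * tau / e)|%N.
have tj : T * tau / e <= j%:R.
  apply: (le_trans (Num.Theory.ceil_ge _)).
  by rewrite /j natr_absz ler_int ler_norm.
apply: (le_trans (step j)); rewrite lerD2l /lam ler_pdivrMl//.
move: tj; rewrite ler_pdivrMr// => tj; apply: (le_trans tj).
by rewrite ler_wpM2r ?ler_nat// ltW.
Qed.

End gram_inverse.

(** * The trace of the inverse of a random Gram matrix *)

Section measurable_inverse.
Context {R : realType}.

Lemma measurable_inv : measurable_fun [set: R] (fun x : R => x^-1).
Proof.
rewrite (_ : (fun x => _) = (fun x : R => x * expR (- ln (x ^+ 2)))).
  apply: measurable_funM => //; apply: measurableT_comp => //.
  apply: measurableT_comp => //; apply: (measurableT_comp (@measurable_ln R)).
  exact: exprn_measurable.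
apply/funext => x; have [->|x0] := eqVneq x 0; first by rewrite invr0 mul0r.
rewrite expRN lnK ?posrE ?exprn_even_gt0// invfM mulrA divff// mul1r.
by [].
Qed.

Lemma measurable_det d (T : measurableType d) k (F : T -> 'M[R]_k) :
  measurable_fun setT F -> measurable_fun setT (fun t => \det (F t)).
Proof.
move=> mF; apply: measurable_sum => s; apply: measurable_funM => //.
apply: measurable_prod => i _.
exact: (measurableT_comp (measurable_entry _ _) mF).
Qed.

(** A formula that is measurable in the entries everywhere, unlike the inverse
that is defined by cases. *)
Definition minv k (A : 'M[R]_k) : 'M[R]_k := (\det A)^-1 *: \adj A.

Lemma minvE k (A : 'M[R]_k) : A \in unitmx -> minv A = invmx A.
Proof. by rewrite /minv /invmx => ->. Qed.

Lemma measurable_minv d (T : measurableType d) k (F : T -> 'M[R]_k) :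
  measurable_fun setT F -> measurable_fun setT (fun t => minv (F t)).
Proof.
move=> mF; apply: measurable_fun_matrix => i j.
rewrite (_ : (fun t => _) = (fun t => (\det (F t))^-1 *
    ((-1) ^+ (j + i) * \det (row' j (col' i (F t)))))); last first.
  by apply/funext => t; rewrite !mxE.
apply: measurable_funM.
  exact: (measurableT_comp measurable_inv (measurable_det mF)).
apply: measurable_funM => //; apply: measurable_det.
apply: measurable_fun_matrix => r s.
rewrite (_ : (fun t => _) = (fun t => F t (lift j r) (lift i s))); last first.
  by apply/funext => t; rewrite !mxE.
exact: (measurableT_comp (measurable_entry _ _) mF).
Qed.

End measurable_inverse.

Section random_inverse.
Context {R : realType} {I : finType} {m n : nat}.
Local Notation omega := {ffun I -> R}.
Variables (nu : I -> probability R R) (mu : probability omega R).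
Hypothesis nu_mu : product_law (fun i => nu i) mu.
Variable ax : 'I_n * 'I_m -> I.
Hypothesis ax_inj : injective ax.
Hypothesis ax_std : forall k, standard nu (ax k).
Variable cc : R.
Local Open Scope ereal_scope.
Local Notation colv := (colv ax).

(** By the rank-one update, the value at u of the quadratic form of (M + u u^T)^-1 is
the image by this map of its value for M^-1. *)
Definition frac (q : R) : R := (q / (1 + q))%R.

(** Write q for the quadratic form of K at a random column, multiplied by cc^2; its
mean is T = cc^2 tr K and its second moment at most 96 T^2. The function q / (1 + q) is
bounded below by the tangent parabola al q - be q^2 at q0; with q0 = 48 T the mean
of the parabola is at least T / (1 + 48 T)^2. The factor th rescales T to at most 1. *)
Lemma frac_lower_bound (i : 'I_n) (K : 'M[R]_m) : gram K ->
  (Num.min (cc ^+ 2 * \tr K) 1 / 49 ^+ 2)%:E <=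
  \int[mu]_v (frac (cc ^+ 2 * qform K (colv i v)))%:E.
Proof.
move=> gK; set T := (cc ^+ 2 * \tr K)%R.
have T0 : (0 <= T)%R by rewrite mulr_ge0 ?sqr_ge0// gram_trace_ge0.
pose th := ((Num.max T 1)^-1)%R.
have M1 : (1 <= Num.max T 1)%R by rewrite le_max lexx orbT.
have Mp : (0 < Num.max T 1)%R by exact: lt_le_trans M1.
have th0 : (0 < th)%R by rewrite invr_gt0.
have th1 : (th <= 1)%R by rewrite invf_le1.
have TE : (Num.min T 1 = th * T)%R.
  rewrite /th; case: (leP T 1%R) => h; first by rewrite invr1 mul1r.
  by rewrite mulVf// gt_eqF// (lt_trans ltr01 h).
set T' := Num.min T 1%R.
have T'0 : (0 <= T')%R by rewrite le_min T0 ler01.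
have T'1 : (T' <= 1)%R by rewrite ge_min lexx orbT.
(* Half of the factor 96 of the second moment, so that the linear and the quadratic
   terms leave exactly T' / (1 + q0)^2. *)
pose q0 := (48 * T')%R.
have q00 : (0 <= q0)%R by rewrite mulr_ge0.
pose al := ((1 + 2 * q0) / (1 + q0) ^+ 2)%R.
pose be := ((1 + q0) ^- 2)%R.
have d0 : (0 < (1 + q0) ^+ 2)%R by rewrite exprn_gt0// ltr_wpDr.
have be0 : (0 <= be)%R by rewrite invr_ge0 ltW.
have al0 : (0 <= al)%R by nneg.
pose Q v := qform K (colv i v).
have Q0 v : (0 <= Q v)%R by exact: gram_psd.
have mQ : measurable_fun [set: omega] Q.
  by apply: measurable_qform; [exact: measurable_cst|exact: measurable_colv].
have mfr : measurable_fun [set: omega] (fun v => (frac (cc ^+ 2 * Q v))%:E).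
  apply/measurable_EFinP; apply: measurable_funM; first exact: measurable_funM.
  apply: (measurableT_comp measurable_inv); apply: measurable_funD => //.
  exact: measurable_funM.
have cq0 v : (0 <= cc ^+ 2 * Q v)%R by apply: mulr_ge0 => //; exact: sqr_ge0.
have fr0 v : 0 <= (frac (cc ^+ 2 * Q v))%:E.
  by rewrite lee_fin; apply: divr_ge0 => //; apply: addr_ge0.
have point v : (al * (th * cc ^+ 2) * Q v <=
    frac (cc ^+ 2 * Q v) + be * (th * cc ^+ 2) ^+ 2 * Q v ^+ 2)%R.
  have q0' := cq0 v.
  have -> : (be * (th * cc ^+ 2) ^+ 2 * Q v ^+ 2 = be * (th * (cc ^+ 2 * Q v)) ^+ 2)%R by ring.
  have -> : (al * (th * cc ^+ 2) * Q v = al * (th * (cc ^+ 2 * Q v)))%R by ring.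
  move: (cc ^+ 2 * Q v)%R q0' => q q0'.
  have p0 : (0 <= th * q)%R by rewrite mulr_ge0// ltW.
  have pq : (th * q <= q)%R by rewrite ler_piMl.
  move: (th * q)%R p0 pq => p p0 pq.
  apply: (@le_trans _ _ (frac p + be * p ^+ 2)%R); last first.
    rewrite lerD2r /frac ler_pdivrMr ?ltr_wpDr// mulrAC ler_pdivlMr ?ltr_wpDr//.
    nra.
  rewrite -subr_ge0.
  have -> : (frac p + be * p ^+ 2 - al * p = p * (q0 - p) ^+ 2 / ((1 + p) * (1 + q0) ^+ 2))%R.
    rewrite /frac /be /al; field.
    by rewrite !gt_eqF// ltr_wpDr.
  by nneg.
have intQ : \int[mu]_v (Q v)%:E = (\tr K)%:E by exact: (mean_qform nu_mu ax_inj ax_std).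
have intQ2 : \int[mu]_v (Q v ^+ 2)%:E <= (96 * \tr K ^+ 2)%:E.
  exact: (second_moment_qform nu_mu ax_inj ax_std).
have mQE : measurable_fun [set: omega] (fun v => (Q v)%:E) by exact/measurable_EFinP.
have mQ2 : measurable_fun [set: omega] (fun v => (Q v ^+ 2)%:E).
  by apply/measurable_EFinP; exact: measurable_funX.
have a0 : (0 <= al * (th * cc ^+ 2))%R by nneg.
have b0 : (0 <= be * (th * cc ^+ 2) ^+ 2)%R by nneg.
have Q20 v : 0 <= (Q v ^+ 2)%:E by rewrite lee_fin sqr_ge0.
have main : (al * T')%:E <= \int[mu]_v (frac (cc ^+ 2 * Q v))%:E + (be * (96 * T' ^+ 2))%:E.
  apply: (@le_trans _ _ (\int[mu]_v ((frac (cc ^+ 2 * Q v))%:E +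
      (be * (th * cc ^+ 2) ^+ 2)%:E * (Q v ^+ 2)%:E))).
    have -> : (al * T')%:E = \int[mu]_v ((al * (th * cc ^+ 2))%:E * (Q v)%:E).
      rewrite ge0_integralZl//; last by move=> v _; rewrite lee_fin.
      by rewrite intQ -EFinM; congr EFin; rewrite /T' TE /T; ring.
    apply: ge0_le_integral => //.
    - by move=> v _; rewrite -EFinM lee_fin mulr_ge0.
    - exact: measurable_funeM.
    - by apply: emeasurable_funD => //; exact: measurable_funeM.
    - by move=> v _; rewrite -!EFinM -EFinD lee_fin.
  rewrite ge0_integralD//; last 2 first.
  - by move=> v _; rewrite mule_ge0// lee_fin.
  - exact: measurable_funeM.
  rewrite ge0_integralZl//.
  rewrite leeD2l//; apply: (@le_trans _ _ ((be * (th * cc ^+ 2) ^+ 2)%:E * (96 * \tr K ^+ 2)%:E)).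
    by apply: lee_wpmul2l => //; rewrite lee_fin.
  rewrite -EFinM lee_fin /T' TE /T le_eqVlt; apply/orP; left; apply/eqP; ring.
have : \int[mu]_v (frac (cc ^+ 2 * Q v))%:E \is a fin_num.
  rewrite ge0_fin_numE; last by apply: integral_ge0 => v _.
  apply: (@le_lt_trans _ _ (\int[mu]_v 1%:E)); last by rewrite integral_cst_probability ltry.
  apply: ge0_le_integral => // v _; rewrite lee_fin /frac ler_pdivrMr ?mul1r.
    by rewrite lerDr.
  by apply: ltr_wpDr.
move: main; case: (\int[mu]_v _) => // r; rewrite -EFinD !lee_fin => main _.
have main2 : (T' * be <= r)%R.
  apply: (@le_trans _ _ (al * T' - be * (96 * T' ^+ 2))%R); last lra.
  by rewrite /al -/be /q0 le_eqVlt; apply/orP; left; apply/eqP; ring.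
have q48 : (1 + q0 <= 49)%R by rewrite /q0; lra.
have q01 : (0 < 1 + q0)%R by rewrite ltr_wpDr.
apply: le_trans main2; apply: ler_wpM2l; first exact: T'0.
rewrite /be lef_pV2 ?posrE ?exprn_gt0//.
by apply: lerXn2r; rewrite // nnegrE ltW.
Qed.

Lemma rank1_shift (M : 'M[R]_m) (u : 'cV[R]_m) : gram M -> M \in unitmx ->
  (M + u *m u^T)%R \in unitmx ->
  invmx (M + u *m u^T)%R = update_precision (invmx M) u.
Proof.
move=> gM uM uMu.
have q0 : (0 <= qform (invmx M) u)%R by apply: gram_psd; exact: gram_invmx.
have E : (update_precision (invmx M) u *m (M + u *m u^T) = 1%:M)%R.
  by apply: update_precision_inv (mulVmx uM); rewrite gt_eqF// ltr_wpDr.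
by rewrite -[LHS]mul1mx -E -mulmxA mulmxV// mulmx1.
Qed.

Lemma qform_rank1_shift (M : 'M[R]_m) (u : 'cV[R]_m) : gram M -> M \in unitmx ->
  (qform (update_precision (invmx M) u) u = frac (qform (invmx M) u))%R.
Proof.
move=> gM uM; set K := invmx M; set q := qform K u.
have q0 : (0 <= q)%R by apply: gram_psd; exact: gram_invmx.
have -> : (qform (update_precision K u) u = q - (1 + q)^-1 * (q * q))%R.
  rewrite /qform /update_precision mulmxBr mulmxBl mxE; congr (_ + _)%R.
  rewrite mxE -scalemxAr -scalemxAl mxE; congr (- (_ * _))%R.
  have -> : (u^T *m (K *m u *m (u^T *m K)) *m u = (u^T *m K *m u) *m (u^T *m K *m u))%R.
    by rewrite !mulmxA.
  by rewrite mxE big_ord1.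
by rewrite /frac; field; rewrite gt_eqF// ltr_wpDr.
Qed.

Lemma trace_rank1_shift (M : 'M[R]_m) (u : 'cV[R]_m) : gram M -> M \in unitmx ->
  (\tr (update_precision (invmx M) u) <= \tr (invmx M))%R.
Proof.
move=> gM uM; have gK := gram_invmx gM uM.
have q0 : (0 <= qform (invmx M) u)%R by exact: gram_psd.
rewrite /update_precision raddfB/= mxtraceZ gerBl mulr_ge0 ?invr_ge0 ?addr_ge0//.
have -> : (invmx M *m u *m (u^T *m invmx M) = (invmx M *m u) *m (invmx M *m u)^T)%R.
  by rewrite trmx_mul (gram_sym gK).
apply: gram_trace_ge0; exists unit, (fun=> (invmx M *m u)%R).
by rewrite (big_pred1 tt)//; case.
Qed.

Definition colgram (h : seq 'I_n) (v : omega) : 'M[R]_m :=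
  (\sum_(i <- h) (cc *: colv i v) *m (cc *: colv i v)^T)%R.

Lemma gram_colgram h v : uniq h -> gram (colgram h v).
Proof. exact: gram_sum. Qed.

Lemma measurable_colgram h : measurable_fun [set: omega] (colgram h).
Proof.
apply: measurable_sum_mx => i.
have mc : measurable_fun [set: omega] (fun v => cc *: colv i v)%R.
  apply: measurable_fun_matrix => r s.
  rewrite (_ : (fun v : omega => _) = (fun v : omega => cc * colv i v r s)%R).
    apply: measurable_funM => //.
    exact: (measurableT_comp (measurable_entry r s) (measurable_colv ax i)).
  by apply/funext => v; rewrite mxE.
by apply: measurable_mulmx => //; exact: measurable_trmx.
Qed.

Lemma colgram_merge h (E : pred I) v' v : (forall i r, i \in h -> ~~ E (ax (i, r))) ->
  colgram h (merge E v' v) = colgram h v.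
Proof.
move=> hE; apply: eq_big_seq => i ih.
have -> : colv i (merge E v' v) = colv i v; last by [].
by apply/colP => r; rewrite !colvE ffunE (negbTE (hE i r ih)).
Qed.

Section leave_one_out.
Variables (h : seq 'I_n) (rho : R).
Hypotheses (uh : uniq h) (rho0 : (0 < rho)%R).

Let M v : 'M[R]_m := (colgram h v + rho%:M)%R.
Let T v : R := (cc ^+ 2 * \tr (invmx (M v)))%R.

Let gM v s : uniq s -> gram (colgram s v + rho%:M)%R.
Proof.
move=> us; apply: gram_add; first exact: gram_colgram.
by apply: gram_scalar; exact: ltW.
Qed.

Let uM v s : uniq s -> (colgram s v + rho%:M)%R \in unitmx.
Proof. by move=> us; apply: gram_shift_unit => //; exact: gram_colgram. Qed.

Let measurable_shifted s : measurable_fun [set: omega] (fun v => colgram s v + rho%:M)%R.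
Proof. by apply: measurable_addmx; [exact: measurable_colgram|exact: measurable_cst]. Qed.

Let measurable_shifted_inv s : uniq s ->
  measurable_fun [set: omega] (fun v => invmx (colgram s v + rho%:M)%R).
Proof.
move=> us; rewrite (_ : (fun v => _) = (fun v => minv (colgram s v + rho%:M)%R)).
  by apply: measurable_minv; exact: measurable_shifted.
by apply/funext => v; rewrite minvE// uM.
Qed.

Let measurable_T : measurable_fun [set: omega] T.
Proof.
by apply: measurable_funM => //; apply: measurable_mxtrace; exact: measurable_shifted_inv.
Qed.

Let T0 v : (0 <= T v)%R.
Proof.
apply: mulr_ge0; first exact: sqr_ge0.
by apply: gram_trace_ge0; apply: gram_invmx; [exact: gM|exact: uM].
Qed.

(** The column i is independent of the other columns, and removing its
contribution can only increase the trace of the inverse; so [frac_lower_bound]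
applies to the column i and the inverse of the matrix without it. *)
Lemma leave_one_out i : i \in h ->
  \int[mu]_v (Num.min (T v) 1 / 49 ^+ 2)%:E <=
  \int[mu]_v (cc ^+ 2 * qform (invmx (M v)) (colv i v))%:E.
Proof.
move=> ih; pose h' := rem i h.
have uh' : uniq h' by exact: rem_uniq.
have iNh' : i \notin h' by rewrite mem_rem_uniqF.
pose K' v := invmx (colgram h' v + rho%:M)%R.
have gK' v : gram (K' v) by apply: gram_invmx; [exact: gM|exact: uM].
have ME v : M v = (colgram h' v + rho%:M + (cc *: colv i v) *m (cc *: colv i v)^T)%R.
  by rewrite /M /colgram (perm_big _ (perm_to_rem ih)) big_cons [RHS]addrAC; congr (_ + _)%R; rewrite addrC.
have KE v : invmx (M v) = update_precision (K' v) (cc *: colv i v)%R.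
  by rewrite ME; apply: rank1_shift; [exact: gM|exact: uM|rewrite -ME; exact: uM].
have qZ K x : (qform K (cc *: x) = cc ^+ 2 * qform K x :> R)%R.
  by rewrite /qform [(cc *: x)^T%R]linearZ/= -!scalemxAl -scalemxAr !scalerA [LHS]mxE expr2.
have qE v : (cc ^+ 2 * qform (invmx (M v)) (colv i v) =
    frac (cc ^+ 2 * qform (K' v) (colv i v)))%R.
  by rewrite -!qZ KE qform_rank1_shift//; [exact: gM|exact: uM].
under [leRHS]eq_integral do rewrite qE.
pose E : pred I := mem (codom (fun r => ax (i, r))).
have KE' v' v : K' (merge E v' v) = K' v.
  rewrite /K' colgram_merge// => j r jh; apply/negP => /codomP[s /ax_inj [ij _]].
  by rewrite -ij jh in iNh'.
have cE v' v : colv i (merge E v' v) = colv i v'.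
  apply/colP => r; rewrite !colvE ffunE; case: ifP => // /negP[].
  exact: (codom_f (fun r => ax (i, r))).
have fr0 v : 0 <= (frac (cc ^+ 2 * qform (K' v) (colv i v)))%:E.
  have q0 : (0 <= qform (K' v) (colv i v))%R by exact: gram_psd.
  by rewrite lee_fin /frac; nneg.
have mfr (F : omega * omega -> omega) (G : omega * omega -> omega) :
    measurable_fun setT F -> measurable_fun setT G ->
    measurable_fun setT (fun z => (frac (cc ^+ 2 * qform (K' (F z)) (colv i (G z))))%:E).
  move=> mF mG.
  have mq : measurable_fun setT (fun z => cc ^+ 2 * qform (K' (F z)) (colv i (G z)))%R.
    apply: measurable_funM => //; apply: measurable_qform.
      exact: (measurableT_comp (measurable_shifted_inv uh') mF).
    exact: (measurableT_comp (measurable_colv ax i) mG).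
  apply/measurable_EFinP; apply: measurable_funM => //.
  by apply: (measurableT_comp measurable_inv); exact: measurable_funD.
have mf1 : measurable_fun [set: omega] (fun v => (frac (cc ^+ 2 * qform (K' v) (colv i v)))%:E).
  apply/measurable_EFinP.
  have mq : measurable_fun [set: omega] (fun z => cc ^+ 2 * qform (K' z) (colv i z))%R.
    apply: measurable_funM => //; apply: measurable_qform.
      exact: (measurable_shifted_inv uh').
    exact: measurable_colv.
  apply: measurable_funM => //.
  by apply: (measurableT_comp measurable_inv); exact: measurable_funD.
rewrite [leRHS](resample nu_mu E)//.
apply: ge0_le_integral => //.
- move=> v _; rewrite lee_fin divr_ge0 ?exprn_ge0//.
  by rewrite le_min T0 ler01.
- apply/measurable_EFinP; apply: measurable_funM => //.
  exact: measurable_minr.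
- pose F z := (frac (cc ^+ 2 * qform (K' z.1) (colv i z.2)))%:E.
  rewrite (_ : (fun v => _) = (fun v => \int[mu]_v' F (v, v'))); last first.
    by apply/funext => v; apply: eq_integral => v' _; rewrite KE' cE.
  apply: measurable_fun_fubini_tonelli_F.
    by apply: (mfr fst snd); [exact: measurable_fst|exact: measurable_snd].
  move=> z; have q0 : (0 <= qform (K' z.1) (colv i z.2))%R by exact: gram_psd.
  by rewrite lee_fin /frac; nneg.
- move=> v _; under eq_integral do rewrite KE' cE.
  apply: le_trans (frac_lower_bound i (gK' v)).
  rewrite lee_fin ler_pM2r ?invr_gt0 ?exprn_gt0//.
  rewrite le_min !ge_min lexx orbT andbT; apply/orP; left.
  rewrite /T ler_wpM2l ?sqr_ge0// KE; apply: trace_rank1_shift; [exact: gM|exact: uM].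
Qed.

(** The quadratic forms of the inverse at all the columns add up to
tr (M^-1 (M - rho)) <= m, while the mean of each is at least a fixed multiple of that of the truncated
trace by [leave_one_out]. *)
Lemma mean_trace_inverse :
  (size h)%:R%:E * \int[mu]_v (Num.min (T v) 1 / 49 ^+ 2)%:E <= m%:R%:E.
Proof.
pose f i v : R := (cc ^+ 2 * qform (invmx (M v)) (colv i v))%R.
have gK v : gram (invmx (M v)) by apply: gram_invmx; [exact: gM|exact: uM].
have f0 i v : 0 <= (f i v)%:E.
  by rewrite lee_fin mulr_ge0 ?sqr_ge0//; exact: gram_psd.
have mf i : measurable_fun [set: omega] (fun v => (f i v)%:E).
  apply/measurable_EFinP; apply: measurable_funM => //; apply: measurable_qform.
    exact: measurable_shifted_inv.
  exact: measurable_colv.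
apply: (@le_trans _ _ (\sum_(i <- h) \int[mu]_v (f i v)%:E)).
  rewrite (_ : (size h)%:R%:E * _ = \sum_(i <- h) \int[mu]_v (Num.min (T v) 1 / 49 ^+ 2)%:E).
    by rewrite !big_seq; apply: lee_sum => i ih; exact: leave_one_out.
  elim: (h) => [|i s IH /=]; first by rewrite big_nil mul0e.
  by rewrite big_cons -IH -nat1r EFinD ge0_muleDl ?lee_fin// mul1e.
rewrite -ge0_integral_sum//.
rewrite -[leRHS](@integral_cst_probability _ _ _ mu).
apply: ge0_le_integral => //.
- by move=> v _; apply: sume_ge0.
- exact: emeasurable_sum.
- move=> v _; rewrite sumEFin lee_fin.
  have -> : (\sum_(i <- h) f i v = \tr (invmx (M v) *m colgram h v))%R.
    rewrite /colgram mulmx_sumr raddf_sum/=; apply: eq_bigr => i _.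
    rewrite /f mulmxA [RHS]mxtrace_mulC mulmxA /mxtrace big_ord1.
    rewrite [(cc *: _)^T%R]linearZ/= -!scalemxAl -scalemxAr !scalerA [RHS]mxE expr2.
    by [].
  have -> : colgram h v = (M v - rho%:M)%R by rewrite /M addrK.
  rewrite mulmxBr mulVmx; last exact: uM.
  rewrite mul_mx_scalar raddfB/= mxtrace1 mxtraceZ gerBl.
  by apply: mulr_ge0; [exact: ltW|exact: gram_trace_ge0].
Qed.

End leave_one_out.

End random_inverse.

Section inverse_event.
Context {R : realType} {I : finType} {m n : nat}.
Local Notation omega := {ffun I -> R}.
Variables (nu : I -> probability R R) (mu : probability omega R).
Hypothesis nu_mu : product_law (fun i => nu i) mu.
Variable ax : 'I_n * 'I_m -> I.
Hypothesis ax_inj : injective ax.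
Hypothesis ax_std : forall k, standard nu (ax k).
Variables (cc rho t : R) (h : seq 'I_n).
Hypotheses (cc0 : 0 < cc) (rho0 : 0 <= rho) (t0 : 0 < t) (t1 : t <= 1) (uh : uniq h).
Hypothesis th : 8 * 49 ^+ 2 * m%:R <= t * (size h)%:R.
Hypothesis h0 : (0 < size h)%N.

(** The size of the inverse alone says nothing where the matrix is singular, so
invertibility is part of the event. *)
Definition small_inverse (v : omega) : Prop :=
  colgram ax cc h v + rho%:M \in unitmx /\
  cc ^+ 2 * \tr (minv (colgram ax cc h v + rho%:M)) <= t.

Let S v := colgram ax cc h v + rho%:M.

Let measurable_S : measurable_fun [set: omega] S.
Proof. by apply: measurable_addmx; [exact: measurable_colgram|exact: measurable_cst]. Qed.

Lemma measurable_small_inverse : measurable [set v | small_inverse v].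
Proof.
have m1 : measurable [set v | \det (S v) != 0].
  rewrite (_ : [set v | _] = (fun v => \det (S v)) @^-1` (~` [set 0])).
    rewrite -[X in measurable X]setTI; apply: (measurable_det measurable_S) => //.
    by apply: measurableC; exact: measurable_set1.
  by apply/seteqP; split => v /= /eqP.
have m2 : measurable [set v | cc ^+ 2 * \tr (minv (S v)) <= t].
  rewrite (_ : [set v | _] = (fun v => cc ^+ 2 * \tr (minv (S v))) @^-1` `]-oo, t]).
    rewrite -[X in measurable X]setTI.
    have mf : measurable_fun [set: omega] (fun v => cc ^+ 2 * \tr (minv (S v))).
      by apply: measurable_funM => //; apply: measurable_mxtrace; exact: measurable_minv.
    exact: mf.
  by apply/seteqP; split => v /=; rewrite in_itv.
rewrite (_ : [set v | _] = [set v | \det (S v) != 0] `&` [set v | cc ^+ 2 * \tr (minv (S v)) <= t]).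
  exact: measurableI.
by apply/seteqP; split => v /=; rewrite /small_inverse unitmxE unitfE.
Qed.

(** Markov's inequality for [mean_trace_inverse] with a regularisation 1 / (j + 1)
added to rho, which vanishes in the limit by [ridge_limit]; the exceptional events increase with j. *)
Lemma small_inverse_prob : (mu (~` [set v | small_inverse v]) <= 8^-1%:E)%E.
Proof.
pose lam j : R := j.+1%:R^-1.
have lam0 j : 0 < lam j by rewrite invr_gt0.
have rl j : 0 < rho + lam j by rewrite ltr_wpDl.
pose T j v : R := cc ^+ 2 * \tr (invmx (colgram ax cc h v + (rho + lam j)%:M)).
have gS v : gram (S v).
  by apply: gram_add; [exact: gram_colgram|exact: gram_scalar].
have SE j v : colgram ax cc h v + (rho + lam j)%:M = S v + (lam j)%:M.
  by rewrite /S -addrA -raddfD.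
have gj j v : gram (colgram ax cc h v + (rho + lam j)%:M).
  by apply: gram_add; [exact: gram_colgram|apply: gram_scalar; exact: ltW].
have uj j v : colgram ax cc h v + (rho + lam j)%:M \in unitmx.
  by apply: gram_shift_unit => //; exact: gram_colgram.
have T0 j v : 0 <= T j v.
  by rewrite mulr_ge0 ?sqr_ge0//; apply: gram_trace_ge0; exact: gram_invmx.
have mT j : measurable_fun [set: omega] (T j).
  apply: measurable_funM => //; apply: measurable_mxtrace.
  rewrite (_ : (fun v => _) = (fun v => minv (colgram ax cc h v + (rho + lam j)%:M))).
    apply: measurable_minv; apply: measurable_addmx; last exact: measurable_cst.
    exact: measurable_colgram.
  by apply/funext => v; rewrite minvE.
pose B j := [set v | t < T j v].
have mB j : measurable (B j).
  rewrite (_ : B j = T j @^-1` `]t, +oo[).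
    by rewrite -[X in measurable X]setTI; exact: mT.
  by apply/seteqP; split => v /=; rewrite in_itv/= andbT.
have PB j : (mu (B j) <= 8^-1%:E)%E.
  have mean := mean_trace_inverse nu_mu ax_inj ax_std cc uh (rl j).
  have mind : measurable_fun [set: omega] (fun v => (\1_(B j) v : R)%:E).
    by apply/measurable_EFinP; exact: measurable_indic.
  have markov : ((t / 49 ^+ 2)%:E * mu (B j) <=
      \int[mu]_v (Num.min (T j v) 1 / 49 ^+ 2)%:E)%E.
    have -> : (mu (B j) = \int[mu]_v (\1_(B j) v : R)%:E)%E.
      by rewrite integral_indic// setIT.
    rewrite -ge0_integralZl//; last first.
      by rewrite lee_fin divr_ge0 ?exprn_ge0// ltW.
    apply: ge0_le_integral => //.
    - by move=> v _; rewrite -EFinM lee_fin mulr_ge0// divr_ge0 ?exprn_ge0// ltW.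
    - exact: measurable_funeM.
    - apply/measurable_EFinP; apply: measurable_funM => //.
      exact: measurable_minr.
    - move=> v _; rewrite -EFinM lee_fin indicE; case: (boolP (v \in B j)) => [|_].
        rewrite inE /B/= => tT; rewrite mulr1 ler_pM2r ?invr_gt0 ?exprn_gt0//.
        by rewrite le_min (ltW tT).
      by rewrite mulr0 divr_ge0 ?exprn_ge0// le_min T0 ler01.
  have := le_trans (lee_wpmul2l _ markov) mean; rewrite lee_fin => /(_ (ler0n _ _)).
  have : mu (B j) \is a fin_num by exact: fin_num_measure.
  case: (mu (B j)) => // p _; rewrite -!EFinM !lee_fin => H.
  have s0 : 0 < (size h)%:R :> R by rewrite ltr0n.
  have ts : 0 < t * (size h)%:R by rewrite mulr_gt0.
  have e49 : (0 : R) < 49 ^+ 2 by rewrite exprn_gt0.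
  have H2 : t * (size h)%:R * p <= 49 ^+ 2 * m%:R.
    rewrite -(ler_pM2r (x := (49 ^+ 2)^-1)) ?invr_gt0//.
    rewrite [X in _ <= X]mulrAC divff ?gt_eqF// mul1r.
    by apply: le_trans H; rewrite le_eqVlt; apply/orP; left; apply/eqP; ring.
  rewrite -(ler_pM2l ts); apply: (le_trans H2).
  have := th; move: (49 ^+ 2) e49 => N e49 th'; lra.
have nB : nondecreasing_seq B.
  move=> j j' jj'; apply/subsetPset => v /= tT; apply: (lt_le_trans tT).
  rewrite ler_wpM2l ?sqr_ge0//; apply: trace_resolvent_le => //.
    exact: gram_colgram.
  by rewrite lerD2l lef_pV2 ?posrE// ler_nat.
have mU : measurable (\bigcup_j B j) by exact: bigcupT_measurable.
apply: (@le_trans _ _ (mu (\bigcup_j B j))).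
  apply: le_measure; rewrite ?inE//.
    by apply: measurableC; exact: measurable_small_inverse.
  move=> v /= nG; apply/not_notP => nB'; apply: nG.
  have [uS trS] : S v \in unitmx /\ \tr (invmx (S v)) <= t / cc ^+ 2.
    apply: ridge_limit => // j; rewrite -/(lam j) -SE ler_pdivlMr ?exprn_gt0// mulrC.
    by rewrite leNgt; apply/negP => tT; apply: nB'; exists j.
  split => //; rewrite minvE//.
  by move: trS; rewrite ler_pdivlMr ?exprn_gt0// mulrC.
have cvgB := nondecreasing_cvg_mu (mu := mu) mB mU nB.
rewrite -(cvg_lim _ cvgB)//; apply: lime_le; first by apply/cvg_ex; eexists; exact: cvgB.
by apply: nearW => j; exact: PB.
Qed.

End inverse_event.

(** * Two-point tests with a frozen design *)

Section row_tests.
Context {R : realType} {I J : finType} {m L : nat}.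
Local Notation omega := {ffun I -> R}.
Variables (nu : I -> probability R R) (mu : probability omega R).
Hypothesis nu_mu : product_law (fun i => nu i) mu.
Variable ix : J * 'I_L -> I.
Hypothesis ix_inj : injective ix.
Local Open Scope ereal_scope.

Lemma rowsum_perm (b : J -> 'cV[R]_m) (s s' : seq J) : perm_eq s s' ->
  rowsum (L := L) ix b s = rowsum ix b s'.
Proof. by move=> ss'; apply/funext => v; exact: perm_big. Qed.

Lemma rowcov_sym (b : J -> 'cV[R]_m) s : ((rowcov b s)^T = rowcov b s)%R.
Proof.
rewrite /rowcov raddf_sum; apply: eq_bigr => j _.
by rewrite /= trmx_mul trmxK.
Qed.

(** The rows in s0 carry the same coefficients under both laws and form the common
background, of precision K0. Both precisions are at most K0, so the
divergence (L/2) tr ((K' - K) D) = (L/2) tr (K' D K D) is at most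
(L/2) tr (K0 D K0 D). *)
Lemma shared_rows_test (b b' : J -> 'cV[R]_m) (s s0 : seq J) (K0 : 'M[R]_m)
    (t : R) (B : set 'M[R]_(m, L)) :
  uniq (s ++ s0) -> {in s0, b =1 b'} ->
  (K0 *m rowcov b s0 = 1%:M)%R ->
  (forall j l, b j != 0%R -> standard nu (ix (j, l))) ->
  (forall j l, b' j != 0%R -> standard nu (ix (j, l))) ->
  (forall j l, j \in s -> standard nu (ix (j, l))) ->
  (0 <= t)%R -> measurable B ->
  let D := (rowcov b (s ++ s0) - rowcov b' (s ++ s0))%R in
  t%:E * \int[mu]_v (\1_B (rowsum ix b (s ++ s0) v))%:E <=
  (L%:R * \tr (K0 *m D *m K0 *m D) / 2)%:E +
  (expR t - 1)%:E * \int[mu]_v (\1_B (rowsum ix b' (s ++ s0) v))%:E.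
Proof.
move=> us bb' KS0 bS bS' sS t0 mB; cbv zeta.
set D := (rowcov b _ - _)%R.
have us0 : uniq s0 by move: us; rewrite cat_uniq => /and3P[].
have KT0 : (K0^T = K0)%R.
  have := congr1 trmx KS0; rewrite trmx_mul rowcov_sym trmx1 => H.
  by rewrite -[LHS]mul1mx -KS0 -mulmxA H mulmx1.
have KS0' : (K0 *m rowcov b' s0 = 1%:M)%R.
  rewrite -[RHS]KS0 /rowcov; congr (_ *m _); rewrite !big_seq.
  by apply: eq_bigr => j js; rewrite bb'.
have base : rowsum (L := L) ix b' s0 = rowsum ix b s0.
  apply/funext => v; rewrite /rowsum !big_seq.
  by apply: eq_bigr => j js; rewrite bb'.
have [K [kap [KT KS KK0 _ dK]]] := add_rows nu_mu ix_inj KT0 KS0 bS us sS.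
have [K' [kap' [KT' KS' KK0' _ dK']]] := add_rows nu_mu ix_inj KT0 KS0' bS' us sS.
rewrite base in dK'.
have DT : (D^T = D)%R by rewrite /D raddfB /= !rowcov_sym.
have DE : ((K0 - K) - (K0 - K') = K' - K)%R by rewrite opprB addrC addrA subrK.
have mm := rowsum_second_moment nu_mu ix_inj.
have m1 := mm _ _ bS _ (K' - K)%R us.
have m0 := mm _ _ bS' _ (K' - K)%R us.
rewrite -DE in m1 m0.
have := two_point_test (measurable_rowsum ix b (s ++ s0))
  (measurable_rowsum ix b' (s ++ s0)) (measurable_rowsum ix b s0) dK dK' m1 m0 t0 mB.
move/le_trans; apply; apply: leeD2r; rewrite lee_fin ler_pM2r// DE -mulrBr.
rewrite ler_wpM2l// -raddfB -mulmxBr -/D (precision_difference KS' KS) -/D.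
apply: mxtrace_sandwich_le => //.
- exact: (gram_inv KT KS (gram_sum _ us)).
- exact: (gram_inv KT0 KS0 (gram_sum _ us0)).
Qed.

End row_tests.

Section rescaled_rows.
Context {R : realType} {I : finType} {n L : nat}.
Local Notation omega := {ffun I -> R}.
Variables (nu : I -> probability R R) (mu : probability omega R).
Hypothesis nu_mu : product_law (fun i => nu i) mu.
Variable iw : 'I_n * 'I_L -> I.
Hypothesis iw_inj : injective iw.
Hypothesis iw_std : forall p, standard nu (iw p).
Local Open Scope ereal_scope.

Definition axis (x : 'I_n -> R) (i : 'I_n) : 'cV[R]_n := (x i *: delta_mx i 0)%R.

Definition scaled_rows (x : 'I_n -> R) : omega -> 'M[R]_(n, L) :=
  rowsum iw (axis x) (index_enum 'I_n).

Lemma scaled_rowsE x v i l : scaled_rows x v i l = (x i * v (iw (i, l)))%R.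
Proof.
rewrite /scaled_rows /rowsum summxE (bigD1 i)//= big1 => [|j ji].
  by rewrite addr0 !mxE big_ord1 !mxE !eqxx mulr1.
by rewrite !mxE big_ord1 !mxE [in _ == _]eq_sym (negbTE ji)/= mulr0 mul0r.
Qed.

Lemma rowcov_axis x :
  (rowcov (axis x) (index_enum 'I_n) = diag_mx (\row_i x i ^+ 2))%R.
Proof.
apply/matrixP => i j; rewrite /rowcov summxE (bigD1 i)//= big1 => [|k ki].
  rewrite addr0 !mxE big_ord1 !mxE !eqxx mulr1 andbT [j == i]eq_sym.
  by case: (i == j); rewrite /= ?mulr1 ?mulr0 ?mulr0n ?mulr1n.
by rewrite !mxE big_ord1 !mxE [i == k]eq_sym (negbTE ki)/= mulr0 mul0r.
Qed.

Lemma trform_diag (dg : 'I_n -> R) (Y : 'M[R]_(n, L)) :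
  (trform (diag_mx (\row_i dg i)) Y Y = \sum_i \sum_l dg i * Y i l ^+ 2)%R.
Proof.
rewrite /trform /mxtrace exchange_big/=; apply: eq_bigr => l _.
rewrite !mxE; apply: eq_bigr => i _; rewrite mul_mx_diag !mxE.
by rewrite expr2; ring.
Qed.

Lemma scaled_rows_density x : (forall i, 0 < x i)%R ->
  exists kappa, quad_density mu (scaled_rows x) (scaled_rows (fun=> 1%R)) kappa
    (diag_mx (\row_i (1 - (x i ^+ 2)^-1)))%R.
Proof.
move=> x0; exists (\sum_(i < n) \sum_(l < L) - ln (x i))%R => g mg g0.
pose r k : R := if [pick p | iw p == k] is Some p then x p.1 else 1%R.
have rE p : r (iw p) = x p.1.
  by rewrite /r; case: pickP => [q /eqP/iw_inj->//|/(_ p)]; rewrite eqxx.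
have r1 k : k \notin codom iw -> r k = 1%R.
  by move=> kN; rewrite /r; case: pickP => // q /eqP qk; rewrite -qk codom_f in kN.
have YE v : scaled_rows x v = scaled_rows (fun=> 1%R) (rescale r v).
  by apply/matrixP => i l; rewrite !scaled_rowsE mul1r ffunE rE.
have mS y : measurable_fun [set: omega] (scaled_rows y) by exact: measurable_rowsum.
under eq_integral => v _ do rewrite YE.
rewrite (gaussian_rescale nu_mu (f := fun v => g (scaled_rows (fun=> 1%R) v))).
- apply: eq_integral => v _; congr (_ * (expR _)%:E).
  rewrite (bigID (mem (codom iw)))/= [X in (_ + X)%R]big1 => [|k kN]; last first.
    by rewrite r1// /scale_log ln1 oppr0 add0r expr1n invr1 subrr mulr0.
  rewrite addr0 -(big_uniq _ (_ : uniq (codom iw))) /=; last by rewrite map_inj_uniq ?enum_uniq.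
  transitivity (\sum_i \sum_l scale_log (r (iw (i, l))) (v (iw (i, l))))%R.
    rewrite pair_bigA/= codomE big_map enumT/=; apply: eq_bigr => -[i l] _ //.
  rewrite trform_diag mulr_suml -big_split/=; apply: eq_bigr => i _.
  rewrite mulr_suml -big_split/=; apply: eq_bigr => l _.
  by rewrite scaled_rowsE mul1r rE /scale_log/=; congr (_ + _)%R; ring.
- move=> k; rewrite /r; case: pickP => [q _|_]; [exact: x0|exact: ltr01].
- move=> k; have [/codomP[p ->] _|kN] := boolP (k \in codom iw); first exact: iw_std.
  by rewrite r1// eqxx.
- exact: (measurableT_comp mg (mS _)).
- by move=> v; exact: g0.
Qed.

(** Independent coordinates: both precisions are diagonal, and the divergence is
L / 2 times the sum of (x_i^2 - x'_i^2)^2 / (x_i x'_i)^2. *)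
Lemma scaled_rows_test (x x' : 'I_n -> R) (t xmin : R) (B : set 'M[R]_(n, L)) :
  (0 < xmin)%R -> (forall i, xmin <= x i)%R -> (forall i, xmin <= x' i)%R ->
  (0 <= t)%R -> measurable B ->
  t%:E * \int[mu]_v (\1_B (scaled_rows x v))%:E <=
  (L%:R * (\sum_i (x i ^+ 2 - x' i ^+ 2) ^+ 2 / xmin ^+ 4) / 2)%:E +
  (expR t - 1)%:E * \int[mu]_v (\1_B (scaled_rows x' v))%:E.
Proof.
move=> xm0 xm xm' t0 mB.
have x0 i : (0 < x i)%R by exact: lt_le_trans (xm i).
have x0' i : (0 < x' i)%R by exact: lt_le_trans (xm' i).
have [k dk] := scaled_rows_density x0.
have [k' dk'] := scaled_rows_density x0'.
have mS y : measurable_fun [set: omega] (scaled_rows y) by exact: measurable_rowsum.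
set D1 := diag_mx _ in dk; set D0 := diag_mx _ in dk'.
have std y (j : 'I_n) (l : 'I_L) : axis y j != 0%R -> standard nu (iw (j, l)) by [].
have mm y := rowsum_second_moment nu_mu iw_inj (std y) (D1 - D0)%R (index_enum_uniq 'I_n).
have := two_point_test (mS x) (mS x') (mS (fun=> 1%R)) dk dk' (mm x) (mm x') t0 mB.
move/le_trans; apply; apply: leeD2r; rewrite lee_fin ler_pM2r// -mulrBr ler_wpM2l//.
rewrite -raddfB -mulmxBr !rowcov_axis /D1 /D0 -!raddfB/=.
rewrite mulmx_diag mxtrace_diag; apply: ler_sum => i _; rewrite !mxE.
set p := x i; set q := x' i.
have p0 : (p ^+ 2 != 0)%R by apply: lt0r_neq0; rewrite exprn_gt0// x0.
have q0 : (q ^+ 2 != 0)%R by apply: lt0r_neq0; rewrite exprn_gt0// x0'.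
have -> : ((1 - (p ^+ 2)^-1 - (1 - (q ^+ 2)^-1)) * (p ^+ 2 - q ^+ 2) =
  (p ^+ 2 - q ^+ 2) ^+ 2 / (p ^+ 2 * q ^+ 2))%R.
  by move: p0 q0; move: (p ^+ 2)%R (q ^+ 2)%R => a b a0 b0; field; apply/andP; split.
rewrite ler_wpM2l ?sqr_ge0// lef_pV2 ?posrE ?mulr_gt0 ?exprn_gt0//; try exact: x0; try exact: x0'.
rewrite (_ : (xmin ^+ 4 = xmin ^+ 2 * xmin ^+ 2)%R) -?exprD//.
have sq (y : R) : (xmin <= y)%R -> (xmin ^+ 2 <= y ^+ 2)%R.
  by move=> xy; rewrite lerXn2r ?nnegrE ?(ltW xm0)//; exact: le_trans (ltW xm0) xy.
by rewrite exprD; apply: ler_pM; rewrite ?sqr_ge0// sq// ?xm ?xm'.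
Qed.

End rescaled_rows.

(** * The observation, its design, and resampling *)

Section observations.
Context {R : realType} {I : finType} {m n L : nat}.
Local Notation omega := {ffun I -> R}.
Variables (nu : I -> probability R R) (mu : probability omega R).
Hypothesis nu_mu : product_law (fun i => nu i) mu.
Variables (ax : 'I_n * 'I_m -> I) (ix : ('I_n + 'I_m) * 'I_L -> I) (sg : R).
Hypotheses (ax_inj : injective ax) (ix_inj : injective ix).
Hypothesis ax_ix : forall k p, ax k != ix p.
Hypothesis ax_std : forall k, standard nu (ax k).
Hypothesis w_std : forall i l, standard nu (ix (inl i, l)).
Hypothesis z_std : sg != 0 -> forall r l, standard nu (ix (inr r, l)).
Local Open Scope ereal_scope.

(** The observation is a sum of rank-one terms, one for each coordinate of the
signal and one for each coordinate of the noise. *)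
Definition signal_rows (x : 'I_n -> R) (a : 'I_n -> 'cV[R]_m) (j : 'I_n + 'I_m) : 'cV[R]_m :=
  match j with inl i => x i *: a i | inr r => sg *: delta_mx r 0 end%R.

Definition columns (v : omega) (i : 'I_n) : 'cV[R]_m := colv ax i v.

Definition observation (x : 'I_n -> R) (v : omega) : 'M[R]_(m, L) :=
  rowsum ix (signal_rows x (columns v)) (index_enum ('I_n + 'I_m)%type) v.

Definition design (v : omega) : 'M[R]_(m, n) := \matrix_(r, i) v (ax (i, r)).

Lemma measurable_design : measurable_fun [set: omega] design.
Proof.
apply: measurable_fun_matrix => r i.
have -> : (fun v => design v r i) = (fun v => v (ax (i, r))).
  by apply/funext => v; rewrite mxE.
exact: measurable_coord.
Qed.

Lemma measurable_observation x : measurable_fun [set: omega] (observation x).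
Proof.
apply: measurable_sum_mx => -[i|r]; apply: measurable_mulmx; try exact: measurable_row_of.
  apply: measurable_fun_matrix => o u.
  have -> : (fun v => signal_rows x (columns v) (inl i) o u) =
      (fun v => (x i * v (ax (i, o)))%R).
    by apply/funext => v; rewrite /= mxE [u]ord1 colvE.
  by apply: measurable_funM => //; exact: measurable_coord.
exact: measurable_cst.
Qed.

Let E := mem (codom ix).

Let not_E k : E (ax k) = false.
Proof. by apply/negP => /codomP[p /eqP]; rewrite (negbTE (ax_ix _ _)). Qed.

Lemma columns_resample v' v : columns (merge E v' v) = columns v.
Proof. by apply/funext => i; apply/colP => r; rewrite !colvE ffunE not_E. Qed.

Lemma design_resample v' v : design (merge E v' v) = design v.
Proof. by apply/matrixP => r i; rewrite !mxE ffunE not_E. Qed.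

Lemma observation_resample x v' v : observation x (merge E v' v) =
  rowsum ix (signal_rows x (columns v)) (index_enum _) v'.
Proof.
rewrite /observation columns_resample; apply: eq_bigr => j _; congr (_ *m _)%R.
by apply/rowP => l; rewrite !mxE ffunE ifT//; exact: codom_f.
Qed.

Definition cross_form (d : 'I_n -> R) (K : 'M[R]_m) (a : 'I_n -> 'cV[R]_m) : R :=
  (\sum_i \sum_j d i * d j * cross K (a i) (a j) ^+ 2)%R.

Lemma mxtrace_cross_form d K a : (K^T = K)%R ->
  let D := (\sum_i d i *: (a i *m (a i)^T))%R in
  (\tr (K *m D *m K *m D) = cross_form d K a)%R.
Proof.
move=> KT D; have tr1 i j :
    (\tr (K *m (a i *m (a i)^T) *m K *m (a j *m (a j)^T)) = cross K (a i) (a j) ^+ 2)%R.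
  rewrite -!mulmxA mxtrace_mulC -!mulmxA mxtrace_mulC -!mulmxA.
  have -> : ((a i)^T *m (K *m (a j *m ((a j)^T *m (K *m a i)))) =
     (cross K (a i) (a j) * cross K (a j) (a i))%:M)%R.
    rewrite !mulmxA [((a i)^T *m K *m a j)%R]mx11_scalar -!mulmxA mul_scalar_mx.
    rewrite [((a j)^T *m (K *m a i))%R]mx11_scalar /cross -!mulmxA.
    by rewrite scale_scalar_mx.
  rewrite mxtrace_scalar mulr1n; congr (_ * _)%R.
  rewrite /cross -[in RHS]KT -mulmxA -[a j in RHS]trmxK -!trmx_mul [in RHS]mxE.
  by rewrite !mulmxA.
rewrite /cross_form -[K *m D *m K *m D]mulmxA {1}/D mulmx_sumr mulmx_suml raddf_sum/=.
apply: eq_bigr => i _; rewrite mulmx_sumr raddf_sum/=; apply: eq_bigr => j _.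
by rewrite mulmxA -!scalemxAr -!scalemxAl !mxtraceZ tr1 mulrCA mulrA.
Qed.

Section shared_part.
Variables (x x' : 'I_n -> R) (x0 : R) (h : seq 'I_n).
Hypotheses (uh : uniq h) (xh : forall i, i \in h -> x i = x0)
  (xh' : forall i, i \in h -> x' i = x0).
Let d i := (x i ^+ 2 - x' i ^+ 2)%R.
Let S v := (colgram ax x0 h v + (sg ^+ 2)%:M)%R.

Let hc := [seq i <- index_enum 'I_n | i \notin h].
Let s := map inl hc : seq ('I_n + 'I_m).
Let s0 := map inl h ++ map inr (index_enum 'I_m) : seq ('I_n + 'I_m).

Let us : uniq (s ++ s0).
Proof.
have iL : injective (@inl 'I_n 'I_m) by move=> ? ? [].
have iR : injective (@inr 'I_n 'I_m) by move=> ? ? [].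
have nLR (r : seq 'I_n) (r' : seq 'I_m) : ~~ has (mem (map inl r)) (map (@inr 'I_n 'I_m) r').
  by apply/hasPn => _ /mapP[u _ ->]; apply/negP => /mapP[].
rewrite !cat_uniq !map_inj_uniq// filter_uniq ?index_enum_uniq//= uh.
rewrite nLR !andbT; apply/hasPn => j; rewrite mem_cat => /orP[/mapP[i ih ->]|/mapP[r _ ->]].
  by rewrite mem_map// mem_filter ih.
by apply/negP => /mapP[].
Qed.

Let ps : perm_eq (s ++ s0) (index_enum ('I_n + 'I_m)%type).
Proof.
apply: uniq_perm; rewrite ?index_enum_uniq//.
have iL : injective (@inl 'I_n 'I_m) by move=> ? ? [].
have iR : injective (@inr 'I_n 'I_m) by move=> ? ? [].
move=> [i|r]; rewrite mem_index_enum !mem_cat.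
  by rewrite !mem_map// mem_filter mem_index_enum andbT; case: (i \in h); rewrite ?orbT.
by rewrite (mem_map iR) mem_index_enum !orbT.
Qed.

Lemma shared_rowcov v : (rowcov (signal_rows x (columns v)) s0 = S v)%R.
Proof.
rewrite /rowcov big_cat/= !big_map /S /colgram; congr (_ + _)%R.
  by rewrite !big_seq; apply: eq_bigr => i ih; rewrite /= xh.
apply/matrixP => r r'; rewrite summxE !mxE (bigD1 r)//= big1 => [|k kr].
  by rewrite !mxE big_ord1 !mxE !eqxx mulr1 andbT addr0 [r' == r]eq_sym;
    case: (r == r'); rewrite /= ?mulr1 ?mulr0 ?mulr0n ?mulr1n.
by rewrite !mxE big_ord1 !mxE [r == k]eq_sym (negbTE kr)/= mulr0 mul0r.
Qed.

(** Instance of [shared_rows_test] for a fixed value of the design; the background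
consists of the coordinates in h and the noise. *)
Lemma frozen_design_test v (t : R) (B : set 'M[R]_(m, L)) :
  (S v \in unitmx)%R -> (0 <= t)%R -> measurable B ->
  t%:E * \int[mu]_v' (\1_B (rowsum ix (signal_rows x (columns v)) (index_enum _) v'))%:E <=
  (L%:R * cross_form d (minv (S v)) (columns v) / 2)%:E +
  (expR t - 1)%:E *
    \int[mu]_v' (\1_B (rowsum ix (signal_rows x' (columns v)) (index_enum _) v'))%:E.
Proof.
move=> uS t0 mB; have gS : gram (S v).
  by apply: gram_add; [exact: gram_colgram|apply: gram_scalar; exact: sqr_ge0].
rewrite minvE//; have KT := gram_sym (gram_invmx gS uS).
have std y : forall j l, signal_rows y (columns v) j != 0%R -> standard nu (ix (j, l)).
  move=> [i|r] l //=; have [->|sg0 _] := eqVneq sg 0%R; first by rewrite scale0r eqxx.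
  exact: z_std.
have eqs : {in s0, signal_rows x (columns v) =1 signal_rows x' (columns v)}.
  move=> j; rewrite mem_cat => /orP[/mapP[i ih ->]|/mapP[r _ ->]]//=.
  by rewrite xh ?xh'.
have sS : forall (j : 'I_n + 'I_m) (l : 'I_L), j \in s -> standard nu (ix (j, l)).
  by move=> j l /mapP[i _ ->].
have KS : (invmx (S v) *m rowcov (signal_rows x (columns v)) s0 = 1%:M)%R.
  by rewrite shared_rowcov mulVmx.
have := shared_rows_test nu_mu ix_inj us eqs KS (std x) (std x') sS t0 mB.
rewrite /= !(rowsum_perm _ _ ps) -mxtrace_cross_form//.
suff -> : (rowcov (signal_rows x (columns v)) (s ++ s0) -
  rowcov (signal_rows x' (columns v)) (s ++ s0) =
  \sum_i d i *: (columns v i *m (columns v i)^T))%R by [].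
rewrite /rowcov !(perm_big _ ps)/= !big_sumType/= opprD addrACA subrr addr0 -sumrB.
have sc (c : R) (u : 'cV[R]_m) : ((c *: u) *m (c *: u)^T = c ^+ 2 *: (u *m u^T))%R.
  by rewrite linearZ/= -scalemxAr -scalemxAl scalerA expr2.
by apply: eq_bigr => i _; rewrite !sc -scalerBl.
Qed.

End shared_part.

End observations.

(** * Two-point tests averaged over the design *)

Section integrated_tests.
Context {R : realType} {I : finType} {m n L : nat}.
Local Notation omega := {ffun I -> R}.
Variables (nu : I -> probability R R) (mu : probability omega R).
Hypothesis nu_mu : product_law (fun i => nu i) mu.
Local Open Scope ereal_scope.

(** Both sides are averaged over the coordinates outside E, by [resample]. *)
Lemma integrate_test (E : pred I) (f f' : omega -> \bar R) (q : omega -> R) (t : R) :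
  measurable_fun [set: omega] f -> (forall v, 0 <= f v) ->
  measurable_fun [set: omega] f' -> (forall v, 0 <= f' v) ->
  measurable_fun [set: omega] q -> (forall v, 0 <= q v)%R -> (0 <= t)%R ->
  (forall v, t%:E * \int[mu]_v' f (merge E v' v) <=
     (q v)%:E + (expR t - 1)%:E * \int[mu]_v' f' (merge E v' v)) ->
  t%:E * \int[mu]_v f v <= \int[mu]_v (q v)%:E + (expR t - 1)%:E * \int[mu]_v f' v.
Proof.
move=> mf f0 mf' f'0 mq q0 t0 H.
have e0 : (0 <= expR t - 1)%R.
  by rewrite subr_ge0; apply: le_trans (expR_ge1Dx t); rewrite lerDl.
have inner g : measurable_fun [set: omega] g -> (forall v, 0 <= g v) ->
    measurable_fun [set: omega] (fun v => \int[mu]_v' g (merge E v' v)).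
  move=> mg g0.
  have mG : measurable_fun setT (fun z : omega * omega => g (merge E z.1 z.2)).
    by apply: measurableT_comp => //; exact: measurable_merge.
  by apply: (measurable_fun_fubini_tonelli_G (m1 := mu) _ mG) => z; exact: g0.
have inner0 g : (forall v, 0 <= g v) -> forall v, 0 <= \int[mu]_v' g (merge E v' v).
  by move=> g0 v; apply: integral_ge0 => v' _; exact: g0.
rewrite (resample nu_mu E mf f0) (resample nu_mu E mf' f'0).
have mi := inner _ mf f0; have mi' := inner _ mf' f'0.
have i0 := inner0 _ f0; have i0' := inner0 _ f'0.
have mq' : measurable_fun [set: omega] (fun v => (q v)%:E) by exact/measurable_EFinP.
have m3 : measurable_fun [set: omega]
    (fun v => (expR t - 1)%:E * \int[mu]_v' f' (merge E v' v)) by exact: measurable_funeM.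
rewrite -(ge0_integralZl mu measurableT mi (fun v _ => i0 v)) ?lee_fin//.
rewrite -(ge0_integralZl mu measurableT mi' (fun v _ => i0' v)) ?lee_fin//.
rewrite -ge0_integralD//; last 2 first.
- by move=> v _; rewrite lee_fin.
- by move=> v _; apply: mule_ge0 => //; rewrite lee_fin.
apply: ge0_le_integral => //.
- by move=> v _; apply: mule_ge0 => //; rewrite lee_fin.
- exact: measurable_funeM.
- exact: emeasurable_funD.
Qed.

Variables (ax : 'I_n * 'I_m -> I) (ix : ('I_n + 'I_m) * 'I_L -> I) (sg : R).
Hypotheses (ax_inj : injective ax) (ix_inj : injective ix).
Hypothesis ax_ix : forall k p, ax k != ix p.
Hypothesis ax_std : forall k, standard nu (ax k).
Hypothesis w_std : forall i l, standard nu (ix (inl i, l)).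
Hypothesis z_std : sg != 0%R -> forall r l, standard nu (ix (inr r, l)).

Definition data (x : 'I_n -> R) (v : omega) : 'M[R]_(m, L) * 'M[R]_(m, n) :=
  (observation ax ix sg x v, design ax v).

Lemma measurable_data x : measurable_fun [set: omega] (data x).
Proof.
apply: measurable_fun_pair; first exact: measurable_observation.
exact: measurable_design.
Qed.

Definition hit (x : 'I_n -> R) (B : set ('M[R]_(m, L) * 'M[R]_(m, n))) : \bar R :=
  \int[mu]_v (\1_B (data x v))%:E.

Lemma measurable_hit x B : measurable B ->
  measurable_fun [set: omega] (fun v => (\1_B (data x v) : R)).
Proof.
move=> mB; apply: (measurableT_comp (f := \1_B : _ -> R)); first exact: measurable_indic.
exact: measurable_data.
Qed.

Let measurable_slice (B : set ('M[R]_(m, L) * 'M[R]_(m, n))) p q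
    (f : 'M[R]_(p, q) -> 'M[R]_(m, L)) A : measurable B ->
  measurable_fun [set: 'M[R]_(p, q)] f -> measurable [set Y | B (f Y, A)].
Proof.
move=> mB mf; rewrite (_ : [set Y | _] = (fun Y => (f Y, A)) @^-1` B)//.
rewrite -[X in measurable X]setTI.
have mg : measurable_fun [set: 'M[R]_(p, q)] (fun Y => (f Y, A)).
  by apply: measurable_fun_pair => //; exact: measurable_cst.
exact: mg.
Qed.

(** With the design and the noise fixed, the observation is a function of
the matrix of speckled signals, to which [scaled_rows_test] applies. *)
Lemma scaling_test (x x' : 'I_n -> R) (xmin t : R) B :
  (0 < xmin)%R -> (forall i, xmin <= x i)%R -> (forall i, xmin <= x' i)%R ->
  (0 <= t)%R -> measurable B ->
  t%:E * hit x B <=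
  (L%:R * (\sum_i (x i ^+ 2 - x' i ^+ 2) ^+ 2 / xmin ^+ 4) / 2)%:E +
  (expR t - 1)%:E * hit x' B.
Proof.
move=> xm0 xm xm' t0 mB.
pose iw (p : 'I_n * 'I_L) := ix (inl p.1, p.2).
have iwi : injective iw by move=> [i l] [i' l'] /ix_inj [-> ->].
pose E := mem (codom iw).
pose f y v := (\1_B (data y v))%:E : \bar R.
set q := (L%:R * _ / 2)%R.
have q0 : (0 <= q)%R.
  rewrite /q divr_ge0// mulr_ge0// sumr_ge0// => i _.
  by rewrite divr_ge0 ?sqr_ge0// exprn_ge0// ltW.
have mf y : measurable_fun [set: omega] (f y).
  by apply/measurable_EFinP; exact: measurable_hit.
have f0 y v : 0 <= f y v by rewrite lee_fin.
have NE k : E (ax k) = false.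
  by apply/negP => /codomP[p /eqP]; rewrite (negbTE (ax_ix _ _)).
have colE v' v : columns ax (merge E v' v) = columns ax v.
  by apply/funext => i; apply/colP => r; rewrite !colvE ffunE NE.
have desE v' v : design ax (merge E v' v) = design ax v.
  by apply/matrixP => r i; rewrite !mxE ffunE NE.
pose N v : 'M[R]_(m, L) := (\sum_(r < m) (sg *: delta_mx r 0) *m row_of ix (inr r) v)%R.
have obsE y v' v : observation ax ix sg y (merge E v' v) =
    (design ax v *m scaled_rows iw y v' + N v)%R.
  rewrite /observation /rowsum big_sumType/= colE; congr (_ + _)%R.
    apply/matrixP => r l; rewrite summxE mxE; apply: eq_bigr => i _.
    rewrite scaled_rowsE !mxE big_ord1 !mxE ffunE ifT; last exact: (codom_f iw (i, l)).
    by rewrite mulrA [(_ * y i)%R]mulrC.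
  apply: eq_bigr => r _; congr (_ *m _)%R; apply/rowP => l; rewrite !mxE ffunE.
  by case: ifP => // /codomP[p /ix_inj].
have := @integrate_test E (f x) (f x') (fun=> q) t (mf x) (f0 x) (mf x') (f0 x')
  (measurable_cst _) (fun=> q0) t0.
rewrite integral_cst_probability; apply => v.
have mBv : measurable [set Th | B (design ax v *m Th + N v, design ax v)%R].
  apply: (measurable_slice (f := fun Th => design ax v *m Th + N v)%R) => //.
  apply: measurable_addmx; last exact: measurable_cst.
  by apply: measurable_mulmx; [exact: measurable_cst|exact: measurable_id].
have fE y : \int[mu]_v' f y (merge E v' v) =
    \int[mu]_v' (\1_[set Th | B (design ax v *m Th + N v, design ax v)%R]
      (scaled_rows iw y v'))%:E.
  by apply: eq_integral => v' _; rewrite /f /data obsE desE.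
rewrite !fE; apply: (scaled_rows_test nu_mu iwi _ xm0) => // p.
exact: w_std.
Qed.

Section good_design.
Variables (x x' : 'I_n -> R) (x0 : R) (h : seq 'I_n) (tau : R).
Hypotheses (uh : uniq h) (xh : forall i, i \in h -> x i = x0)
  (xh' : forall i, i \in h -> x' i = x0).
Let d i := (x i ^+ 2 - x' i ^+ 2)%R.
Hypothesis d0 : (\sum_i d i = 0)%R.
Let S v := (colgram ax x0 h v + (sg ^+ 2)%:M)%R.

(** Depends on the columns of the design in h only, so the other columns can be
redrawn on this event. *)
Definition good_design : set omega := [set v | S v \in unitmx /\ \tr (minv (S v)) <= tau]%R.

Hypothesis mgood : measurable good_design.
Hypothesis good_prob : mu (~` good_design) <= 8^-1%:E.

Let ind0 v : ~ good_design v -> (\1_good_design v = 0 :> R)%R.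
Proof. by move=> ng; rewrite indicE memNset. Qed.

Let ind1 v : good_design v -> (\1_good_design v = 1 :> R)%R.
Proof. by move=> g; rewrite indicE mem_set. Qed.

Let gS v : gram (S v).
Proof. by apply: gram_add; [exact: gram_colgram|apply: gram_scalar; exact: sqr_ge0]. Qed.

Let measurable_S : measurable_fun [set: omega] S.
Proof. by apply: measurable_addmx; [exact: measurable_colgram|exact: measurable_cst]. Qed.

Let Q (K : 'M[R]_m) (v : omega) : R := cross_form d K (columns ax v).

Let Q_ge0 K v : gram K -> (0 <= Q K v)%R.
Proof.
move=> gK; rewrite /Q -mxtrace_cross_form; last exact: gram_sym.
set D := (\sum_i _)%R; have [J [c KE]] := gK.
have DT : (D^T = D)%R.
  rewrite /D raddf_sum/=; apply: eq_bigr => i _.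
  by rewrite linearZ/= trmx_mul trmxK.
rewrite {2}KE (mxtrace_gram _ _ DT); apply: sumr_ge0 => j _.
exact: gram_psd.
Qed.

Let measurable_Q (F : omega -> 'M[R]_m) : measurable_fun [set: omega] F ->
  measurable_fun [set: omega] (fun v => Q (F v) v).
Proof.
move=> mF; apply: measurable_sum => i; apply: measurable_sum => j.
apply: measurable_funM => //; apply: measurable_funX.
apply: (measurableT_comp (measurable_entry 0%R 0%R)); apply: measurable_mulmx.
  by apply: measurable_mulmx => //; apply: measurable_trmx; exact: measurable_colv.
exact: measurable_colv.
Qed.

Let qg v : R := (\1_good_design v * (L%:R * Q (minv (S v)) v / 2))%R.

Let qg_ge0 v : (0 <= qg v)%R.
Proof.
rewrite /qg indicE; have [|_] := boolP (v \in good_design); last by rewrite mul0r.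
rewrite inE => -[uS _]; rewrite mul1r divr_ge0// mulr_ge0// minvE//.
by apply: Q_ge0; exact: gram_invmx.
Qed.

Let measurable_qg : measurable_fun [set: omega] qg.
Proof.
apply: measurable_funM; first exact: measurable_indic.
by apply: measurable_funM => //; apply: measurable_funM => //; apply: measurable_Q; exact: measurable_minv.
Qed.

Let mean_qg : \int[mu]_v (qg v)%:E <= (L%:R * (96 * (\sum_i d i ^+ 2) * tau ^+ 2) / 2)%:E.
Proof.
pose E k := (k \in codom ax) && [forall p, (ax p == k) ==> (p.1 \notin h)].
have EN i r : E (ax (i, r)) = (i \notin h).
  rewrite /E codom_f/=; apply/forallP/idP => [/(_ (i, r))|ih p]; first by rewrite eqxx.
  by apply/implyP => /eqP/ax_inj ->.
have SE v' v : S (merge E v' v) = S v.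
  by rewrite /S colgram_merge// => i r ih; rewrite EN ih.
have gE v' v : good_design (merge E v' v) = good_design v.
  by rewrite /good_design/= SE.
have QE K v' v : Q K (merge E v' v) = Q K v'.
  apply: eq_bigr => i _; apply: eq_bigr => j _.
  have [ih|ih] := boolP (i \in h); first by rewrite /d xh// xh'// subrr !mul0r.
  have [jh|jh] := boolP (j \in h); first by rewrite /d (xh jh) (xh' jh) subrr mulr0 !mul0r.
  congr (_ * cross _ _ _ ^+ 2)%R.
    by apply/colP => r; rewrite !colvE ffunE EN ih.
  by apply/colP => r; rewrite !colvE ffunE EN jh.
have mq : measurable_fun [set: omega] (fun v => (qg v)%:E) by exact/measurable_EFinP.
rewrite (resample nu_mu E mq); last by move=> v; rewrite lee_fin.
rewrite -[leRHS](integral_cst_probability mu).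
have D0 : (0 <= \sum_i d i ^+ 2)%R by apply: sumr_ge0 => i _; exact: sqr_ge0.
apply: ge0_le_integral => //.
- by move=> v _; apply: integral_ge0 => v' _; rewrite lee_fin.
- have mG : measurable_fun setT (fun z : omega * omega => (qg (merge E z.1 z.2))%:E).
    apply: (measurableT_comp mq); exact: measurable_merge.
  by apply: (measurable_fun_fubini_tonelli_G (m1 := mu) _ mG) => z; rewrite lee_fin.
move=> v _.
have [gv|ngv] := pselect (good_design v); last first.
  have -> : \int[mu]_v' (qg (merge E v' v))%:E = 0.
    by apply: integral0_eq => v' _; rewrite /qg ind0 ?mul0r ?gE.
  by rewrite lee_fin divr_ge0//; nneg.
have [uS trS] := gv.
set K := minv (S v); have gK : gram K by rewrite /K minvE//; exact: gram_invmx.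
have qE v' : (qg (merge E v' v))%:E = (L%:R / 2)%:E * (Q K v')%:E.
  rewrite /qg ind1 ?gE// mul1r SE QE -EFinM; congr (_%:E).
  by rewrite mulrAC.
under eq_integral do rewrite qE.
have mQK : measurable_fun [set: omega] (fun v' => (Q K v')%:E).
  by apply/measurable_EFinP; apply: (measurable_Q (F := fun=> K)); exact: measurable_cst.
have Q0 v' : [set: omega] v' -> 0 <= (Q K v')%:E by move=> _; rewrite lee_fin; exact: Q_ge0.
rewrite (ge0_integralZl mu measurableT mQK Q0); last by rewrite lee_fin divr_ge0.
have := mean_cross_form nu_mu ax_inj ax_std (gram_sym gK) gK d0.
move=> /(@lee_wpmul2l _ (L%:R / 2)%:E); rewrite lee_fin divr_ge0// => /(_ isT).
move/le_trans; apply; rewrite -EFinM lee_fin mulrAC ler_pM2r// ler_wpM2l//.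
rewrite ler_wpM2l ?mulr_ge0// lerXn2r ?nnegrE//; first exact: gram_trace_ge0.
exact: le_trans (gram_trace_ge0 gK) trS.
Qed.

(** On the good event, [frozen_design_test] is averaged first over the speckle and the noise,
then over the columns outside h, where [mean_cross_form] applies; the columns in
h do not contribute because d vanishes there. The complement of the event costs t / 8. *)
Lemma good_design_test (t : R) B : (0 <= t)%R -> measurable B ->
  t%:E * hit x B <=
  (t / 8 + L%:R * (96 * (\sum_i d i ^+ 2) * tau ^+ 2) / 2)%:E +
  (expR t - 1)%:E * hit x' B.
Proof.
move=> t0 mB.
have e0 : (0 <= expR t - 1)%R.
  by rewrite subr_ge0; apply: le_trans (expR_ge1Dx t); rewrite lerDl.
pose f y v := (\1_good_design v * \1_B (data y v))%:E : \bar R.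
have mf y : measurable_fun [set: omega] (f y).
  apply/measurable_EFinP; apply: measurable_funM; first exact: measurable_indic.
  exact: measurable_hit.
have f0 y v : 0 <= f y v by rewrite lee_fin mulr_ge0.
pose E := mem (codom ix).
have colE v' v : columns ax (merge E v' v) = columns ax v := columns_resample ax_ix v' v.
have desE v' v : design ax (merge E v' v) = design ax v := design_resample ax_ix v' v.
have gE v' v : good_design (merge E v' v) = good_design v.
  rewrite /good_design/= /S colgram_merge// => i r _.
  by apply/negP => /codomP[p /eqP]; rewrite (negbTE (ax_ix _ _)).
have key v : t%:E * \int[mu]_v' f x (merge E v' v) <=
     (qg v)%:E + (expR t - 1)%:E * \int[mu]_v' f x' (merge E v' v).
  have [gv|ngv] := pselect (good_design v); last first.
    have z y : \int[mu]_v' f y (merge E v' v) = 0.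
      apply: integral0_eq => v' _.
      by rewrite /f ind0 ?mul0r ?gE.
    by rewrite !z !mule0 adde0 lee_fin.
  have mBv : measurable [set Y | B (Y, design ax v)].
    by apply: (measurable_slice (f := id)) => //; exact: measurable_id.
  have fE y : \int[mu]_v' f y (merge E v' v) =
      \int[mu]_v' (\1_[set Y | B (Y, design ax v)]
        (rowsum ix (signal_rows sg y (columns ax v)) (index_enum _) v'))%:E.
    apply: eq_integral => v' _; rewrite /f ind1 ?gE// mul1r.
    by rewrite /data observation_resample// desE.
  have [uS _] := gv.
  have := frozen_design_test nu_mu ix_inj w_std z_std uh xh xh' uS t0 mBv.
  by rewrite -!fE /qg ind1// mul1r.
have main := integrate_test (mf x) (f0 x) (mf x') (f0 x') measurable_qg qg_ge0 t0 key.
have mind : measurable_fun [set: omega] (fun v => (\1_(~` good_design) v : R)%:E).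
  by apply/measurable_EFinP; apply: measurable_indic; exact: measurableC.
have mh y : measurable_fun [set: omega] (fun v => (\1_B (data y v))%:E : \bar R).
  by apply/measurable_EFinP; exact: measurable_hit.
have up : hit x B <= \int[mu]_v f x v + 8^-1%:E.
  apply: (@le_trans _ _ (\int[mu]_v (f x v + (\1_(~` good_design) v)%:E))).
    apply: ge0_le_integral => //.
    - exact: emeasurable_funD.
    - move=> v _; rewrite -EFinD lee_fin /f.
      have [gv|ngv] := pselect (good_design v).
        by rewrite (ind1 gv) mul1r lerDl.
      rewrite (ind0 ngv) mul0r add0r [X in (_ <= X)%R]indicE mem_set//.
      by rewrite indicE lern1 leq_b1.
  rewrite ge0_integralD//; apply: leeD2l.
  by rewrite integral_indic ?setIT//; exact: measurableC.
have down : \int[mu]_v f x' v <= hit x' B.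
  apply: ge0_le_integral => //.
  move=> v _; rewrite lee_fin indicE.
  by case: (v \in good_design); rewrite ?mul1r ?mul0r.
apply: (@le_trans _ _ (t%:E * (\int[mu]_v f x v + 8^-1%:E))).
  by apply: lee_wpmul2l; rewrite ?lee_fin.
rewrite muleDr//; last first.
  by rewrite ge0_adde_def// ?inE; [apply: integral_ge0 => v _; exact: f0|rewrite lee_fin].
rewrite addeC EFinD -addeA -EFinM; apply: leeD2l.
apply: (le_trans main); apply: leeD; first exact: mean_qg.
by apply: lee_wpmul2l; rewrite ?lee_fin.
Qed.

End good_design.
End integrated_tests.

(** * The two-point test in all noise regimes *)

Section pair_test.
Context {R : realType} {I : finType} {m n L : nat}.
Local Notation omega := {ffun I -> R}.
Variables (nu : I -> probability R R) (mu : probability omega R).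
Hypothesis nu_mu : product_law (fun i => nu i) mu.
Variables (ax : 'I_n * 'I_m -> I) (ix : ('I_n + 'I_m) * 'I_L -> I) (sg : R).
Hypotheses (ax_inj : injective ax) (ix_inj : injective ix).
Hypothesis ax_ix : forall k p, ax k != ix p.
Hypothesis ax_std : forall k, standard nu (ax k).
Hypothesis w_std : forall i l, standard nu (ix (inl i, l)).
Hypothesis z_std : sg != 0 -> forall r l, standard nu (ix (inr r, l)).

Lemma trace_shift_le (N : 'M[R]_m) (rho : R) : gram N -> 0 < rho ->
  \tr (invmx (N + rho%:M)) <= m%:R / rho.
Proof.
move=> gN r0; have uS := gram_shift_unit gN r0.
have gK : gram (invmx (N + rho%:M)).
  by apply: gram_invmx => //; apply: gram_add => //; apply: gram_scalar; exact: ltW.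
rewrite ler_pdivlMr//.
have := congr1 mxtrace (mulVmx uS); rewrite mulmxDr mxtraceD mxtrace1 mul_mx_scalar mxtraceZ.
move=> <-; rewrite mulrC lerDr.
by have /andP[] := mxtrace_mul_le gK gN.
Qed.

(** The ratio n / m from which [small_inverse_prob] gives a bound at most 1
with h one half of the columns. *)
Definition design_ratio : R := 16 * 49 ^+ 2.

Definition information_constant (xmin : R) : R := 96 * design_ratio ^+ 2 / xmin ^+ 4 + 96.

Definition noise_level : R :=
  Num.max (sg ^+ 4) (Num.max (m%:R ^+ 2) (n%:R ^+ 2)).

Let N := design_ratio.
Let N0 : 0 < N. Proof. by rewrite /N /design_ratio mulr_gt0// exprn_gt0. Qed.
Let N1 : 1 <= N.
Proof.
have h49 : 1 <= 49 ^+ 2 :> R by rewrite exprn_ege1// ler1n.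
by rewrite /N /design_ratio; move: h49; move: (49 ^+ 2) => q; lra.
Qed.

(** The three regimes of the noise level give the same bound, up to constants
collected in [information_constant]. *)
Lemma pair_test (x x' : 'I_n -> R) (x0 xmin : R) (h : seq 'I_n) (t : R) B :
  (0 < m)%N -> (0 < n)%N -> 0 < xmin ->
  (forall i, xmin <= x i) -> (forall i, xmin <= x' i) ->
  xmin <= x0 -> uniq h -> (n <= 2 * size h)%N ->
  (forall i, i \in h -> x i = x0) -> (forall i, i \in h -> x' i = x0) ->
  \sum_i (x i ^+ 2 - x' i ^+ 2) = 0 -> 0 <= t -> measurable B ->
  (t%:E * hit (m := m) (L := L) mu ax ix sg x B <=
  (t / 8 + L%:R * (information_constant xmin * (\sum_i (x i ^+ 2 - x' i ^+ 2) ^+ 2)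
     * (m%:R ^+ 2 / noise_level)) / 2)%:E +
  (expR t - 1)%:E * hit mu ax ix sg x' B)%E.
Proof.
move=> m0 n0 xm0 xm xm' xm00 uh nh xh xh' d0 t0 mB.
have m0' : 0 < m%:R :> R by rewrite ltr0n.
have n0' : 0 < n%:R :> R by rewrite ltr0n.
have sg4 : sg ^+ 4 = (sg ^+ 2) ^+ 2 by rewrite -exprM.
have sq0 (a b : R) : 0 <= b -> a <= b -> 0 <= a -> a ^+ 2 <= b ^+ 2.
  by move=> b0 ab a0; rewrite lerXn2r ?nnegrE.
set D := \sum_i (_ ^+ 2 - _ ^+ 2) ^+ 2.
have D0 : 0 <= D by apply: sumr_ge0 => i _; exact: sqr_ge0.
set C := information_constant xmin.
have xm4 : 0 < xmin ^+ 4 by rewrite exprn_gt0.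
have C96 : 96 <= C.
  by rewrite /C /information_constant lerDr divr_ge0 ?(ltW xm4)// mulr_ge0// sqr_ge0.
have CN : 96 * N ^+ 2 / xmin ^+ 4 <= C by rewrite /C /information_constant lerDl.
have s0 : 0 <= sg ^+ 2 := sqr_ge0 _.
have widen a b : a <= b ->
  ((t%:E * hit mu ax ix sg x B <= (t / 8 + L%:R * (a * D) / 2)%:E +
    (expR t - 1)%:E * hit mu ax ix sg x' B) ->
  (t%:E * hit mu ax ix sg x B <= (t / 8 + L%:R * (b * D) / 2)%:E +
    (expR t - 1)%:E * hit mu ax ix sg x' B))%E.
  move=> ab /le_trans; apply; apply: leeD2r; rewrite lee_fin lerD2l ler_pM2r//.
  by rewrite ler_wpM2l// ler_wpM2r.
rewrite [C * D * _]mulrAC.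
have [smn|smn] := leP (Num.max m%:R n%:R) (sg ^+ 2).
  (* Strong noise: the additive noise alone bounds the precision, by 1 / sg^2. *)
  move: smn; rewrite ge_max => /andP[sm sn].
  have MxE : noise_level = sg ^+ 4.
    apply/max_idPl; rewrite sg4 ge_max; apply/andP.
    by split; apply: sq0.
  have s2 : 0 < sg ^+ 2 by exact: lt_le_trans sm.
  have gN v : gram (colgram ax x0 h v) by exact: gram_colgram.
  pose tau := m%:R / sg ^+ 2.
  have goodT : good_design ax sg x0 h tau = setT.
    apply/seteqP; split => // v _; split; first exact: gram_shift_unit.
    by rewrite minvE ?trace_shift_le// gram_shift_unit.
  apply: (widen (96 * tau ^+ 2)).
    rewrite MxE sg4 /tau expr_div_n ler_wpM2r// divr_ge0 ?sqr_ge0//.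
  have := @good_design_test _ _ _ _ _ _ _ nu_mu ax ix sg ax_inj ix_inj ax_ix ax_std
    w_std z_std x x' x0 h tau uh xh xh' d0 _ _ t B t0 mB.
  rewrite goodT => H; rewrite [96 * _ * D]mulrAC; apply: H; first exact: measurableT.
  by rewrite setCT measure0.
have [nm|nm] := leP (N * m%:R) n%:R.
  (* Many more coordinates than measurements: the frozen half of the speckled
     signal acts as noise, of precision about 1 / n. *)
  have mn : m%:R <= n%:R :> R by apply: le_trans nm; rewrite ler_peMl// ltW.
  have MxE : noise_level = n%:R ^+ 2.
    rewrite /noise_level (max_idPr (sq0 _ _ (ltW n0') mn (ltW m0'))).
    apply/max_idPr; rewrite sg4; apply: sq0 => //.
    by apply: ltW; apply: (lt_le_trans smn); rewrite ge_max mn lexx.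
  pose t1 := N * m%:R / n%:R.
  have t10 : 0 < t1 by rewrite divr_gt0// mulr_gt0.
  have t11 : t1 <= 1 by rewrite ler_pdivrMr// mul1r.
  have x00 : 0 < x0 by exact: lt_le_trans xm00.
  have h0 : (0 < size h)%N by rewrite -(ltn_pmul2l (m := 2))// muln0 (leq_trans n0 nh).
  have th : 8 * 49 ^+ 2 * m%:R <= t1 * (size h)%:R.
    have : (n%:R : R) <= 2 * (size h)%:R by rewrite -natrM ler_nat.
    move/(ler_wpM2l (ltW t10)) => H.
    have e : t1 * n%:R = 16 * 49 ^+ 2 * m%:R by rewrite /t1 mulfVK ?gt_eqF.
    move: H; rewrite e; move: (49 ^+ 2) => q H.
    by rewrite -(ler_pM2l (x := 2))//; apply: le_trans (le_trans H _); rewrite le_eqVlt; apply/orP; left; apply/eqP; ring.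
  pose tau := t1 / x0 ^+ 2.
  have goodE : good_design ax sg x0 h tau = [set v | small_inverse ax x0 (sg ^+ 2) t1 h v].
    have tE (a : R) : (a <= tau) = (x0 ^+ 2 * a <= t1).
      by rewrite /tau ler_pdivlMr ?exprn_gt0// mulrC.
    by apply/seteqP; split => v [uS trS]; split => //; rewrite ?tE// -tE.
  have mg : measurable (good_design ax sg x0 h tau).
    by rewrite goodE; exact: measurable_small_inverse.
  have pg : (mu (~` good_design ax sg x0 h tau) <= 8^-1%:E)%E.
    by rewrite goodE; apply: (small_inverse_prob nu_mu ax_inj ax_std).
  apply: (widen (96 * tau ^+ 2)).
    rewrite MxE /tau /t1 !expr_div_n.
    apply: (@le_trans _ _ (96 * N ^+ 2 / xmin ^+ 4 * (m%:R ^+ 2 / n%:R ^+ 2))); last first.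
      by rewrite ler_wpM2r// divr_ge0// sqr_ge0.
    rewrite -(exprM x0 2 2) exprMn.
    have : (x0 ^+ 4)^-1 <= (xmin ^+ 4)^-1.
      by rewrite lef_pV2 ?posrE ?exprn_gt0// lerXn2r ?nnegrE// ltW.
    have c0 : 0 <= 96 * N ^+ 2 * (m%:R ^+ 2 / n%:R ^+ 2).
      by apply: mulr_ge0; [rewrite mulr_ge0// sqr_ge0|rewrite divr_ge0// sqr_ge0].
    move/(ler_wpM2l c0); rewrite [leRHS]mulrAC => H; apply: le_trans H.
    by rewrite le_eqVlt; apply/orP; left; apply/eqP; ring.
  rewrite [96 * _ * D]mulrAC.
  exact: (good_design_test nu_mu ax_inj ix_inj ax_ix ax_std w_std z_std uh xh xh' d0 mg pg).
(* Many measurements: observing the speckled signal itself would not suffice. *)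
have mNm : m%:R <= N * m%:R by rewrite ler_peMl// ltW.
have Mx0 : 0 < noise_level by rewrite !lt_max; apply/or3P; apply: Or32; rewrite exprn_gt0.
have MxN : noise_level <= N ^+ 2 * m%:R ^+ 2.
  rewrite -exprMn !ge_max; apply/andP; split.
    rewrite sg4; apply: sq0 => //; first by rewrite mulr_ge0 ?ltW.
    by apply: ltW; apply: (lt_le_trans smn); rewrite ge_max mNm ltW.
  by apply/andP; split; apply: sq0; rewrite ?mulr_ge0//; exact: ltW.
apply: (widen (1 / xmin ^+ 4)).
  apply: (@le_trans _ _ (96 * N ^+ 2 / xmin ^+ 4 * (m%:R ^+ 2 / noise_level))); last first.
    by rewrite ler_wpM2r// divr_ge0 ?sqr_ge0// ltW.
  rewrite [leRHS](_ : _ = 96 * (N ^+ 2 * m%:R ^+ 2 / noise_level) / xmin ^+ 4); last by ring.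
  rewrite ler_pM2r ?invr_gt0//.
  have : 1 <= N ^+ 2 * m%:R ^+ 2 / noise_level by rewrite ler_pdivlMr// mul1r.
  lra.
have := scaling_test nu_mu sg ix_inj ax_ix w_std xm0 xm xm' t0 mB.
move/le_trans; apply; apply: leeD2r; rewrite lee_fin.
rewrite -[leLHS]add0r lerD ?divr_ge0// ler_pM2r// ler_wpM2l//.
by rewrite -mulr_suml div1r mulrC.
Qed.

End pair_test.

(** * From the statistical model to independent unit coordinates *)

Section entries.
Context {d : measure_display} {T : measurableType d} {R : realType}.
Variable P : probability T R.
Context {m n L : nat}.
Variables (A : 'I_m -> 'I_n -> {RV P >-> R}) (W : 'I_L -> 'I_n -> {RV P >-> R})
  (Z : 'I_L -> 'I_m -> {RV P >-> R}) (sg : R).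
Hypotheses (sg0 : 0 <= sg) (model : looks_model A W Z sg).

Let I : finType := (('I_m * 'I_n) + (('I_L * 'I_n) + ('I_L * 'I_m)))%type.

Definition design_entry (p : 'I_n * 'I_m) : I := inl (p.2, p.1).

Definition row_entry (p : ('I_n + 'I_m) * 'I_L) : I :=
  match p.1 with inl i => inr (inl (p.2, i)) | inr r => inr (inr (p.2, r)) end.

Let unit_scale : R := if sg == 0 then 1 else sg.

Let scale (i : I) : R := match i with inr (inr _) => unit_scale | _ => 1 end.

(** Entries of the noise are divided by sigma when it is nonzero; otherwise they
are almost surely zero and keep their law. *)
Definition entry_law (i : I) : probability R R :=
  match i with
  | inr (inr _) => centered_normal (if sg == 0 then 0 else 1)
  | _ => centered_normal 1
  end.

Definition unit_entries (t : T) : {ffun I -> R} :=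
  [ffun i => all_entries A W Z i t / scale i].

Lemma measurable_unit_entries : measurable_fun [set: T] unit_entries.
Proof.
apply: measurable_finfun => i; apply: measurable_funM => //.
Qed.

HB.instance Definition _ :=
  isMeasurableFun.Build _ _ _ _ unit_entries measurable_unit_entries.

Definition unit_entries_law : probability {ffun I -> R} R := distribution P unit_entries.

Let unit_scale_gt0 : 0 < unit_scale.
Proof. by rewrite /unit_scale; case: eqVneq => // n0; rewrite lt_def n0. Qed.

Let scaled_noise (U : set R) : measurable U ->
  centered_normal sg [set y | U (y / unit_scale)] =
  centered_normal (if sg == 0 then 0 else 1) U.
Proof.
move=> mU; rewrite /unit_scale; case: (eqVneq sg 0) => [->|sgn0].
  by congr (centered_normal _ _); apply/seteqP; split => y /=; rewrite divr1.
have sgp : 0 < sg by rewrite lt_def sgn0.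
have mV : measurable [set y | U (y / sg)].
  rewrite (_ : [set y | _] = (fun y : R => y / sg) @^-1` U)//.
  by rewrite -[X in measurable X]setTI; exact: (mulrr_measurable sg^-1).
have e (mu : probability R R) V : measurable V -> (mu V = \int[mu]_y (\1_V y)%:E)%E.
  by move=> mV'; rewrite integral_indic// setIT.
have mI : measurable_fun [set: R] (fun y => (\1_[set y | U (y / sg)] y : R)%:E).
  by apply/measurable_EFinP; exact: measurable_indic.
have I0 y : (0 <= (\1_[set y | U (y / sg)] y : R)%:E)%E by rewrite lee_fin.
transitivity (\int[centered_normal sg]_y (\1_[set y | U (y / sg)] y)%:E)%E.
  exact: (e (centered_normal sg : probability R R) _ mV).
rewrite (integral_scaled_normal sgp mI I0).
transitivity (\int[centered_normal 1]_y (\1_U y : R)%:E)%E; last first.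
  exact/esym/(e (centered_normal 1 : probability R R) _ mU).
apply: eq_integral => y _; rewrite !indicE; congr ((nat_of_bool _)%:R%:E).
by apply/idP/idP; rewrite !inE/= [sg * y]mulrC mulfK ?gt_eqF.
Qed.

(** Mutual independence, read on boxes. *)
Lemma unit_entries_product_law : product_law (fun i => entry_law i) unit_entries_law.
Proof.
move=> B mB; have [lA lW lZ ind] := model.
pose B' (i : I) := [set y : R | B i (y / scale i)].
have mB' i : measurable (B' i).
  rewrite (_ : B' i = (fun y : R => y / scale i) @^-1` B i)//.
  by rewrite -[X in measurable X]setTI; exact: (mulrr_measurable (scale i)^-1).
transitivity (P (\bigcap_i (all_entries A W Z i @^-1` B' i))).
  rewrite /unit_entries_law /distribution /pushforward; congr (P _).
  apply/seteqP; split => t /= H i.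
    by move=> _; have := H i; rewrite ffunE.
  by rewrite ffunE; exact: H.
rewrite ind//; apply: eq_bigr => i _.
have B1 (i' : I) : scale i' = 1 -> B' i' = B i'.
  by move=> s1; apply/seteqP; split => y; rewrite /B'/= s1 divr1.
case: i => [p|[p|p]].
- by have /= := lA p.1 p.2 _ (mB' (inl p)); rewrite B1.
- by have /= := lW p.1 p.2 _ (mB' (inr (inl p))); rewrite B1.
- have /= := lZ p.1 p.2 _ (mB' (inr (inr p))); rewrite /distribution /pushforward => ->.
  exact: scaled_noise.
Qed.


Lemma design_unit_entries t : forward_matrix A t = design design_entry (unit_entries t).
Proof. by apply/matrixP => r i; rewrite !mxE ffunE /= divr1. Qed.

Lemma looks_unit_entries (x : 'rV[R]_n) t : (sg = 0 -> forall l r, Z l r t = 0) ->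
  looks A W Z x t = observation design_entry row_entry sg (fun i => x 0 i) (unit_entries t).
Proof.
move=> Z0; apply/matrixP => r l.
rewrite mxE /look /observation /rowsum big_sumType/= [RHS]mxE [LHS]mxE; congr (_ + _).
  rewrite summxE [LHS]mxE; apply: eq_bigr => i _.
  rewrite mul_mx_diag !mxE big_ord1 !mxE !ffunE /= !divr1.
  by rewrite [_ * x 0 i]mulrC.
rewrite summxE (bigD1 r)//= big1 => [|r' rr'].
  rewrite addr0 !mxE big_ord1 !mxE !eqxx mulr1 ffunE /= /unit_scale.
  case: (eqVneq sg 0) => [s0|sn0]; first by rewrite s0 mul0r Z0.
  by rewrite mulrCA divff// mulr1.
by rewrite !mxE big_ord1 !mxE [r == r']eq_sym (negbTE rr')/= mulr0 mul0r.
Qed.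

(** When sigma = 0 the noise vanishes only almost surely, so the observation agrees with its
expression in the unit entries only almost everywhere. *)
Lemma noiseless_ae : sg = 0 -> {ae P, forall t, forall l r, Z l r t = 0}.
Proof.
have [_ _ lZ _] := model; move=> s0.
apply: filter_forall => l; apply: filter_forall => r.
have mU : measurable (~` [set (0 : R)]) by apply: measurableC; exact: measurable_set1.
exists (Z l r @^-1` (~` [set 0])); split.
- by rewrite -[X in measurable X]setTI; exact: measurable_funPT.
- have := lZ l r _ mU; rewrite /distribution /pushforward => ->.
  by rewrite /centered_normal s0 eqxx diracE memNset//= => /(_ erefl).
- by move=> t /= H.
Qed.

Lemma measurable_looks (x : 'rV[R]_n) :
  measurable_fun [set: T] (fun t => (looks A W Z x t, forward_matrix A t)).
Proof.
have mA : measurable_fun [set: T] (forward_matrix A).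
  apply: measurable_fun_matrix => i j.
  have -> : (fun t => forward_matrix A t i j) = A i j by apply/funext => t; rewrite mxE.
  exact: measurable_funPT.
apply: measurable_fun_pair => //.
apply: measurable_fun_matrix => i l.
have -> : (fun t => looks A W Z x t i l) = (fun t => look A W Z x l t i 0).
  by apply/funext => t; rewrite mxE.
apply: (measurableT_comp (measurable_entry i 0)); apply: measurable_addmx.
  apply: measurable_mulmx; first by apply: measurable_mulmx => //; exact: measurable_cst.
  apply: measurable_fun_matrix => u v.
  have -> : (fun t => speckle W l t u v) = W l u by apply/funext => t; rewrite mxE.
  exact: measurable_funPT.
apply: measurable_fun_matrix => u v.
have -> : (fun t => noise Z l t u v) = Z l u by apply/funext => t; rewrite mxE.
exact: measurable_funPT.
Qed.

Lemma integral_looks (x : 'rV[R]_n) (g : 'M[R]_(m, L) * 'M[R]_(m, n) -> \bar R) :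
  measurable_fun [set: 'M[R]_(m, L) * 'M[R]_(m, n)] g -> (forall y, 0 <= g y)%E ->
  (\int[P]_t g (looks A W Z x t, forward_matrix A t) =
  \int[unit_entries_law]_v g (data design_entry row_entry sg (fun i => x 0%R i) v))%E.
Proof.
move=> mg g0.
have mgd : measurable_fun setT
    (fun v => g (data design_entry row_entry sg (fun i => x 0 i) v)).
  by apply: (measurableT_comp mg); exact: measurable_data.
rewrite /unit_entries_law ge0_integral_distribution//.
apply: ae_eq_integral => //.
- exact: (measurableT_comp mg (measurable_looks x)).
- exact: (measurableT_comp mgd measurable_unit_entries).
case: (eqVneq sg 0) => [s0|sn0].
  apply: filterS (noiseless_ae s0) => t H _ /=.
  by rewrite /data -looks_unit_entries// -design_unit_entries.
apply: aeW => t _ /=; rewrite /data -looks_unit_entries -?design_unit_entries//.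
by move=> s0; rewrite s0 eqxx in sn0.
Qed.

End entries.

(** * Averaging over blocks *)

Section block_switching.
Context {R : realType} (k M : nat).
Local Notation codes := {ffun 'I_k -> 'I_M}.

Definition switch (th : codes) (b : 'I_k) (j : 'I_M) : codes :=
  [ffun b' => if b' == b then j else th b'].

(** The map (th, j) |-> (switch th b j, th b) is an involution. *)
Lemma sum_switch (F : codes -> R) (b : 'I_k) :
  \sum_th \sum_j F (switch th b j) = M%:R * \sum_th F th.
Proof.
rewrite pair_bigA/= mulr_sumr.
rewrite (reindex_inj (h := fun p : codes * 'I_M => (switch p.1 b p.2, p.1 b)))/=; last first.
  apply: (inv_inj (f := fun p : codes * 'I_M => (switch p.1 b p.2, p.1 b))) => -[th j] /=.
  congr pair; last by rewrite ffunE eqxx.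
  by apply/ffunP => b'; rewrite !ffunE; case: eqP => // ->.
rewrite (eq_bigr (fun p : codes * 'I_M => F p.1)) => [|[th j] _ /=].
  rewrite -(pair_bigA _ (fun th _ => F th))/=; apply: eq_bigr => th _.
  by rewrite sumr_const card_ord mulr_natl.
by congr F; apply/ffunP => b'; rewrite !ffunE; case: eqP => // ->.
Qed.

End block_switching.

Section assouad.
Context {R : realType} {I : finType} {m n L : nat}.
Local Notation omega := {ffun I -> R}.
Variables (nu : I -> probability R R) (mu : probability omega R).
Hypothesis nu_mu : product_law (fun i => nu i) mu.
Variables (ax : 'I_n * 'I_m -> I) (ix : ('I_n + 'I_m) * 'I_L -> I) (sg : R).
Hypotheses (ax_inj : injective ax) (ix_inj : injective ix).
Hypothesis ax_ix : forall p q, ax p != ix q.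
Hypothesis ax_std : forall p, standard nu (ax p).
Hypothesis w_std : forall i l, standard nu (ix (inl i, l)).
Hypothesis z_std : sg != 0 -> forall r l, standard nu (ix (inr r, l)).

Let probability_hit x B : R := fine (hit (m := m) (L := L) mu ax ix sg x B).

Let measurable_pre x B : measurable B -> measurable (data ax ix sg x @^-1` B : set omega).
Proof. by move=> mB; rewrite -[X in measurable X]setTI; exact: measurable_data. Qed.

Let hitE x B : measurable B ->
  hit mu ax ix sg x B = mu (data ax ix sg x @^-1` B).
Proof.
move=> mB; have mD := measurable_pre x mB.
by rewrite -[in RHS](setIT (_ @^-1` _)) -integral_indic.
Qed.

Let hit_fine x B : measurable B -> hit mu ax ix sg x B = (probability_hit x B)%:E.
Proof. by move=> mB; rewrite /probability_hit fineK// hitE//; apply: fin_num_measure; exact: measurable_pre. Qed.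

Variables (k M : nat) (blk : 'I_n -> option 'I_k) (y : 'I_M -> 'I_n -> R).
Variables (x0 xmin : R) (h : seq 'I_n) (r2 D : R).
Hypotheses (m0 : (0 < m)%N) (n0 : (0 < n)%N) (xm0 : 0 < xmin) (xmx0 : xmin <= x0).
Hypotheses (uh : uniq h) (nh : (n <= 2 * size h)%N).
Hypothesis blk_h : forall i, i \in h -> blk i = None.
Hypothesis y_min : forall j i, xmin <= y j i.
Hypothesis y_sum : forall b j, \sum_(i | blk i == Some b) (y j i ^+ 2 - x0 ^+ 2) = 0.
Hypothesis y_energy : forall b j, \sum_(i | blk i == Some b) (y j i ^+ 2 - x0 ^+ 2) ^+ 2 <= D.
Hypothesis y_sep : forall b j j', j != j' ->
  r2 <= \sum_(i | blk i == Some b) (y j i - y j' i) ^+ 2.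
Hypothesis r20 : 0 <= r2.
Hypotheses (M0 : (0 < M)%N) (M4 : 4 <= ln (M%:R : R)).
Hypothesis budget : L%:R * (information_constant xmin * D *
   (m%:R ^+ 2 / noise_level (m := m) (n := n) sg)) / 2 <= ln (M%:R : R) / 8.

Local Notation codes := {ffun 'I_k -> 'I_M}.

Definition block_signal (th : codes) (i : 'I_n) : R :=
  if blk i is Some b then y (th b) i else x0.

Let erased (th : codes) (b : 'I_k) (i : 'I_n) : R :=
  if blk i == Some b then x0 else block_signal th i.

Variable xhat : 'M[R]_(m, L) * 'M[R]_(m, n) -> 'rV[R]_n.
Hypothesis mxhat : measurable_fun setT xhat.

Let dist b j z : R := \sum_(i | blk i == Some b) (xhat z 0 i - y j i) ^+ 2.
Let S b j := [set z | dist b j z < r2 / 4].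

Let measurable_dist b j : measurable_fun setT (dist b j).
Proof.
rewrite /dist; under eq_fun do rewrite big_mkcond.
apply: measurable_sum => i; case: (blk i == Some b); last exact: measurable_cst.
apply: measurable_funX; apply: measurable_funB => //.
exact: (measurableT_comp (measurable_entry 0 i) mxhat).
Qed.

Let measurable_S b j : measurable (S b j).
Proof.
rewrite (_ : S b j = dist b j @^-1` `]-oo, (r2 / 4)[).
  by rewrite -[X in measurable X]setTI; exact: measurable_dist.
by apply/seteqP; split => z; rewrite /S/= in_itv.
Qed.

Let S_disjoint b j j' z : S b j z -> S b j' z -> j = j'.
Proof.
rewrite /S/= => dj dj'; apply/eqP/negPn/negP => jj'.
have := y_sep b jj'; rewrite leNgt => /negP; apply.
apply: (@le_lt_trans _ _ (2 * (dist b j z + dist b j' z))); last by lra.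
rewrite /dist -big_split/= mulr_sumr; apply: ler_sum => i _.
rewrite -subr_ge0.
have -> : 2 * ((xhat z 0 i - y j i) ^+ 2 + (xhat z 0 i - y j' i) ^+ 2) - (y j i - y j' i) ^+ 2 =
  (2 * xhat z 0 i - y j i - y j' i) ^+ 2 by ring.
exact: sqr_ge0.
Qed.

Let total_hit x b : \sum_j probability_hit x (S b j) <= 1.
Proof.
rewrite -lee_fin -sumEFin.
rewrite (eq_bigr (fun j => mu (data ax ix sg x @^-1` S b j))) => [|j _]; last first.
  by rewrite -hit_fine// hitE.
have mD j := measurable_pre x (measurable_S b j).
have tD : trivIset [set: 'I_M] (fun j => data ax ix sg x @^-1` S b j).
  by move=> j j' _ _ [v [/= Sj Sj']]; exact: S_disjoint Sj Sj'.
have mU : measurable (\big[setU/set0]_(j < M) (data ax ix sg x @^-1` S b j)).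
  by apply: bigsetU_measurable.
have := measure_semi_additive_ord mu mD tD mU.
by move=> /= <-; exact: probability_le1.
Qed.

Let ln_M_gt0 : 0 < ln (M%:R : R). Proof. by apply: lt_le_trans M4. Qed.

Let signal_min th i : xmin <= block_signal th i.
Proof. by rewrite /block_signal; case: (blk i). Qed.

Let erased_min th b i : xmin <= erased th b i.
Proof. by rewrite /erased; case: ifP. Qed.

Let erased_diff th b i : block_signal th i ^+ 2 - erased th b i ^+ 2 =
  if blk i == Some b then y (th b) i ^+ 2 - x0 ^+ 2 else 0.
Proof. by rewrite /erased /block_signal; case: eqP => [->|_]; rewrite ?subrr. Qed.

Let erased_switch th b j : erased (switch th b j) b = erased th b.
Proof.
apply/funext => i; rewrite /erased /block_signal; case: eqP => //.
by case: (blk i) => // b' bb'; rewrite ffunE; case: eqP => // e; case: bb'; rewrite e.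
Qed.

Let block_error th b :
  \sum_j probability_hit (block_signal (switch th b j)) (S b j) <= M%:R / 2.
Proof.
have M4' := M4; have bud := budget; have lnM := ln_M_gt0.
set t := ln (M%:R : R) in M4' bud lnM.
have et : expR t = M%:R by rewrite lnK ?posrE ?ltr0n.
have one j : t * probability_hit (block_signal (switch th b j)) (S b j) <=
    t / 4 + (M%:R - 1) * probability_hit (erased th b) (S b j).
  have swj : switch th b j b = j by rewrite ffunE eqxx.
  have d0 : \sum_i (block_signal (switch th b j) i ^+ 2 - erased th b i ^+ 2) = 0.
    under eq_bigr do rewrite -(erased_switch th b j) erased_diff.
    by rewrite -big_mkcond swj y_sum.
  have dD : \sum_i (block_signal (switch th b j) i ^+ 2 - erased th b i ^+ 2) ^+ 2 <= D.
    apply: le_trans (y_energy b j).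
    rewrite [leRHS]big_mkcond/=; apply: ler_sum => i _.
    rewrite -(erased_switch th b j) erased_diff swj.
    by case: ifP => // _; rewrite expr0n.
  have xh i : i \in h -> block_signal (switch th b j) i = x0.
    by move=> ih; rewrite /block_signal blk_h.
  have xh' i : i \in h -> erased th b i = x0.
    by move=> ih; rewrite /erased /block_signal blk_h.
  have := pair_test nu_mu ax_inj ix_inj ax_ix ax_std w_std z_std m0 n0 xm0
    (signal_min _) (erased_min th b) xmx0 uh nh xh xh' d0 (ltW lnM) (measurable_S b j).
  rewrite et !hit_fine// -!EFinM -EFinD lee_fin => /le_trans; apply.
  rewrite lerD2r; apply: (@le_trans _ _ (t / 8 + t / 8)); last by lra.
  rewrite lerD2l; apply: le_trans bud; rewrite ler_pM2r// ler_wpM2l//.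
  rewrite ler_wpM2r//; first by rewrite divr_ge0 ?sqr_ge0// !le_max sqr_ge0 orbT.
  rewrite ler_wpM2l// /information_constant addr_ge0// divr_ge0 ?exprn_ge0 ?(ltW xm0)//.
  by rewrite mulr_ge0// sqr_ge0.
rewrite -(ler_pM2l lnM) mulr_sumr; apply: (le_trans (ler_sum _ (fun j _ => one j))).
rewrite big_split/= sumr_const card_ord -[_ *+ M]mulr_natl -mulr_sumr.
have M1 : 1 <= M%:R :> R by rewrite ler1n.
have := total_hit (erased th b) b; set s := \sum_(_ < _) _ => s1.
have : (M%:R - 1) * s <= M%:R - 1 by rewrite ler_piMr// subr_ge0.
have : 4 * M%:R <= t * M%:R by rewrite ler_wpM2r.
set tM := t * M%:R; have -> : t * (M%:R / 2) = tM / 2 by rewrite mulrA.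
have -> : M%:R * (t / 4) = tM / 4 by rewrite mulrA [_ * t]mulrC.
by move: M1 {s1}; move: (M%:R : R) s tM => a s tM; lra.
Qed.

(** Averaging [block_error] over all codes, by [sum_switch], gives the
mean over the codes of the number of blocks that are guessed correctly. *)
Lemma hard_code : exists th : codes,
  \sum_b probability_hit (block_signal th) (S b (th b)) <= k%:R / 2.
Proof.
have M0' : 0 < M%:R :> R by rewrite ltr0n.
pose F b th := probability_hit (block_signal th) (S b (th b)).
have avg : \sum_(th : codes) \sum_b F b th <= \sum_(th : codes) k%:R / 2.
  rewrite exchange_big/=.
  have blockwise b : \sum_(th : codes) F b th <= \sum_(th : codes) 2^-1.
    rewrite -(ler_pM2l M0') -(sum_switch _ b) mulr_sumr; apply: ler_sum => th _.
    apply: le_trans (block_error th b); rewrite le_eqVlt; apply/orP; left; apply/eqP.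
    by apply: eq_bigr => j _; rewrite /F ffunE eqxx.
  apply: (le_trans (ler_sum _ (fun b _ => blockwise b))).
  by rewrite exchange_big/=; apply: ler_sum => th _; rewrite sumr_const card_ord -[leLHS]mulr_natl.
apply/not_existsP => none; move: avg; apply/negP; rewrite -ltNge.
have th0 : codes by exact: [ffun=> Ordinal M0].
apply: ltr_sum => [|th _]; first by apply/hasP; exists th0; rewrite ?mem_index_enum.
by rewrite ltNge; apply/negP/none.
Qed.

(** On each block that is not guessed correctly, the estimate is at squared
distance at least r2 / 4 from the signal. *)
Lemma assouad_lower_bound : exists th : codes,
  ((k%:R * r2 / 8)%:E <=
   \int[mu]_v (l2norm (xhat (data ax ix sg (block_signal th) v)
                - \row_i block_signal th i) ^+ 2)%:E)%E.
Proof.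
have [th hth] := hard_code; exists th.
set x := block_signal th in hth *.
pose miss b : set omega := ~` (data ax ix sg x @^-1` S b (th b)).
have mmiss b : measurable (miss b) by apply: measurableC; exact: measurable_pre.
have norm2E v : l2norm (xhat (data ax ix sg x v) - \row_i x i) ^+ 2 =
    \sum_i (xhat (data ax ix sg x v) 0 i - x i) ^+ 2.
  rewrite sqr_sqrtr; last by apply: sumr_ge0 => i _; exact: sqr_ge0.
  by apply: eq_bigr => i _; rewrite !mxE.
have mean b : mu.-integrable setT (EFin \o (fun v => r2 / 4 * \1_(miss b) v)) /\
    (\int[mu]_v (r2 / 4 * \1_(miss b) v)%:E)%E =
    (r2 / 4 * (1 - probability_hit x (S b (th b))))%:E.
  have ii := integrable_indic mu (mmiss b).
  split.
    rewrite (_ : _ \o _ = fun v => ((r2 / 4)%:E * (\1_(miss b) v)%:E)%E).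
      exact: integrableZl.
    by apply/funext => v.
  under eq_integral do rewrite EFinM.
  rewrite integralZl// integral_indic// setIT.
  have e : mu (miss b) = (1 - probability_hit x (S b (th b)))%:E.
    by rewrite EFinB -hit_fine// hitE//; apply: probability_setC; exact: measurable_pre.
  by apply: etrans (congr1 (fun z => (r2 / 4)%:E * z)%E e) _; rewrite -EFinM.
have [_ sumE] := integral_rsum (index_enum 'I_k) mean.
apply: (@le_trans _ _ (\int[mu]_v (\sum_b r2 / 4 * \1_(miss b) v)%:E)%E).
  rewrite sumE lee_fin -mulr_sumr sumrB sumr_const card_ord.
  apply: (@le_trans _ _ (r2 / 4 * (k%:R / 2))).
    by rewrite le_eqVlt; apply/orP; left; apply/eqP; field.
  by rewrite ler_wpM2l ?divr_ge0// lerBrDl -lerBrDr; move: hth; set s := \sum_(_ < _) _; lra.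
apply: ge0_le_integral => //.
- move=> v _; rewrite lee_fin; apply: sumr_ge0 => b _.
  by rewrite mulr_ge0// divr_ge0.
- apply/measurable_EFinP; apply: measurable_sum => b; exact: measurable_funM.
- apply/measurable_EFinP.
  rewrite (_ : (fun v : omega => _) =
    (fun v : omega => \sum_i (xhat (data ax ix sg x v) 0 i - x i) ^+ 2)); last exact/funext.
  apply: measurable_sum => i; apply: measurable_funX; apply: measurable_funB => //.
  apply: (measurableT_comp (measurable_entry 0 i)).
  by apply: (measurableT_comp mxhat); exact: measurable_data.
move=> v _; rewrite lee_fin norm2E.
set z := data _ _ _ _ _.
apply: (@le_trans _ _ (\sum_b \sum_(i | blk i == Some b) (xhat z 0 i - x i) ^+ 2)).
  apply: ler_sum => b _; rewrite indicE; case: (boolP (v \in miss b)) => [|_]; last first.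
    by rewrite mulr0; apply: sumr_ge0 => i _; exact: sqr_ge0.
  rewrite inE /miss /S /= => /negP; rewrite -leNgt mulr1 => /le_trans; apply.
  rewrite /dist le_eqVlt; apply/orP; left; apply/eqP; apply: eq_bigr => i /eqP bi.
  by rewrite /x /block_signal bi.
under eq_bigr do rewrite big_mkcond; rewrite exchange_big/=; apply: ler_sum => i _.
case E : (blk i) => [b|].
  rewrite (bigD1 b)//= eqxx big1 ?addr0// => b' bb'.
  by case: eqP => // -[e]; rewrite e eqxx in bb'.
by rewrite big1 ?sqr_ge0.
Qed.

End assouad.

(** * Walsh codewords on blocks of coordinates *)

Section walsh_code.
Context {R : realType}.

Fixpoint walsh (q a i : nat) : R :=
  if q is q'.+1 then walsh q' a./2 i./2 * (-1) ^+ (odd a && odd i) else 1.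

Lemma walsh0 q i : walsh q 0 i = 1.
Proof. by elim: q i => //= q IH i; rewrite IH mul1r. Qed.

Lemma walsh_sqr q a i : walsh q a i ^+ 2 = 1.
Proof.
elim: q a i => [|q IH] a i /=; first by rewrite expr1n.
by rewrite exprMn IH mul1r sqrr_sign.
Qed.

Lemma sum_double (F : nat -> R) N :
  \sum_(i < N.*2) F i = \sum_(i < N) (F i.*2 + F i.*2.+1).
Proof.
elim: N => [|N IH]; first by rewrite !big_ord0.
by rewrite doubleS 2!big_ord_recr/= IH big_ord_recr/= addrA.
Qed.

(** Summing over the last binary digit of i cancels the terms where a and a'
have distinct parities; the other digits are handled by induction. *)
Lemma walsh_orthogonal q a a' : (a < 2 ^ q)%N -> (a' < 2 ^ q)%N ->
  \sum_(i < 2 ^ q) walsh q a i * walsh q a' i = if a == a' then (2 ^ q)%:R else 0.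
Proof.
elim: q a a' => [|q IH] a a' aq aq'.
  rewrite expn0 big_ord1 /= mul1r; move: aq aq'; rewrite expn0 !ltnS !leqn0.
  by move=> /eqP-> /eqP->.
rewrite expnS mul2n (sum_double (fun i => walsh q.+1 a i * walsh q.+1 a' i)) /=.
have half b : (b < 2 ^ q.+1)%N -> (b./2 < 2 ^ q)%N by rewrite expnS mul2n; lia.
have step (i : nat) : walsh q a./2 i.*2./2 * (-1) ^+ (odd a && odd i.*2) *
      (walsh q a'./2 i.*2./2 * (-1) ^+ (odd a' && odd i.*2)) +
    walsh q a./2 (uphalf i.*2) * (-1) ^+ (odd a && ~~ odd i.*2) *
      (walsh q a'./2 (uphalf i.*2) * (-1) ^+ (odd a' && ~~ odd i.*2)) =
    (walsh q a./2 i * walsh q a'./2 i) * (1 + (-1) ^+ odd a * (-1) ^+ odd a').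
  rewrite odd_double !andbF !andbT doubleK uphalf_double !expr0 !mulr1; ring.
rewrite (eq_bigr _ (fun (i : 'I_(2 ^ q)) _ => step i)) -mulr_suml IH ?half//.
have -> : (a == a') = (a./2 == a'./2) && (odd a == odd a').
  by apply/eqP/andP => [->//|[/eqP h /eqP o]]; rewrite -(odd_double_half a) h o odd_double_half.
case: eqP => _ /=; last by rewrite mul0r.
case: (odd a) (odd a') => -[]/=; rewrite ?expr1 ?expr0 ?mulrN1 ?mulN1r ?opprK ?mulr1 ?subrr ?mulr0//.
- by rewrite -mul2n natrM mulrC.
- by rewrite -mul2n natrM mulrC.
Qed.

Lemma walsh_sum q a : (0 < a)%N -> (a < 2 ^ q)%N -> \sum_(i < 2 ^ q) walsh q a i = 0.
Proof.
move=> a0 aq; have := walsh_orthogonal aq (expn_gt0 2 q).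
rewrite gtn_eqF// => e; rewrite -[RHS]e; apply: eq_bigr => i _.
by rewrite walsh0 mulr1.
Qed.

Lemma walsh_energy q a : \sum_(i < 2 ^ q) walsh q a i ^+ 2 = (2 ^ q)%:R.
Proof. by under eq_bigr do rewrite walsh_sqr; rewrite sumr_const card_ord. Qed.

Lemma walsh_distance q a a' : (a < 2 ^ q)%N -> (a' < 2 ^ q)%N -> a != a' ->
  \sum_(i < 2 ^ q) (walsh q a i - walsh q a' i) ^+ 2 = 2 * (2 ^ q)%:R.
Proof.
move=> aq aq' aa'.
under eq_bigr do rewrite sqrrB !walsh_sqr.
rewrite big_split/= sumrB.
have := walsh_orthogonal aq aq'; rewrite (negbTE aa') => e.
rewrite sumrMnl e mul0rn subr0 sumr_const card_ord; ring.
Qed.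

End walsh_code.

Section blocks.
Context {R : realType} (n k q : nat).
Hypotheses (fits : (k * 2 ^ q <= n)%N).

Definition block_of (i : 'I_n) : option 'I_k := insub (i %/ 2 ^ q)%N.

Let B0 : (0 < 2 ^ q)%N. Proof. by rewrite expn_gt0. Qed.

Lemma block_ofP i b : (block_of i == Some b) = (i %/ 2 ^ q == b)%N.
Proof.
rewrite /block_of; case: insubP => [u ui e|]; first by rewrite -e.
by move=> /negP ui; apply/esym/negP => /eqP e; apply: ui; rewrite e.
Qed.

Lemma block_sum (f : nat -> R) b :
  \sum_(i | block_of i == Some b) f (i %% 2 ^ q)%N = \sum_(r < 2 ^ q) f r.
Proof.
have lt (r : 'I_(2 ^ q)) : (b * 2 ^ q + r < n)%N.
  have bk : (b.+1 * 2 ^ q <= k * 2 ^ q)%N by rewrite leq_mul2r ltn_ord orbT.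
  apply: leq_trans fits; apply: leq_trans bk.
  by rewrite mulSn addnC ltn_add2r ltn_ord.
rewrite (reindex_onto (fun r => Ordinal (lt r)) (fun i : 'I_n => Ordinal (ltn_pmod i B0)))/=.
  apply: eq_big => [r|r _]; last by rewrite modnMDl modn_small.
  rewrite block_ofP /= divnMDl// divn_small// addn0 eqxx/=.
  by apply/eqP/val_inj; rewrite /= modnMDl modn_small.
move=> i; rewrite block_ofP => /eqP e; apply: val_inj => /=.
by rewrite -e -divn_eq.
Qed.

Definition idle : seq 'I_n := [seq i <- index_enum 'I_n | block_of i == None].

Lemma idle_uniq : uniq idle.
Proof. by rewrite filter_uniq// index_enum_uniq. Qed.

Lemma idle_None i : i \in idle -> block_of i = None.
Proof. by rewrite mem_filter => /andP[/eqP]. Qed.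

Lemma size_idle : size idle = (n - k * 2 ^ q)%N.
Proof.
have idleE (i : 'I_n) : (block_of i == None) = (k * 2 ^ q <= i)%N.
  by rewrite /block_of leqNgt -ltn_divLR//; case: insubP => [u ->|/negbTE ->].
rewrite /idle size_filter -sum1_count (eq_bigl _ _ idleE).
rewrite -(big_mkord (fun i => (k * 2 ^ q <= i)%N) (fun=> 1%N)).
rewrite (big_cat_nat (leq0n _) fits)/= big_nat_cond big_pred0 => [|i].
  rewrite add0n big_nat_cond (eq_bigl (fun i => (k * 2 ^ q <= i < n)%N && true)) => [|i].
    by rewrite -big_nat_cond sum_nat_const_nat muln1.
  by case: (k * 2 ^ q <= i)%N; rewrite ?andbT ?andbF.
by case: ltnP; rewrite ?andbF.
Qed.

End blocks.

Section modulated_levels.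
Context {R : realType} (xmin xmax tau : R) (q : nat).
Hypotheses (xmin0 : 0 < xmin) (xmm : xmin < xmax) (tau0 : 0 <= tau).
Hypothesis tau_small : tau <= (xmax ^+ 2 - xmin ^+ 2) / 2.

Definition mid_level : R := Num.sqrt ((xmin ^+ 2 + xmax ^+ 2) / 2).

(** The squares of the signal coordinates, not the coordinates, are modulated: the
covariance of the data is affine in the squares. *)
Definition level (j r : nat) : R := Num.sqrt (mid_level ^+ 2 + tau * walsh q j.+1 r).

Let mid_sqr : mid_level ^+ 2 = (xmin ^+ 2 + xmax ^+ 2) / 2.
Proof. by rewrite sqr_sqrtr// divr_ge0// addr_ge0// sqr_ge0. Qed.

Let walsh_pm a r : -1 <= (walsh q a r : R) <= 1.
Proof.
have /eqP := walsh_sqr (R := R) q a r; rewrite sqrf_eq1 => /orP[] /eqP ->; lra.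
Qed.

Let level_bounds j r : xmin ^+ 2 <= mid_level ^+ 2 + tau * walsh q j.+1 r <= xmax ^+ 2.
Proof.
have /andP[w1 w2] := walsh_pm j.+1 r.
have : - tau <= tau * walsh q j.+1 r by rewrite -mulrN1 ler_wpM2l.
have : tau * walsh q j.+1 r <= tau by rewrite ler_piMr.
by rewrite mid_sqr; move: (tau * _) => u; move: tau_small; lra.
Qed.

Lemma level_sqr j r : level j r ^+ 2 - mid_level ^+ 2 = tau * walsh q j.+1 r.
Proof.
have /andP[h _] := level_bounds j r.
rewrite [level j r ^+ 2]sqr_sqrtr; last exact: le_trans (sqr_ge0 _) h.
by rewrite addrC addKr.
Qed.

Let sqrt_bounds u : xmin ^+ 2 <= u <= xmax ^+ 2 -> xmin <= Num.sqrt u <= xmax.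
Proof.
move=> /andP[u1 u2]; have xM : 0 <= xmax by exact: ltW (lt_trans xmin0 xmm).
apply/andP; split.
  by rewrite -[leLHS](ger0_norm (ltW xmin0)) -sqrtr_sqr ler_wsqrtr.
by rewrite -[leRHS](ger0_norm xM) -sqrtr_sqr ler_wsqrtr.
Qed.

Lemma level_range j r : xmin <= level j r <= xmax.
Proof. exact/sqrt_bounds/level_bounds. Qed.

Lemma mid_level_range : xmin <= mid_level <= xmax.
Proof.
have sq : xmin ^+ 2 <= xmax ^+ 2 by rewrite lerXn2r ?nnegrE ?ltW// (lt_trans xmin0).
by apply: sqrt_bounds; lra.
Qed.

(** (y - y')^2 = (y^2 - y'^2)^2 / (y + y')^2, and y + y' <= 2 xmax. *)
Lemma level_separation j j' : (j.+1 < 2 ^ q)%N -> (j'.+1 < 2 ^ q)%N -> j != j' ->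
  tau ^+ 2 * (2 ^ q)%:R / (2 * xmax ^+ 2) <=
  \sum_(r < 2 ^ q) (level j r - level j' r) ^+ 2.
Proof.
move=> jq jq' jj'; have xM : 0 < xmax by exact: lt_trans xmin0 xmm.
apply: (@le_trans _ _ (\sum_(r < 2 ^ q) tau ^+ 2 / (4 * xmax ^+ 2) *
    (walsh q j.+1 r - walsh q j'.+1 r) ^+ 2)).
  rewrite -mulr_sumr walsh_distance// le_eqVlt; apply/orP; left; apply/eqP.
  by field; rewrite gt_eqF.
apply: ler_sum => r _; rewrite mulrAC -exprMn mulrBr -!level_sqr opprB addrA subrK.
have /andP[a1 a2] := level_range j r; have /andP[b1 b2] := level_range j' r.
rewrite subr_sqr exprMn ler_pdivrMr ?mulr_gt0 ?exprn_gt0//.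
rewrite ler_wpM2l ?sqr_ge0//.
have -> : 4 * xmax ^+ 2 = (2 * xmax) ^+ 2 by ring.
by rewrite lerXn2r ?nnegrE//; move: xmin0 a1 a2 b1 b2; lra.
Qed.

End modulated_levels.

(** * Finite signal classes and the minimax risk *)

Section finite_classes.
Context {R : realType}.

Lemma covering_number_le n (C : set 'rV[R]_n) (eta B : R) (J : finType) (c : J -> 'rV[R]_n) :
  C `<=` \bigcup_j l2ball (c j) eta -> #|J|%:R <= B ->
  (covering_number eta C <= B%:E)%E.
Proof.
move=> cov JB; apply: (@le_trans _ _ (#|J|%:R%:E)%E); last by rewrite lee_fin.
apply: ereal_inf_lbound; exists #|J| => //; exists (fun i => c (enum_val i)).
move=> x /cov[j _ xj]; exists (enum_rank j) => //.
by rewrite enum_rankK.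
Qed.

(** Below the radius (xmax - xmin) sqrt n the points themselves are the centers,
and M eta <= (xmax - xmin) n <= a n^b; above it a single ball suffices. *)
Lemma finite_signal_class (xmin xmax a b : R) (k n M : nat) (J : finType)
    (c : J -> 'rV[R]_n) (j0 : J) :
  xmin < xmax -> xmax - xmin <= a -> 1 <= b -> (0 < n)%N ->
  (#|J| <= M ^ k)%N -> (M ^ 2 <= n)%N ->
  (forall j i, xmin <= c j 0 i <= xmax) ->
  signal_class xmin xmax a b k n (range c).
Proof.
move=> xx xa b1 n0 JM Mn cx; split.
- by exists (c j0), j0.
- by move=> _ [j _ <-].
move=> eta /andP[eta0 eta_le].
set w := xmax - xmin in xa; have w0 : 0 < w by rewrite subr_gt0.
have n0' : 0 < n%:R :> R by rewrite ltr0n.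
have s0 : 0 <= Num.sqrt n%:R :> R by exact: sqrtr_ge0.
have ss : Num.sqrt n%:R * Num.sqrt n%:R = n%:R :> R by rewrite -expr2 sqr_sqrtr// ltW.
have [small|large] := ltP eta (w * Num.sqrt n%:R).
  apply: (covering_number_le (c := c)).
    move=> _ [j _ <-]; exists j => //; rewrite /l2ball/= /l2norm.
    by rewrite big1 ?sqrtr0 ?ltW// => i _; rewrite !mxE subrr expr0n.
  apply: (@le_trans _ _ ((M ^ k)%:R)); first by rewrite ler_nat.
  have ab0 : 0 <= a * n%:R `^ b by exact: le_trans (ltW eta0) eta_le.
  have q0 : 0 <= a * n%:R `^ b / eta by rewrite divr_ge0// ltW.
  rewrite natrX; apply: lerXn2r; rewrite ?nnegrE ?ler0n//.
  rewrite ler_pdivlMr//.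
  have Ms : M%:R <= Num.sqrt n%:R :> R.
    by rewrite -(ger0_norm (ler0n R M)) -sqrtr_sqr ler_wsqrtr// -natrX ler_nat.
  apply: (@le_trans _ _ (Num.sqrt n%:R * (w * Num.sqrt n%:R))).
    by apply: ler_pM => //; exact: ltW.
  rewrite mulrCA ss; apply: ler_pM => //; first exact: ltW.
  by rewrite -[leLHS]powRr1// ler_powR// ler1n.
apply: (covering_number_le (c := fun=> c j0) (J := unit)); last first.
  by rewrite card_unit exprn_ege1// ler_pdivlMr// mul1r.
move=> _ [j _ <-]; exists tt => //; rewrite /l2ball/= /l2norm; apply: le_trans large.
have -> : w * Num.sqrt n%:R = Num.sqrt (\sum_(i < n) w ^+ 2).
  by rewrite sumr_const card_ord -[w ^+ 2 *+ n]mulr_natr sqrtrM ?sqr_ge0// sqrtr_sqr ger0_norm// ltW.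
apply: ler_wsqrtr; apply: ler_sum => i _; rewrite !mxE -[leLHS]real_normK ?num_real//.
apply: lerXn2r; rewrite ?nnegrE ?normr_ge0 ?(ltW w0)// ler_norml.
have /andP[a1 a2] := cx j i; have /andP[b1' b2] := cx j0 i.
by apply/andP; split; rewrite /w; lra.
Qed.

End finite_classes.

Lemma half_remains (n u : nat) : (2 * u <= n)%N -> (n <= 2 * (n - u))%N.
Proof. lia. Qed.

Section minimax.
Context {R : realType} {d : measure_display} {T : measurableType d}.
Variable P : probability T R.

(** The signals built from Walsh codewords on k blocks, with the energy of a
block equal to tau^2 2^q. *)
Lemma minimax_lower_bound (xmin xmax a b : R) (m n L k q M : nat) (tau sg : R)
    (A : 'I_m -> 'I_n -> {RV P >-> R}) (W : 'I_L -> 'I_n -> {RV P >-> R})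
    (Z : 'I_L -> 'I_m -> {RV P >-> R}) :
  0 < xmin -> xmin < xmax -> xmax - xmin <= a -> 1 <= b ->
  (0 < m)%N -> (0 < n)%N -> 0 <= sg -> looks_model A W Z sg ->
  (2 * (k * 2 ^ q) <= n)%N -> (0 < M)%N -> (M < 2 ^ q)%N -> (M ^ 2 <= n)%N ->
  4 <= ln (M%:R : R) -> 0 <= tau -> tau <= (xmax ^+ 2 - xmin ^+ 2) / 2 ->
  L%:R * (information_constant xmin * (tau ^+ 2 * (2 ^ q)%:R) *
   (m%:R ^+ 2 / noise_level (m := m) (n := n) sg)) / 2 <= ln (M%:R : R) / 8 ->
  ((k%:R * (tau ^+ 2 * (2 ^ q)%:R / (2 * xmax ^+ 2)) / 8 / n%:R)%:E <=
   ereal_sup [set minimax_risk A W Z C | C in signal_class xmin xmax a b k n])%E.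
Proof.
move=> xm0 xx xa b1 m0 n0 sg0 model fits2 M0 Mq Mn M4 tau0 taus budget.
have xM0 : 0 < xmax by exact: lt_trans xm0 xx.
have fits : (k * 2 ^ q <= n)%N by apply: leq_trans fits2; rewrite leq_pmull.
pose blk : 'I_n -> option 'I_k := @block_of n k q.
pose y (j : 'I_M) (i : 'I_n) : R := level xmin xmax tau q j (i %% 2 ^ q)%N.
pose x0 := mid_level xmin xmax.
have /andP[x01 x02] : xmin <= x0 <= xmax by exact: mid_level_range.
have y_range j i : xmin <= y j i <= xmax by exact: level_range.
pose signal (th : {ffun 'I_k -> 'I_M}) : 'rV[R]_n := \row_i block_signal blk y x0 th i.
pose C := range signal.
have jq (j : 'I_M) : (j.+1 < 2 ^ q)%N by apply: leq_ltn_trans Mq.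
have yE j i : y j i ^+ 2 - x0 ^+ 2 = tau * walsh q j.+1 (i %% 2 ^ q)%N by exact: level_sqr.
have CS : signal_class xmin xmax a b k n C.
  apply: (@finite_signal_class _ _ _ _ _ _ _ M _ signal [ffun=> Ordinal M0]) => //.
    by rewrite card_ffun !card_ord.
  move=> th i; rewrite mxE /block_signal; case: (blk i) => [b'|]; first exact: y_range.
  by rewrite x01 x02.
apply: (@le_trans _ _ (minimax_risk A W Z C)); last first.
  by apply: ereal_sup_ubound; exists C.
apply: le_ereal_inf_tmp => _ [xhat _ <-].
have nu_mu := unit_entries_product_law sg0 model.
have y_min j i : xmin <= y j i by have /andP[] := y_range j i.
have nh : (n <= 2 * size (idle n k q))%N.
  by rewrite size_idle//; exact: half_remains.
have bsum (F : nat -> R) (b' : 'I_k) :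
  \sum_(i | blk i == Some b') F (i %% 2 ^ q)%N = \sum_(r < 2 ^ q) F r := block_sum fits F b'.
have y_sum b' j : \sum_(i | blk i == Some b') (y j i ^+ 2 - x0 ^+ 2) = 0.
  under eq_bigr do rewrite yE.
  by rewrite (bsum (fun r => tau * walsh q j.+1 r)) -mulr_sumr walsh_sum ?mulr0.
have y_energy b' j : \sum_(i | blk i == Some b') (y j i ^+ 2 - x0 ^+ 2) ^+ 2 <=
    tau ^+ 2 * (2 ^ q)%:R.
  under eq_bigr do rewrite yE exprMn.
  by rewrite (bsum (fun r => tau ^+ 2 * walsh q j.+1 r ^+ 2)) -mulr_sumr walsh_energy.
have y_sep b' (j j' : 'I_M) : j != j' -> tau ^+ 2 * (2 ^ q)%:R / (2 * xmax ^+ 2) <=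
    \sum_(i | blk i == Some b') (y j i - y j' i) ^+ 2.
  move=> jj'.
  rewrite (bsum (fun r => (level xmin xmax tau q j r - level xmin xmax tau q j' r) ^+ 2)).
  exact: level_separation.
have r20 : 0 <= tau ^+ 2 * (2 ^ q)%:R / (2 * xmax ^+ 2).
  by apply: divr_ge0; apply: mulr_ge0 => //; exact: sqr_ge0.
have ax_inj : injective (design_entry (m := m) (n := n) (L := L)).
  by move=> [i r] [i' r'] [-> ->].
have ix_inj : injective (row_entry (m := m) (n := n) (L := L)).
  by move=> [[i|r] l] [[i'|r'] l'] // [-> ->].
have ax_ix (p : 'I_n * 'I_m) (p' : ('I_n + 'I_m) * 'I_L) :
  design_entry (m := m) (n := n) (L := L) p != row_entry p' by case: p' => [[]].
have z_std : sg != 0 -> forall (r : 'I_m) (l : 'I_L),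
    standard (entry_law (m := m) (n := n) (L := L) sg) (row_entry (inr r, l)).
  by move=> sgn0 r l; rewrite /standard /= (negbTE sgn0).
have mxhat : measurable_fun setT xhat by exact: measurable_funPT.
have [th hth] := assouad_lower_bound nu_mu ax_inj ix_inj ax_ix (fun=> erefl)
  (fun _ _ => erefl) z_std m0 n0 xm0 x01 (idle_uniq n k q) nh (@idle_None n k q)
  y_min y_sum y_energy y_sep r20 M0 M4 budget mxhat.
apply: (@le_trans _ _ (mean_squared_error A W Z xhat (signal th))); last first.
  by apply: ereal_sup_ubound; exists (signal th) => //; exists th.
rewrite /mean_squared_error unlock.
have n0' : 0 < n%:R :> R by rewrite ltr0n.
pose g (z : 'M[R]_(m, L) * 'M[R]_(m, n)) := (l2norm (xhat z - signal th) ^+ 2)%:E : \bar R.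
have mg : measurable_fun setT g.
  apply/measurable_EFinP.
  rewrite (_ : (fun z : 'M[R]_(m, L) * 'M[R]_(m, n) => _) =
      (fun z => \sum_i (xhat z 0 i - signal th 0 i) ^+ 2)).
    apply: measurable_sum => i; apply: measurable_funX; apply: measurable_funB => //.
    exact: (measurableT_comp (measurable_entry 0 i) mxhat).
  apply/funext => z; rewrite sqr_sqrtr; last by apply: sumr_ge0 => i _; exact: sqr_ge0.
  by apply: eq_bigr => i _; rewrite !mxE.
have g0 z : (0 <= g z)%E by rewrite lee_fin sqr_ge0.
have -> : (\int[P]_t (l2norm (xhat (looks A W Z (signal th) t, forward_matrix A t) -
    signal th) ^+ 2 / n%:R)%:E =
  (n%:R^-1)%:E * \int[P]_t g (looks A W Z (signal th) t, forward_matrix A t))%E.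
  rewrite -ge0_integralZl//.
  - by apply: eq_integral => t _; rewrite /g -EFinM mulrC.
  - exact: (measurableT_comp mg (measurable_looks A W Z (signal th))).
rewrite (integral_looks model _ mg g0) [X in (X%:E <= _)%E]mulrC EFinM.
apply: lee_wpmul2l; first by rewrite lee_fin invr_ge0.
apply: le_trans hth _; rewrite le_eqVlt; apply/orP; left; apply/eqP.
have -> : (fun i => signal th 0 i) = block_signal blk y x0 th.
  by apply/funext => i; rewrite mxE.
by [].
Qed.

End minimax.

(** * Asymptotics *)

Section code_parameters.
Context {R : realType}.

Lemma block_length (n k : nat) : (0 < k)%N -> (2 * k <= n)%N ->
  exists q, (2 * (k * 2 ^ q) <= n)%N /\ (n <= 4 * (k * 2 ^ q))%N.
Proof.
move=> k0 kn; have s0 : (0 < n./2 %/ k)%N by rewrite divn_gt0//; lia.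
exists (trunc_log 2 (n./2 %/ k)).
have /(leq_mul (leqnn k)) lo := trunc_logP (leqnn 2) s0.
have /(leq_mul (leqnn k)) hi := trunc_log_ltn (n./2 %/ k) (leqnn 2).
have := leq_divM n./2 k; have := ltn_ceil n./2 k0.
move: lo hi; rewrite expnS [(_ %/ k * k)%N]mulnC [(_.+1 * k)%N]mulnC.
rewrite mulnA [(k * 2)%N]mulnC -mulnA.
by move: (k * (2 ^ _))%N (k * (n./2 %/ k))%N (k * (n./2 %/ k).+1)%N => a b c; lia.
Qed.

(** With w = n^(eps / 2), the hypothesis on k gives k w^4 <= n. Then M is the integer part
of w^2, which is at least w, and the block length is at least w^4 / 4 > M. *)
Lemma code_parameters (eps : R) (n k : nat) : 0 < eps -> (0 < n)%N -> (0 < k)%N ->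
  12 <= eps * ln n%:R -> k%:R <= n%:R `^ (1 - 2 * eps) ->
  exists q M : nat, [/\ (2 * (k * 2 ^ q) <= n)%N, (n <= 4 * (k * 2 ^ q))%N,
    (0 < M)%N /\ (M < 2 ^ q)%N, (M ^ 2 <= n)%N &
    eps / 2 * ln n%:R <= ln (M%:R : R)].
Proof.
move=> e0 n0 k0 big kn; have n0' : 0 < n%:R :> R by rewrite ltr0n.
have k0' : 1 <= k%:R :> R by rewrite ler1n.
set l := ln n%:R in big *; set w := expR (eps / 2 * l).
have w7 : 7 <= w.
  apply: le_trans (expR_ge1Dx _); move: big; rewrite mulrAC; lra.
have kw : k%:R * w ^+ 4 <= n%:R.
  apply: (@le_trans _ _ (n%:R `^ (1 - 2 * eps) * w ^+ 4)).
    by rewrite ler_wpM2r// exprn_ge0// expR_ge0.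
  rewrite /powR gt_eqF// -/l /w -expRM_natl -expRD.
  have -> : (1 - 2 * eps) * l + 4 * (eps / 2 * l) = l by field.
  by rewrite lnK.
have w2 : 7 * w <= w ^+ 2 by rewrite expr2 ler_wpM2r// (le_trans _ w7).
have w4 : 49 * w ^+ 2 <= w ^+ 4.
  rewrite (_ : w ^+ 4 = w ^+ 2 * w ^+ 2); last by ring.
  by rewrite ler_wpM2r ?sqr_ge0//; lra.
have [q [lo hi]] : exists q, (2 * (k * 2 ^ q) <= n)%N /\ (n <= 4 * (k * 2 ^ q))%N.
  apply: block_length => //; rewrite -(ler_nat R) natrM.
  have : k%:R * 2 <= k%:R * w ^+ 4 by rewrite ler_wpM2l//; lra.
  lra.
have /truncn_itv /andP[M1 M2] : 0 <= w ^+ 2 by exact: sqr_ge0.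
set M := Num.truncn _ in M1 M2; exists q, M.
have M0 : 1 < M%:R :> R by rewrite -[X in _ < X](addrK 1) -natr1 in M2 *; lra.
split => //.
- split; first by move: M0; rewrite ltr1n => /ltnW.
  rewrite -(ltr_nat R).
  have : n%:R <= 4 * (k%:R * (2 ^ q)%:R) :> R by rewrite -!natrM ler_nat.
  move=> hi'; apply: le_lt_trans M1 _.
  have : k%:R * w ^+ 4 <= k%:R * (4 * (2 ^ q)%:R) by apply: (le_trans kw); lra.
  rewrite ler_pM2l ?(lt_le_trans _ k0')//; lra.
- rewrite -(ler_nat R) natrX; apply: le_trans kw.
  have : M%:R ^+ 2 <= (w ^+ 2) ^+ 2 by rewrite lerXn2r ?nnegrE ?sqr_ge0.
  by rewrite -exprM => /le_trans; apply; rewrite ler_peMl// exprn_ge0// expR_ge0.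
- rewrite -[leLHS]expRK ler_ln ?posrE ?expR_gt0 ?(lt_trans _ M0)//.
  by move: M2; rewrite -natr1 -/w; lra.
Qed.

End code_parameters.

Theorem theorem2p15 (R : realType) (xmin xmax eps : R)
    (hxmin : 0 < xmin) (hx : xmin < xmax) (heps : 0 < eps < 1 / 2) :
  exists2 c : R, 0 < c &
  forall (a b : R), xmax - xmin <= a -> 1 <= b ->
  forall (m L k : nat -> nat) (sigma : nat -> R),
    (forall n, (0 < n)%N ->
       [/\ (0 < m n)%N, (0 < L n)%N, (0 < k n)%N & 0 <= sigma n]) ->
    (fun n => ln (m n)%:R : R^o) =O_\oo (fun n => ln n%:R : R^o) ->
    (fun n => ln n%:R : R^o) =O_\oo (fun n => ln (m n)%:R : R^o) ->
    (fun n => ln (L n)%:R : R^o) =O_\oo (fun n => ln n%:R : R^o) ->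
    (forall n, (0 < n)%N -> (k n)%:R <= n%:R `^ (1 - 2 * eps)) ->
    (forall n, (0 < n)%N ->
       Num.max (sigma n ^+ 4) (Num.max ((m n)%:R ^+ 2) (n%:R ^+ 2))
         * (k n)%:R * ln n%:R
       <= (m n)%:R ^+ 2 * n%:R `^ (1 - eps) * (L n)%:R) ->
  exists N : nat, forall n, (N <= n)%N ->
  forall (d : measure_display) (T : measurableType d) (P : probability T R)
    (A : 'I_(m n) -> 'I_n -> {RV P >-> R})
    (W : 'I_(L n) -> 'I_n -> {RV P >-> R})
    (Z : 'I_(L n) -> 'I_(m n) -> {RV P >-> R}),
    looks_model A W Z (sigma n) ->
    ((c * (Num.max (sigma n ^+ 4) (Num.max ((m n)%:R ^+ 2) (n%:R ^+ 2))
           * (k n)%:R * ln n%:R / ((m n)%:R ^+ 2 * n%:R * (L n)%:R)))%:E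
     <= ereal_sup [set minimax_risk A W Z C
                  | C in signal_class xmin xmax a b (k n) n])%E.
Proof.
have xM0 : 0 < xmax by exact: lt_trans hxmin hx.
have /andP[e0 e1] := heps.
pose C0 := information_constant xmin.
have C00 : 0 < C0.
  rewrite /C0 /information_constant ltr_wpDl// divr_ge0 ?exprn_ge0 ?(ltW hxmin)//.
  by rewrite mulr_ge0// sqr_ge0.
(* The largest modulation that keeps the squared levels between xmin^2 and xmax^2. *)
pose g := (xmax ^+ 2 - xmin ^+ 2) / 2.
have g0 : 0 < g by rewrite divr_gt0// subr_gt0 ltrXn2r ?nnegrE ?ltW.
(* The first bound keeps the divergence below ln M / 8, the second one keeps tau
   below g. *)
pose c1 := Num.min (eps / (4 * C0)) (g ^+ 2).
have c10 : 0 < c1.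
  by rewrite lt_min; apply/andP; split; [rewrite divr_gt0// mulr_gt0|rewrite exprn_gt0].
have c1e : c1 * C0 <= eps / 4.
  apply: (@le_trans _ _ (eps / (4 * C0) * C0)).
    by rewrite ler_pM2r// ge_min lexx.
  by rewrite le_eqVlt; apply/orP; left; apply/eqP; field; rewrite gt_eqF.
have c1g : c1 <= g ^+ 2 by rewrite ge_min lexx orbT.
exists (c1 / (64 * xmax ^+ 2)); first by rewrite divr_gt0// mulr_gt0// exprn_gt0.
move=> a b xa b1 m L k sigma pos _ _ _ hk hrate.
(* From this rank on n^(eps / 2) >= e^6, so that ln M >= 4. *)
exists (Num.truncn (expR (12 / eps))).+1 => n Nn d T P A W Z model.
have n0 : (0 < n)%N by exact: leq_trans Nn.
have [m0 L0 k0 sg0] := pos n n0.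
have n0' : 0 < n%:R :> R by rewrite ltr0n.
have big : 12 <= eps * ln n%:R.
  rewrite mulrC -ler_pdivrMr// -[leLHS]expRK ler_ln ?posrE ?expR_gt0//.
  have /truncn_itv /andP[_ /ltW /le_trans] := ltW (expR_gt0 (12 / eps)).
  by apply; rewrite ler_nat.
have [q [M [lo hi [M0 Mq] Mn lnM]]] := code_parameters e0 n0 k0 big (hk n n0).
set Mx := Num.max _ _.
have m0' : 0 < (m n)%:R :> R by rewrite ltr0n.
have L0' : 0 < (L n)%:R :> R by rewrite ltr0n.
have k0' : 0 < (k n)%:R :> R by rewrite ltr0n.
have Mx0 : 0 < Mx by rewrite !lt_max; apply/or3P; apply: Or32; rewrite exprn_gt0.
have ln0 : 0 < ln n%:R :> R by rewrite -(pmulr_rgt0 _ e0); apply: lt_le_trans big.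
have den0 : 0 < (m n)%:R ^+ 2 * n%:R * (L n)%:R :> R by rewrite !mulr_gt0// exprn_gt0.
pose del := Mx * (k n)%:R * ln n%:R / ((m n)%:R ^+ 2 * n%:R * (L n)%:R).
have del0 : 0 < del by rewrite divr_gt0// !mulr_gt0.
have del1 : del <= 1.
  rewrite ler_pdivrMr// mul1r; apply: le_trans (hrate n n0) _.
  rewrite ler_pM2r// ler_pM2l ?exprn_gt0//.
  rewrite -[leRHS]powRr1; last exact: ltW.
  by apply: ler_powR; [rewrite ler1n|move: e0; lra].
pose tau := Num.sqrt (c1 * del).
have tau2 : tau ^+ 2 = c1 * del by rewrite sqr_sqrtr// mulr_ge0// ltW.
have taug : tau <= g.
  rewrite -[leRHS](ger0_norm (ltW g0)) -sqrtr_sqr ler_wsqrtr//.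
  by apply: le_trans c1g; rewrite ler_piMr// ltW.
have hi' : n%:R <= 4 * ((k n)%:R * (2 ^ q)%:R) :> R by rewrite -!natrM ler_nat.
have lo' : 2 * ((k n)%:R * (2 ^ q)%:R) <= n%:R :> R by rewrite -!natrM ler_nat.
have M4 : 4 <= ln (M%:R : R) by apply: le_trans lnM; move: big; rewrite mulrAC; lra.
have budget : (L n)%:R * (C0 * (tau ^+ 2 * (2 ^ q)%:R) *
   ((m n)%:R ^+ 2 / noise_level (m := m n) (n := n) (sigma n))) / 2 <= ln (M%:R : R) / 8.
  rewrite -[noise_level _]/Mx tau2.
  have -> : (L n)%:R * (C0 * (c1 * del * (2 ^ q)%:R) * ((m n)%:R ^+ 2 / Mx)) / 2 =
      (c1 * C0) * ln n%:R * (((k n)%:R * (2 ^ q)%:R) / n%:R) / 2.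
    by rewrite /del; field; rewrite !gt_eqF.
  apply: (@le_trans _ _ (eps / 4 * ln n%:R * 2^-1 / 2)); last first.
    by move: lnM; rewrite mulrAC; lra.
  rewrite ler_pM2r//; apply: ler_pM.
  - by rewrite !mulr_ge0// ltW.
  - by rewrite divr_ge0// ?mulr_ge0// ltW.
  - by rewrite ler_pM2r.
  - by rewrite ler_pdivrMr// ler_pdivlMl.
apply: le_trans (minimax_lower_bound hxmin hx xa b1 m0 n0 sg0 model lo M0 Mq Mn M4
  (sqrtr_ge0 _) taug budget).
rewrite lee_fin tau2 -/del.
have -> : (k n)%:R * (c1 * del * (2 ^ q)%:R / (2 * xmax ^+ 2)) / 8 / n%:R =
  c1 / (64 * xmax ^+ 2) * del * (4 * ((k n)%:R * (2 ^ q)%:R) / n%:R).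
  by field; rewrite !gt_eqF.
rewrite ler_peMr//; last by rewrite ler_pdivlMr// mul1r.
by rewrite mulr_ge0 ?(ltW del0)// divr_ge0 ?(ltW c10)// mulr_ge0// sqr_ge0.
Qed.
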